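(* Let $T>0$ and let $H,L:[0,T]\to\mathbb{C}^{N\times N}$ be continuous Hermitian-matrix-valued functions with $L(t)\succeq 0$ for all $t\in[0,T]$, and set $A(t)=L(t)+\mathrm{i}H(t)$. Let $\alpha_{\max}(t)$ be the largest eigenvalue of $L(t)$ and $\eta_{\max}=\int_0^T\alpha_{\max}(t)\,\mathrm{d}t$. Let $a>0$ be real with $\eta_{\max}\le 2\pi a$, let $m\ge 1$, and let $p_1,\dots,p_m\in\mathbb{C}$ be pairwise distinct complex numbers such that $p_r\neq -\mathrm{i}$ for all $r$ and $p_r\notin\{k/a: k\in\mathbb{Z}\}$ for all $r$. Then \[ \mathcal{T}\mathrm{e}^{-\int_{0}^{T}A(s)\mathrm{d}s} -\frac{1}{a}\sum_{k\in\mathbb{Z}}\frac{(\mathrm{e}^{-2\pi a}-1)\,\mathcal{T}\mathrm{e}^{-\mathrm{i}\int_{0}^{T}(H(s)+\frac{k}{a}L(s))\mathrm{d}s}}{2\pi\mathrm{i}\left(\frac{k}{a}+\mathrm{i}\right)\prod_{r=1}^{m}\frac{k/a-p_{r}}{-\mathrm{i}-p_{r}}} -\sum_{r=1}^{m}\frac{(\mathrm{e}^{-2\pi a}-1)\,\mathcal{T}\mathrm{e}^{-\mathrm{i}\int_{0}^{T}(H(s)+p_{r}L(s))\mathrm{d}s}}{(\mathrm{e}^{-2\pi \mathrm{i} p_{r} a}-1)\prod_{r'\neq r}\frac{p_r-p_{r'}}{-\mathrm{i}-p_{r'}}}=0 . \]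
   Context: For a continuous matrix-valued function $B:[0,T]\to\mathbb{C}^{N\times N}$, the time-ordered exponential $\mathcal{T}\mathrm{e}^{-\int_0^T B(s)\,\mathrm{d}s}$ denotes $V(T)$, where $V$ is the unique solution of $\frac{\mathrm{d}V}{\mathrm{d}t}=-B(t)V(t)$, $V(0)=I$. In the terms above, $B(s)=A(s)$, or $B(s)=\mathrm{i}(H(s)+zL(s))$ with $z=k/a$ or $z=p_r$ (complex in general). $L(t)\succeq 0$ means $L(t)$ is positive semidefinite. *)

(* Defs.v *)
From HB Require Import structures.
From mathcomp Require Import all_boot all_order all_algebra.
From mathcomp Require Import all_classical all_reals all_analysis.
From mathcomp Require Import complex.
From Stdlib Require Import ClassicalEpsilon.
Import Order.TTheory GRing.Theory Num.Theory.
Import numFieldTopology.Exports numFieldNormedType.Exports.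

Set Implicit Arguments.
Unset Strict Implicit.
Unset Printing Implicit Defensive.

Local Open Scope ring_scope.
Local Open Scope complex_scope.
Local Open Scope classical_set_scope.

(* The complex numbers over R, with their (norm) topology. *)
Definition Cx (R : rcfType) : numClosedFieldType := R[i].

Definition cexp (R : realType) (z : Cx R) : Cx R :=
  ((expR (complex.Re z))%:C * (cos (complex.Im z) +i* sin (complex.Im z)))%C.

Definition adjmx (R : rcfType) (m n : nat) (M : 'M[Cx R]_(m, n)) : 'M[Cx R]_(n, m) :=
  \matrix_(i, j) conjc (M j i).

Definition hermitian_mx (R : rcfType) (N : nat) (M : 'M[Cx R]_N) : Prop :=
  adjmx M = M.

Definition psd_mx (R : rcfType) (N : nat) (M : 'M[Cx R]_N) : Prop :=
  forall v : 'cV[Cx R]_N, 0 <= (adjmx v *m M *m v) ord0 ord0.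

Definition mx_deriv_within (R : realType) (N : nat) (D : set R)
    (V : R -> 'M[Cx R]_N) (t : R) (dV : 'M[Cx R]_N) : Prop :=
  forall i j,
    (fun s => (V s i j - V t i j) / (s - t)%:C) @ within (D `\` [set t]) (nbhs t)
      --> (dV i j : Cx R).

Definition texp_sol (R : realType) (N : nat) (B : R -> 'M[Cx R]_N) (T : R)
    (V : R -> 'M[Cx R]_N) : Prop :=
  V 0 = 1%:M /\
  forall t, 0 <= t <= T -> mx_deriv_within `[0, T] V t (- (B t *m V t)).

(* time-ordered exponential  T exp(- int_0^T B(s) ds) := V(T) *)
Definition texp (R : realType) (N : nat) (B : R -> 'M[Cx R]_N) (T : R) : 'M[Cx R]_N :=
  epsilon (inhabits (fun _ : R => (1%:M : 'M[Cx R]_N))) (texp_sol B T) T.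

Definition zseries_to (R : realType) (N : nat) (F : int -> 'M[Cx R]_N)
    (S : 'M[Cx R]_N) : Prop :=
  exists S1 S2 : 'M[Cx R]_N,
    (forall i j, (fun n : nat => (\sum_(k < n) F (Posz k)) i j) @ \oo --> (S1 i j : Cx R)) /\
    (forall i j, (fun n : nat => (\sum_(k < n) F (- (Posz k.+1))) i j) @ \oo --> (S2 i j : Cx R)) /\
    S = S1 + S2.

(* Main.v *)
Require Import Defs.
From HB Require Import structures.
From mathcomp Require Import all_boot all_order all_algebra.
From mathcomp Require Import all_classical all_reals all_analysis.
From mathcomp Require Import complex.
From mathcomp Require Import ring lra.
From Stdlib Require ClassicalEpsilon.
Import Order.TTheory GRing.Theory Num.Theory.
Import numFieldTopology.Exports numFieldNormedType.Exports.

(* Put U(z) = T exp(- i int_0^T (H + z L)), so that the first term of the formula is U(- i).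
   The formula is linear in U, and for U(z) = exp(- i z x) with 0 <= x <= 2 pi a it is, after a
   partial fraction expansion of the kernel, a Fourier series whose coefficients are differences
   of two simple poles; that series is the limit of an exact finite identity, the discrete Fourier
   inversion of a geometric sequence.
   A Trotter product, in which exp(- i z dl L(tau)) is expanded spectrally, is a finite sum of
   exponentials exp(- i z x) C. Choosing the node tau of each step by the mean value theorem makes
   the largest frequency equal to int alpha_max <= 2 pi a. These products are bounded uniformly in
   real z and converge to U(z) for every complex z, and the summands decay like 1 / k^2,
   so Tannery's theorem transfers the formula to U. No contour integration is needed. *)

Set Implicit Arguments.
Unset Strict Implicit.
Unset Printing Implicit Defensive.

Local Open Scope ring_scope.
Local Open Scope classical_set_scope.

(** * Complex numbers and their exponential *)

(** Three obstacles shape the construction. A series over a single pole 1 / (k - W) converges only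
    conditionally; the kernel, however, splits into differences of two poles, because its residues
    at - i and at the p_r cancel: the Lagrange weights at - i add up to 1. Moreover each quotient
    exp(- i W y) / (exp(- 2 pi i W) - 1) changes by the same amount 1 between y = 0 and y = 2 pi, so
    for a difference both endpoints of the frequency interval are admissible. Equality int alpha_max
    = 2 pi a is allowed as well, so a Riemann sum that merely approximates the integral could push a
    frequency out of this interval; hence the mean value nodes. Finally, the points z = k / a are
    unbounded, and the error estimates of the Trotter products degrade with |z|. The factor of L is
    therefore kept as an exact exponential, unitary for real z, and only the factor of H is replaced
    by 1 - i dl H, whose departure from unitarity is of order dl^2 and independent of z. This gives
    a bound uniform in k, and pointwise convergence is then enough. *)

(* Injections and projections restated with carrier [Cx R]: mixing the canonical instances of
   [R[i]] and of [Cx R], which are merely convertible, defeats rewriting. *)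
Definition rC (R : rcfType) (x : R) : Cx R := x%:C%C.
Definition Ci (R : rcfType) : Cx R := 'i%R.
Arguments Ci {R}.
Definition Cre (R : rcfType) (z : Cx R) : R := complex.Re z.
Definition Cim (R : rcfType) (z : Cx R) : R := complex.Im z.
Definition cconj (R : rcfType) (z : Cx R) : Cx R := conjc z.
Definition cnorm (R : rcfType) (z : Cx R) : R := Cre `|z|.

Fact rC_is_additive (R : rcfType) : additive (@rC R).
Proof. by move=> x y; exact: (rmorphB (real_complex R)). Qed.
Fact rC_is_multiplicative (R : rcfType) : multiplicative (@rC R).
Proof. by split=> [x y|]; [exact: (rmorphM (real_complex R))|]. Qed.
HB.instance Definition _ (R : rcfType) :=
  GRing.isAdditive.Build R (Cx R) (@rC R) (@rC_is_additive R).
HB.instance Definition _ (R : rcfType) :=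
  GRing.isMultiplicative.Build R (Cx R) (@rC R) (@rC_is_multiplicative R).

Fact cconj_is_additive (R : rcfType) : additive (@cconj R).
Proof. by move=> x y; exact: (rmorphB (@conjc R)). Qed.
Fact cconj_is_multiplicative (R : rcfType) : multiplicative (@cconj R).
Proof. by split=> [x y|]; [exact: (rmorphM (@conjc R))|exact: (rmorph1 (@conjc R))]. Qed.
HB.instance Definition _ (R : rcfType) :=
  GRing.isAdditive.Build (Cx R) (Cx R) (@cconj R) (@cconj_is_additive R).
HB.instance Definition _ (R : rcfType) :=
  GRing.isMultiplicative.Build (Cx R) (Cx R) (@cconj R) (@cconj_is_multiplicative R).

Section Cnorm.
Variable R : rcfType.
Implicit Types z w : Cx R.

Lemma rCI : injective (@rC R). Proof. exact: complexI. Qed.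

Lemma ler_rC (x y : R) : (rC x <= rC y) = (x <= y). Proof. exact: lecR. Qed.
Lemma ltr_rC (x y : R) : (rC x < rC y) = (x < y). Proof. exact: ltcR. Qed.

Lemma ReIm_eq z w : Cre z = Cre w -> Cim z = Cim w -> z = w.
Proof. by case: z w => [a b] [c d] /= ; rewrite /Cre /Cim /= => -> ->. Qed.

Lemma ReD z w : Cre (z + w) = Cre z + Cre w.
Proof. by case: z w => [a b] [c d]. Qed.
Lemma ImD z w : Cim (z + w) = Cim z + Cim w.
Proof. by case: z w => [a b] [c d]. Qed.
Lemma ReN z : Cre (- z) = - Cre z.
Proof. by case: z. Qed.
Lemma ImN z : Cim (- z) = - Cim z.
Proof. by case: z. Qed.
Lemma ReM z w : Cre (z * w) = Cre z * Cre w - Cim z * Cim w.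
Proof. by case: z w => [a b] [c d]. Qed.
Lemma ImM z w : Cim (z * w) = Cre z * Cim w + Cim z * Cre w.
Proof. by case: z w => [a b] [c d]. Qed.
Lemma Re_i : Cre (Ci : Cx R) = 0. Proof. by rewrite /Ci -complexiE. Qed.
Lemma Im_i : Cim (Ci : Cx R) = 1. Proof. by rewrite /Ci -complexiE. Qed.
Lemma Re_rC (x : R) : Cre (rC x) = x. Proof. by []. Qed.
Lemma Im_rC (x : R) : Cim (rC x) = 0. Proof. by []. Qed.
Lemma Re0 : Cre (0 : Cx R) = 0. Proof. by []. Qed.
Lemma Im0 : Cim (0 : Cx R) = 0. Proof. by []. Qed.
Lemma Re1 : Cre (1 : Cx R) = 1. Proof. by []. Qed.
Lemma Im1 : Cim (1 : Cx R) = 0. Proof. by []. Qed.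
Lemma ReJ z : Cre (cconj z) = Cre z. Proof. by case: z. Qed.
Lemma ImJ z : Cim (cconj z) = - Cim z. Proof. by case: z. Qed.

Definition ReImE := (ReD, ImD, ReN, ImN, ReM, ImM, Re_i, Im_i, Re_rC, Im_rC,
  Re0, Im0, Re1, Im1, ReJ, ImJ).

Lemma CiCi : Ci * Ci = -1 :> Cx R.
Proof. by apply: ReIm_eq; rewrite !ReImE; ring. Qed.

Lemma ReImK z : z = rC (Cre z) + Ci * rC (Cim z).
Proof. by apply: ReIm_eq; rewrite !ReImE; ring. Qed.

Lemma Re_sum (I : Type) (r : seq I) (P : pred I) (F : I -> Cx R) :
  Cre (\sum_(i <- r | P i) F i) = \sum_(i <- r | P i) Cre (F i).
Proof. exact: (big_morph _ ReD Re0). Qed.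
Lemma Im_sum (I : Type) (r : seq I) (P : pred I) (F : I -> Cx R) :
  Cim (\sum_(i <- r | P i) F i) = \sum_(i <- r | P i) Cim (F i).
Proof. exact: (big_morph _ ImD Im0). Qed.

Lemma normE z : `|z| = rC (cnorm z).
Proof. by rewrite /cnorm normc_def. Qed.

Lemma cnormE z : cnorm z = Num.sqrt ((Cre z) ^+ 2 + (Cim z) ^+ 2).
Proof. by rewrite /cnorm normc_def. Qed.

Lemma cnorm_ge0 z : 0 <= cnorm z.
Proof. by rewrite cnormE sqrtr_ge0. Qed.

Lemma cnormM z w : cnorm (z * w) = cnorm z * cnorm w.
Proof. by apply/rCI; rewrite rmorphM /= -!normE normrM. Qed.

Lemma cnormD z w : cnorm (z + w) <= cnorm z + cnorm w.
Proof. by rewrite -ler_rC rmorphD /= -!normE ler_normD. Qed.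

Lemma cnormN z : cnorm (- z) = cnorm z.
Proof. by rewrite /cnorm normrN. Qed.

Lemma cnorm0 : cnorm (0 : Cx R) = 0.
Proof. by rewrite /cnorm normr0. Qed.

Lemma cnorm1 : cnorm (1 : Cx R) = 1.
Proof. by rewrite /cnorm normr1. Qed.

Lemma cnorm_eq0 z : (cnorm z == 0) = (z == 0).
Proof.
apply/eqP/eqP => [h|->]; last exact: cnorm0.
by apply/eqP; rewrite -normr_eq0 normE h.
Qed.

Lemma cnorm_gt0 z : (0 < cnorm z) = (z != 0).
Proof. by rewrite lt_def cnorm_ge0 andbT cnorm_eq0. Qed.

Lemma cnormV z : cnorm z^-1 = (cnorm z)^-1.
Proof. by apply/rCI; rewrite fmorphV /= -!normE normfV. Qed.

Lemma cnormB z w : cnorm (z - w) = cnorm (w - z).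
Proof. by rewrite -cnormN opprB. Qed.

Lemma cnorm_real (x : R) : cnorm (rC x) = `|x|.
Proof. by rewrite cnormE !ReImE expr0n /= addr0 sqrtr_sqr. Qed.

Lemma cnormi : cnorm (Ci : Cx R) = 1.
Proof. by rewrite cnormE !ReImE expr0n /= add0r expr1n sqrtr1. Qed.

Lemma cnormJ z : cnorm (cconj z) = cnorm z.
Proof. by rewrite !cnormE !ReImE sqrrN. Qed.

Lemma ler_cnormB z w : cnorm z - cnorm w <= cnorm (z - w).
Proof. by rewrite lerBlDr; apply: le_trans (cnormD _ _); rewrite subrK. Qed.

Lemma le_Re z : `|Cre z| <= cnorm z.
Proof. by rewrite cnormE -sqrtr_sqr ler_wsqrtr// lerDl sqr_ge0. Qed.

Lemma le_Im z : `|Cim z| <= cnorm z.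
Proof. by rewrite cnormE -sqrtr_sqr ler_wsqrtr// lerDr sqr_ge0. Qed.

Lemma cnorm_ReIm z : cnorm z <= `|Cre z| + `|Cim z|.
Proof.
rewrite [X in cnorm X](ReImK z); apply: le_trans (cnormD _ _) _.
by rewrite cnormM !cnorm_real cnormi mul1r.
Qed.

Lemma cnorm_sum (I : Type) (r : seq I) (P : pred I) (F : I -> Cx R) :
  cnorm (\sum_(i <- r | P i) F i) <= \sum_(i <- r | P i) cnorm (F i).
Proof.
elim/big_ind2 : _ => [|x x' y y' h h'|//]; first by rewrite cnorm0.
by apply: le_trans (cnormD _ _) (lerD h h').
Qed.

Lemma sqr_cnorm z : (cnorm z) ^+ 2 = (Cre z) ^+ 2 + (Cim z) ^+ 2.
Proof. by rewrite cnormE sqr_sqrtr// addr_ge0// sqr_ge0. Qed.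

Lemma mulJ z : z * cconj z = rC ((cnorm z) ^+ 2).
Proof. by apply: ReIm_eq; rewrite ?sqr_cnorm !ReImE; ring. Qed.

End Cnorm.

Section Cexp.
Variable R : realType.
Implicit Types z w : Cx R.

Lemma Re_cexp z : Cre (cexp z) = expR (Cre z) * cos (Cim z).
Proof. by rewrite /Cre /cexp /= mul0r subr0. Qed.
Lemma Im_cexp z : Cim (cexp z) = expR (Cre z) * sin (Cim z).
Proof. by rewrite /Cre /Cim /cexp /= mul0r addr0. Qed.

End Cexp.

Lemma rC_divn (R : rcfType) (x : R) (n : nat) : rC (x / n%:R) = rC x / n%:R.
Proof. by rewrite rmorphM fmorphV /= rmorph_nat. Qed.

(** * The exponential: functional equation and elementary estimates *)

Section CexpTheory.
Variable R : realType.
Implicit Types z w : Cx R.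

Lemma cexpD z w : cexp (z + w) = cexp z * cexp w.
Proof.
by apply: ReIm_eq; rewrite !(Re_cexp, Im_cexp, ReImE) expRD ?cosD ?sinD; ring.
Qed.

Lemma cexp0 : cexp (0 : Cx R) = 1.
Proof.
by apply: ReIm_eq; rewrite !(Re_cexp, Im_cexp, ReImE) expR0 ?cos0 ?sin0; ring.
Qed.

Lemma cexpMn z n : cexp (z *+ n) = cexp z ^+ n.
Proof. by elim: n => [|n IH]; rewrite ?mulr0n ?cexp0// mulrS exprS cexpD IH. Qed.

Lemma cnorm_cexp z : cnorm (cexp z) = expR (Cre z).
Proof.
rewrite cnormE Re_cexp Im_cexp !exprMn -mulrDr cos2Dsin2 mulr1 sqrtr_sqr.
by rewrite ger0_norm ?expR_ge0.
Qed.

Lemma cexp_neq0 z : cexp z != 0.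
Proof. by rewrite -cnorm_eq0 cnorm_cexp gt_eqF// expR_gt0. Qed.

Lemma cexpN z : cexp (- z) = (cexp z)^-1.
Proof.
by apply: (mulfI (cexp_neq0 z)); rewrite -cexpD subrr cexp0 divff// cexp_neq0.
Qed.

Lemma cexp_real (x : R) : cexp (rC x) = rC (expR x).
Proof.
by apply: ReIm_eq; rewrite !(Re_cexp, Im_cexp, ReImE) ?cos0 ?sin0; ring.
Qed.

Lemma cexp_2pii : cexp (rC (2 * pi) * Ci : Cx R) = 1.
Proof.
apply: ReIm_eq; rewrite !(Re_cexp, Im_cexp, ReImE) !(mul0r, mulr0, subr0, mulr1, addr0) expR0.
- by rewrite mulr_natl cos2pi mulr1.
- by rewrite mulr_natl sin2pi mulr0.
Qed.

(** The real part is cos x = 1 - 2 sin^2 (x/2), and sin (x/2) > 0 on the open period. *)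
Lemma cexp_im_neq1 (x : R) : 0 < x < 2 * pi -> cexp (rC x * Ci : Cx R) != 1.
Proof.
move=> /andP[x0 x2]; apply/eqP => /(congr1 (@Cre _)).
rewrite !(Re_cexp, Im_cexp, ReImE) !(mul0r, mulr0, subr0, mulr1, addr0) expR0 mul1r => h.
have s0 : 0 < sin (x / 2) by apply: sin_gt0_pi; rewrite ?divr_gt0// ltr_pdivrMr// mulrC.
have : cos x = 1 - 2 * sin (x / 2) ^+ 2.
  rewrite [in LHS](_ : x = x / 2 + x / 2); last by field.
  by rewrite cosD -!expr2 cos2sin2; ring.
rewrite h => e; have : 0 < sin (x / 2) ^+ 2 by rewrite exprn_gt0.
by lra.
Qed.

Lemma sin_mvt (x : R) : 0 < x -> exists2 c, 0 < c < x & sin x = cos c * x.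
Proof.
move=> x0.
have h1 (y : R) : y \in `]0, x[%R -> is_derive y 1 sin (cos y).
  by move=> _; exact: is_derive_sin.
have h2 : {within `[0, x], continuous (@sin R)}.
  by apply: continuous_subspaceT; exact: continuous_sin.
have [c] := MVT x0 h1 h2.
by rewrite in_itv/= sin0 !subr0 => cx e; exists c.
Qed.

Lemma norm_sin_le_pos (x : R) : 0 <= x -> `|sin x| <= x.
Proof.
move=> x0; have [->|/eqP xn0] := eqVneq x 0; first by rewrite sin0 normr0.
have xp : 0 < x by rewrite lt_def x0 andbT; apply/eqP.
have [c _ ->] := sin_mvt xp; rewrite normrM (ger0_norm x0) ler_piMl// ler_norml.
by rewrite cos_geN1 cos_le1.
Qed.

Lemma norm_sin_le (x : R) : `|sin x| <= `|x|.
Proof.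
have [x0|x0] := ger0P x; first exact: norm_sin_le_pos.
by rewrite -normrN -sinN; apply: norm_sin_le_pos; rewrite oppr_ge0 ltW.
Qed.

Lemma cos_sqr_le (x : R) : 0 <= 1 - cos x <= x ^+ 2 / 2.
Proof.
have -> : 1 - cos x = 2 * sin (x / 2) ^+ 2.
  rewrite [in LHS](_ : x = x / 2 + x / 2); last by field.
  by rewrite cosD -!expr2 cos2sin2; ring.
rewrite mulr_ge0 ?sqr_ge0//=.
have : sin (x / 2) ^+ 2 <= (x / 2) ^+ 2.
  by rewrite -[leLHS]real_normK ?num_real// -[leRHS]real_normK ?num_real// ler_sqr ?nnegrE//
    norm_sin_le.
by lra.
Qed.

(** A quadratic bound suffices for [cexp_sub_le]. It follows from sin x = x cos c with c between 0
    and x, combined with [cos_sqr_le]. *)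
Lemma sin_sub_le (x : R) : `|x| <= 1 -> `|sin x - x| <= x ^+ 2.
Proof.
have P (y : R) : 0 < y -> y <= 1 -> `|sin y - y| <= y ^+ 2.
  move=> y0 y1.
  have [c cy ->] := sin_mvt y0.
  have -> : cos c * y - y = - ((1 - cos c) * y) by ring.
  have /andP[c0 c2] := cos_sqr_le c.
  rewrite normrN normrM (ger0_norm c0) (gtr0_norm y0) expr2 ler_pM2r//.
  apply: le_trans c2 _.
  by move: cy => /andP[cp cy]; nra.
move=> x1; have [x0|x0|<-] := ltgtP 0 x; last by rewrite sin0 subrr normr0 expr0n.
- by apply: P => //; rewrite (le_trans (ler_norm _)).
- have := P (- x); rewrite sinN sqrrN -opprD normrN; apply; first by rewrite oppr_gt0.
  by rewrite (le_trans (ler_norm _))// normrN.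
Qed.

(** Both bounds come from exp(x) >= 1 + x: used at x it gives the lower one, used at - x it gives (1
    - x) exp(x) <= 1, hence the upper one. *)
Lemma expR_sub_le (x : R) : `|x| <= 2^-1 -> 0 <= expR x - 1 - x <= 2 * x ^+ 2.
Proof.
move=> x1; have := expR_ge1Dx x; have := expR_ge1Dx (- x).
rewrite expRN => h1 h2; apply/andP; split; first by lra.
have e0 := expR_gt0 x.
have h3 : (1 - x) * expR x <= 1.
  by rewrite -ler_pdivlMr// mul1r.
move: x1; rewrite ler_norml => /andP[xa xb].
nra.
Qed.

(** The second-order bound behind every first-order approximation below. Writing z = x + i y splits
    the remainder into three pieces, each at most 2 |z|^2; the constant 8 is not sharp. *)
Lemma cexp_sub_le z : cnorm z <= 2^-1 -> cnorm (cexp z - 1 - z) <= 8 * cnorm z ^+ 2.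
Proof.
move=> z1; have hR := le_trans (le_Re z) z1; have hI := le_trans (le_Im z) z1.
set x := Cre z in hR *; set y := Cim z in hI *.
have -> : cexp z - 1 - z = (rC (expR x - 1 - x)) * (cexp (rC y * Ci))
    + rC x * (cexp (rC y * Ci) - 1) + (cexp (rC y * Ci) - 1 - rC y * Ci).
  have -> : cexp z = rC (expR x) * cexp (rC y * Ci).
    by rewrite [in LHS](ReImK z) cexpD cexp_real mulrC (mulrC Ci) mulrC.
  by rewrite [X in _ - X](ReImK z) -/x -/y !rmorphB /= rmorph1; ring.
have ce : cnorm (cexp (rC y * Ci)) = 1.
  by rewrite cnorm_cexp !ReImE !(mulr0, mul0r) subr0 expR0.
have b1 : cnorm (cexp (rC y * Ci) - 1 - rC y * Ci) <= 2 * y ^+ 2.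
  apply: le_trans (cnorm_ReIm _) _.
  rewrite !(Re_cexp, Im_cexp, ReImE) !(mulr0, mul0r, subr0, mulr1, addr0) expR0 !mul1r.
  have /andP[c0 c1] := cos_sqr_le y.
  rewrite distrC (ger0_norm c0).
  have := @sin_sub_le y; have : `|y| <= 1 by lra.
  by move=> /[swap] /[apply]; have := sqr_ge0 y; lra.
have b2 : cnorm (cexp (rC y * Ci) - 1) <= 2 * `|y|.
  have -> : cexp (rC y * Ci) - 1 = (cexp (rC y * Ci) - 1 - rC y * Ci) + rC y * Ci by ring.
  apply: le_trans (cnormD _ _) _.
  rewrite [X in _ + X]cnormM cnorm_real cnormi mulr1.
  apply: (le_trans (lerD b1 (lexx _))).
  have : y ^+ 2 <= 2^-1 * `|y|.
    by rewrite -real_normK ?num_real// expr2 ler_wpM2r.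
  by lra.
have /andP[b3 b4] := expR_sub_le hR.
apply: le_trans (cnormD _ _) _.
apply: le_trans (lerD (cnormD _ _) (lexx _)) _.
rewrite (cnormM (rC _) (cexp _)) (cnormM (rC x) (_ - _)) ce mulr1 !cnorm_real (ger0_norm b3).
have xn : `|x| <= cnorm z := le_Re z.
have yn : `|y| <= cnorm z := le_Im z.
have x2 : x ^+ 2 <= cnorm z ^+ 2.
  by rewrite -[leLHS]real_normK ?num_real// ler_sqr ?nnegrE// cnorm_ge0.
have y2 : y ^+ 2 <= cnorm z ^+ 2.
  by rewrite -[leLHS]real_normK ?num_real// ler_sqr ?nnegrE// cnorm_ge0.
have xy : `|x| * cnorm (cexp (rC y * Ci) - 1) <= cnorm z * (2 * cnorm z).
  apply: ler_pM => //; first exact: cnorm_ge0.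
  by apply: le_trans b2 _; rewrite ler_pM2l.
rewrite expr2 in x2 y2 *; nra.
Qed.

Lemma cexp_sub1_le w : cnorm w <= 2^-1 -> cnorm (cexp w - 1) <= 5 * cnorm w.
Proof.
move=> h1; have h3 := cexp_sub_le h1.
have -> : cexp w - 1 = (cexp w - 1 - w) + w by ring.
apply: le_trans (cnormD _ _) _.
have := cnorm_ge0 w; move: h3; rewrite expr2; nra.
Qed.

(* Jordan's inequality, from sin u = 2 sin (u/2) cos (u/2) >= u cos^2 (u/2) *)
Lemma sin_ge_half (u : R) : 0 <= u <= pi / 2 -> u / 2 <= sin u.
Proof.
move=> /andP[]; rewrite le_eqVlt => /predU1P[<- _|u0 u2]; first by rewrite sin0 mul0r.
have pi0 := @pi_gt0 R.
have v0 : 0 < u / 2 by lra.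
have cv : 0 <= cos (u / 2) by apply: cos_ge0_pihalf; apply/andP; split; lra.
have sv : u / 2 * cos (u / 2) <= sin (u / 2).
  have [c /andP[c0 c1] ->] := sin_mvt v0.
  rewrite mulrC ler_pM2r// leNgt ltr_cos ?in_itv/= -?leNgt; lra.
have h : u / 2 * cos (u / 2) ^+ 2 <= sin (u / 2) * cos (u / 2).
  by rewrite expr2 mulrA ler_wpM2r.
have e : sin u = 2 * (sin (u / 2) * cos (u / 2)).
  by rewrite [in LHS](_ : u = u / 2 + u / 2); [rewrite sinD; ring|field].
have c2 : cos u = 2 * cos (u / 2) ^+ 2 - 1.
  rewrite [in LHS](_ : u = u / 2 + u / 2); last by field.
  by rewrite cosD -!expr2 sin2cos2; ring.
have cu : 0 <= cos u by apply: cos_ge0_pihalf; apply/andP; split; lra.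
by rewrite e; nra.
Qed.

(** The modulus is 2 |sin (t/2)|, to which [sin_ge_half] applies on |t| <= pi. It keeps the
    denominators of the discrete kernel away from zero in [dterm_bound]. *)
Lemma cexp_sub1_ge (t : R) : `|t| <= pi -> `|t| / 4 <= cnorm (cexp (rC t * Ci) - 1).
Proof.
move=> tpi.
have e : cexp (rC t * Ci) - 1 = rC (2 * sin (t / 2)) * (Ci * cexp (rC (t / 2) * Ci)).
  rewrite [in LHS](_ : t = t / 2 + t / 2); last by field.
  have c1 : cos (t / 2) ^+ 2 = 1 - sin (t / 2) ^+ 2 := cos2sin2 _.
  apply: ReIm_eq; rewrite !(Re_cexp, Im_cexp, ReImE) !(mulr0, mul0r, subr0, mulr1, addr0, add0r)
    expR0 !mul1r.
  - by rewrite cosD -!expr2 c1; ring.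
  - by rewrite sinD; ring.
rewrite e cnormM cnormM cnormi mul1r cnorm_cexp !ReImE !(mulr0, mul0r) subr0 expR0 mulr1.
rewrite cnorm_real normrM ger0_norm//.
have -> : `|sin (t / 2)| = `|sin (`|t| / 2)|.
  by have [//|_] := ger0P t; rewrite mulNr sinN normrN.
have := @sin_ge_half (`|t| / 2).
have := ler_norm (sin (`|t| / 2)); have := normr_ge0 t.
move=> h1 h2 h3; have : `|t| / 2 / 2 <= sin (`|t| / 2) by apply: h3; lra.
by lra.
Qed.

End CexpTheory.

(** * Limits of complex sequences and a Fourier series *)

(** Here epsilon ranges over [R] and not over the positive elements of [Cx R], so that real
    arithmetic tactics apply; [climP] identifies this with convergence along [\oo]. *)
Definition clim (R : realType) (u : nat -> Cx R) (l : Cx R) :=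
  forall e : R, 0 < e -> exists n0, forall n, (n0 <= n)%N -> cnorm (u n - l) < e.

Section Clim.
Variable R : realType.
Implicit Types (u v : nat -> Cx R) (l z w : Cx R).

Lemma climP u l : clim u l <-> u @ \oo --> l.
Proof.
split => [h|/cvgrPdist_lt h].
  apply/cvgrPdist_lt => e e0.
  have eE : e = rC (Cre e) by apply: ReIm_eq => //; rewrite Im_rC; exact: (ger0_Im (ltW e0)).
  have re0 : 0 < Cre e by move: e0; rewrite eE -[0]/(rC 0) ltr_rC.
  have [n0 hn] := h _ re0.
  exists n0 => // n /= n0n; rewrite distrC normE eE ltr_rC; exact: hn.
move=> e e0.
have e0' : 0 < rC e by rewrite -[0]/(rC 0) ltr_rC.
have [n0 _ hn] := h _ e0'.
exists n0 => n n0n; have := hn n n0n.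
by rewrite /= distrC normE ltr_rC.
Qed.

Lemma clim_cst l : clim (fun=> l) l.
Proof. by move=> e e0; exists 0%N => n _; rewrite subrr cnorm0. Qed.

Lemma climD u v l l' : clim u l -> clim v l' -> clim (fun n => u n + v n) (l + l').
Proof.
move=> h h' e e0; have e2 : 0 < e / 2 by rewrite divr_gt0.
have [n0 hn] := h _ e2; have [n1 hn'] := h' _ e2.
exists (maxn n0 n1) => n; rewrite geq_max => /andP[/hn a /hn' b].
rewrite opprD addrACA; apply: le_lt_trans (cnormD _ _) _; lra.
Qed.

Lemma climM u v l l' : clim u l -> clim v l' -> clim (fun n => u n * v n) (l * l').
Proof.
move=> h h' e e0.
pose B := cnorm l + cnorm l' + 1.
have B0 : 0 < B by have := cnorm_ge0 l; have := cnorm_ge0 l'; rewrite /B; lra.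
have e1 : 0 < Num.min 1 (e / (2 * B)) by rewrite lt_min ltr01 divr_gt0 ?mulr_gt0.
have [n0 hn] := h _ e1; have [n1 hn'] := h' _ e1.
exists (maxn n0 n1) => n; rewrite geq_max => /andP[/hn + /hn'].
rewrite !lt_min !ltr_pdivlMr ?mulr_gt0// => /andP[a1 a2] /andP[b1 b2].
have -> : u n * v n - l * l' = (u n - l) * (v n - l' + l') + l * (v n - l') by ring.
apply: le_lt_trans (cnormD _ _) _; rewrite !cnormM.
have c : cnorm (v n - l' + l') <= B.
  by apply: le_trans (cnormD _ _) _; have := cnorm_ge0 l; rewrite /B; lra.
have d1 : cnorm (u n - l) * cnorm (v n - l' + l') <= cnorm (u n - l) * B.
  by rewrite ler_wpM2l// cnorm_ge0.
have d2 : cnorm l * cnorm (v n - l') <= B * cnorm (v n - l').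
  by rewrite ler_wpM2r ?cnorm_ge0//; have := cnorm_ge0 l'; rewrite /B; lra.
nra.
Qed.

Lemma climN u l : clim u l -> clim (fun n => - u n) (- l).
Proof.
by move=> h e /h[n0 hn]; exists n0 => n /hn; rewrite -opprD cnormN.
Qed.

Lemma climB u v l l' : clim u l -> clim v l' -> clim (fun n => u n - v n) (l - l').
Proof. by move=> h /climN; exact: climD. Qed.

Lemma climV u l : l != 0 -> clim u l -> clim (fun n => (u n)^-1) l^-1.
Proof.
rewrite -cnorm_gt0 => l0 h e e0.
have e1 : 0 < Num.min (cnorm l / 2) (e * cnorm l ^+ 2 / 2).
  by rewrite lt_min !divr_gt0 ?mulr_gt0 ?exprn_gt0.
have [n0 hn] := h _ e1; exists n0 => n /hn; rewrite lt_min => /andP[a b].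
have c : cnorm l / 2 <= cnorm (u n).
  have := cnormD (l - u n) (u n); rewrite subrK cnormB; lra.
have c0 : 0 < cnorm (u n) by apply: lt_le_trans c; rewrite divr_gt0.
have -> : (u n)^-1 - l^-1 = (l - u n) * ((u n)^-1 * l^-1).
  by field; rewrite -!cnorm_gt0 l0 c0.
rewrite !cnormM !cnormV cnormB -invfM ltr_pdivrMr ?mulr_gt0//.
apply: (lt_le_trans b).
have d : cnorm l / 2 * cnorm l <= cnorm (u n) * cnorm l by rewrite ler_pM2r.
have := ler_wpM2l (ltW e0) d; rewrite expr2; lra.
Qed.

Lemma clim_sum (I : Type) (r : seq I) (P : pred I) (F : I -> nat -> Cx R) (G : I -> Cx R) :
  (forall i, P i -> clim (F i) (G i)) ->
  clim (fun n => \sum_(i <- r | P i) F i n) (\sum_(i <- r | P i) G i).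
Proof.
move=> h; elim: r => [|i r IH].
  by rewrite big_nil (_ : (fun n => _) = (fun=> 0)); [exact: clim_cst|apply/funext => n;
    rewrite big_nil].
rewrite big_cons (_ : (fun n => _) = (fun n => if P i then F i n + \sum_(i <- r | P i) F i n else
  \sum_(i <- r | P i) F i n)); last first.
  by apply/funext => n; rewrite big_cons.
by case: ifP => // Pi; apply: climD => //; exact: h.
Qed.

Lemma clim_unique u l l' : clim u l -> clim u l' -> l = l'.
Proof.
move=> h h'; apply/eqP; rewrite -subr_eq0 -cnorm_eq0 eq_le cnorm_ge0 andbT.
apply/ler_addgt0Pl => e e0; rewrite addr0.
have e2 : 0 < e / 2 by rewrite divr_gt0.
have [n0 hn] := h _ e2; have [n1 hn'] := h' _ e2.
have := hn (maxn n0 n1) (leq_maxl _ _); have := hn' (maxn n0 n1) (leq_maxr _ _).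
set x := u _; have -> : l - l' = (x - l') - (x - l) by ring.
by move=> a b; apply: le_trans (cnormD _ _) _; rewrite cnormN; lra.
Qed.

Lemma clim_near u v l n0 : (forall n, (n0 <= n)%N -> u n = v n) -> clim u l -> clim v l.
Proof.
move=> uv h e e0; have [n1 hn] := h e e0; exists (maxn n0 n1) => n.
by rewrite geq_max => /andP[h0 h1]; rewrite -uv//; exact: hn.
Qed.

Lemma exists_nat_gt (x : R) : exists n : nat, x < n%:R.
Proof.
exists (Num.bound `|x|).
by apply: le_lt_trans (ler_norm x) (archi_boundP (normr_ge0 x)).
Qed.

Lemma exists_inv_lt (C e : R) : 0 < e -> exists n0, forall n, (n0 <= n)%N -> C / n.+1%:R < e.
Proof.
move=> e0; have [n0 h] := exists_nat_gt (C / e); exists n0 => n n0n.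
rewrite ltr_pdivrMr ?ltr0n// mulrC -ltr_pdivrMr//.
by apply: (lt_le_trans h); rewrite ler_nat ltnW.
Qed.

Lemma clim_inv u l (C : R) n0 : (forall n, (n0 <= n)%N -> cnorm (u n - l) <= C / n.+1%:R) ->
  clim u l.
Proof.
move=> h e e0; have [n1 hn] := exists_inv_lt C e0.
exists (maxn n0 n1) => n; rewrite geq_max => /andP[a b].
by apply: le_lt_trans (h _ a) (hn _ b).
Qed.

Lemma clim_cexp u l : clim u l -> clim (fun n => cexp (u n)) (cexp l).
Proof.
move=> h e e0.
have c0 : 0 < cnorm (cexp l) by rewrite cnorm_gt0 cexp_neq0.
have e1 : 0 < Num.min (2^-1) (e / (5 * cnorm (cexp l))).
  by rewrite lt_min invr_gt0 ltr0n/= divr_gt0// mulr_gt0.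
have [n0 hn] := h _ e1; exists n0 => n /hn; rewrite lt_min => /andP[h1 h2].
have -> : cexp (u n) - cexp l = cexp l * (cexp (u n - l) - 1).
  by rewrite mulrBr mulr1 -cexpD (addrC l) subrK.
rewrite cnormM.
set w := u n - l in h1 h2 *; have h4 := cexp_sub1_le (ltW h1).
move: h2; rewrite ltr_pdivlMr ?mulr_gt0// => h2.
apply: le_lt_trans h2.
by rewrite mulrA mulrC ler_pM2r// mulrC.
Qed.

(* Tannery's theorem: the double limit is exchanged through the uniform tail bound [tau]. *)
Lemma tannery (f : nat -> nat -> Cx R) (g : nat -> Cx R) (S : nat -> Cx R) (s : Cx R) (tau : nat
  -> R) :
  (forall k, clim (fun n => f n k) (g k)) -> clim S s ->
  (forall e, 0 < e -> exists K0, forall K, (K0 <= K)%N -> tau K < e) ->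
  (exists K0, forall K, (K0 <= K)%N -> exists n0, forall n, (n0 <= n)%N ->
     cnorm (\sum_(k < K) f n k - S n) <= tau K) ->
  clim (fun K => \sum_(k < K) g k) s.
Proof.
move=> fg Ss tau0 [K0 bnd] e e0.
have e2 : 0 < e / 2 by rewrite divr_gt0.
have [K1 hK] := tau0 _ e2.
exists (maxn K0 K1) => K; rewrite geq_max => /andP[k0 k1].
have {bnd}[n0 bnd] := bnd _ k0.
have : clim (fun n => \sum_(k < K) f n k - S n) (\sum_(k < K) g k - s).
  by apply: climB => //; apply: clim_sum => i _; exact: fg.
move=> /(_ _ e2)[n1 hn].
have := hn (maxn n0 n1) (leq_maxr _ _); have := bnd (maxn n0 n1) (leq_maxl _ _).
have := hK _ k1; set X := \sum_(k < K) f _ _ - _; set Y := _ - s.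
move=> t b c; have -> : Y = X - (X - Y) by ring.
apply: le_lt_trans (cnormD _ _) _; rewrite cnormN; lra.
Qed.

End Clim.

(** * Discrete Fourier inversion and its limit *)

Lemma sum_root_unity (F : fieldType) (n : nat) (w : F) : w ^+ n = 1 -> w != 1 ->
  \sum_(k < n) w ^+ k = 0.
Proof.
move=> wn w1; have /eqP := subrX1 w n; rewrite wn subrr eq_sym mulf_eq0 subr_eq0.
by rewrite (negbTE w1) => /eqP.
Qed.

(** Since (q z^k)^n = q^n, each 1 / (1 - q z^k) is a geometric polynomial of degree below n divided
    by 1 - q^n. After exchanging the sums, orthogonality of the roots of unity leaves only the power
    l = j. *)
Lemma dft_geometric (F : fieldType) (n j : nat) (z q : F) :
  (j < n)%N -> z ^+ n = 1 -> (forall k, (0 < k < n)%N -> z ^+ k != 1) -> q ^+ n != 1 ->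
  \sum_(k < n) (z ^+ k) ^- j / (1 - q * z ^+ k) = n%:R * (q ^+ j / (1 - q ^+ n)).
Proof.
move=> jn zn zk qn.
have n0 : (0 < n)%N by apply: leq_ltn_trans jn.
have z0 : z != 0 by apply/eqP => z0; move: zn; rewrite z0 expr0n gtn_eqF// => /esym/eqP;
  rewrite oner_eq0.
have q1 : 1 - q ^+ n != 0 by rewrite subr_eq0 eq_sym.
have zkn k : (z ^+ k) ^+ n = 1 by rewrite exprAC zn expr1n.
have geo (k : 'I_n) : (1 - q * z ^+ k)^-1 = \sum_(l < n) (q * z ^+ k) ^+ l / (1 - q ^+ n).
  set x := q * z ^+ k.
  have xn : x ^+ n = q ^+ n by rewrite exprMn zkn mulr1.
  have x1 : 1 - x != 0.
    by apply/eqP => /eqP; rewrite subr_eq0 => /eqP x1; move: qn; rewrite -xn -x1 expr1n eqxx.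
  apply: (mulfI x1); rewrite divff// -mulr_suml mulrA.
  have := subrX1 x n; rewrite xn => e.
  rewrite -(opprB x) mulNr -e opprB; by rewrite divff.
under eq_bigr do rewrite geo mulr_sumr.
rewrite exchange_big /= (bigD1 (Ordinal jn)) //= [X in _ + X]big1 ?addr0; last first.
  move=> l lj.
  transitivity ((q ^+ l / (1 - q ^+ n)) * \sum_(k < n) (z ^+ l / z ^+ j) ^+ k).
    rewrite mulr_sumr; apply: eq_bigr => k _.
    rewrite !exprMn -!exprM exprVn -exprM (mulnC k) (mulnC k l); ring.
  rewrite sum_root_unity ?mulr0//.
    by rewrite exprMn exprVn -!exprM !(mulnC _ n) !exprM zn !expr1n divff ?oner_eq0.
  have lj' : nat_of_ord l != j by apply: contra lj => /eqP e; apply/eqP/val_inj.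
  apply/eqP => e.
  have {}e : z ^+ l = z ^+ j.
    by rewrite -[LHS](divfK (expf_neq0 j z0)) e mul1r.
  have [ltlj|ltjl|/eqP] := ltngtP l j; last by rewrite (negbTE lj').
  - have := zk (j - l)%N; rewrite subn_gt0 ltlj (leq_ltn_trans (leq_subr _ _) jn) => /(_
    isT)/eqP; apply.
    by apply: (mulfI (expf_neq0 l z0)); rewrite -exprD subnKC ?mulr1 // ltnW.
  - have := zk (l - j)%N; rewrite subn_gt0 ltjl (leq_ltn_trans (leq_subr _ _) (ltn_ord l)) => /(_
    isT)/eqP; apply.
    by apply: (mulfI (expf_neq0 j z0)); rewrite -exprD subnKC ?mulr1 // ltnW.
rewrite (eq_bigr (fun=> q ^+ j / (1 - q ^+ n))); last first.
  move=> k _; rewrite /= exprMn; field.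
  by rewrite q1 /= expf_neq0// expf_neq0.
by rewrite sumr_const card_ord mulr_natl.
Qed.

Section Fourier.
Variable R : realType.
Implicit Types (W U : Cx R).

Let tp : R := 2 * pi.
Let tp_gt0 : 0 < tp. Proof. by rewrite mulr_gt0// pi_gt0. Qed.

Lemma cexp_2piin (k : nat) : cexp (rC (tp * k%:R) * Ci : Cx R) = 1.
Proof.
by rewrite rmorphM rmorph_nat -mulrAC mulr_natr cexpMn cexp_2pii expr1n.
Qed.

Lemma cexp_2piiz (k : int) : cexp (rC (tp * k%:~R) * Ci : Cx R) = 1.
Proof.
case: k => k; first exact: cexp_2piin.
by rewrite NegzE rmorphN /= mulrN rmorphN mulNr cexpN cexp_2piin invr1.
Qed.

(* [dterm n j W x] is the summand of the discrete Fourier inversion formula with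
   [n] nodes, at node [j] and frequency [x]. *)
Let dterm (n j : nat) (W : Cx R) (x : R) : Cx R :=
  cexp (- (rC (x * (tp * j%:R / n%:R)) * Ci)) /
    (n%:R * (1 - cexp (rC (tp / n%:R) * Ci * (rC x - W)))).

(** The sum of [dterm] over a full period, see [dterm_sum]. Its denominator is 1 - q^n = 1 - exp(- 2
    pi i W), free of n, so only the node varies in the limit. *)
Let phid (n j : nat) (W : Cx R) : Cx R :=
  cexp (- (Ci * W * rC (tp * j%:R / n%:R))) / (1 - cexp (- (rC tp * Ci * W))).

(** Used to read the upper half of the frequencies 0, ..., n - 1 as negative frequencies. *)
Lemma dterm_periodic (n j : nat) W (x : R) : (0 < n)%N ->
  dterm n j W (x + n%:R) = dterm n j W x.
Proof.
move=> n0; have nn0 : n%:R != 0 :> R by rewrite pnatr_eq0 -lt0n.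
rewrite /dterm; congr (_ / (_ * (1 - _))).
- have -> : (x + n%:R) * (tp * j%:R / n%:R) = x * (tp * j%:R / n%:R) + tp * j%:R by field.
  by rewrite rmorphD /= mulrDl opprD cexpD (cexpN (rC (tp * j%:R) * Ci)) cexp_2piin invr1 mulr1.
- have -> : rC (tp / n%:R) * Ci * (rC (x + n%:R) - W)
     = rC (tp / n%:R) * Ci * (rC x - W) + rC (tp * 1%:R) * Ci.
    have -> : rC (x + n%:R) = rC x + n%:R :> Cx R by rewrite rmorphD /= rmorph_nat.
    have nC : n%:R != 0 :> Cx R by rewrite pnatr_eq0 -lt0n.
    rewrite !rmorphM /= fmorphV /= !rmorph_nat; field.
    exact: nC.
  by rewrite cexpD cexp_2piin mulr1.
Qed.

(** This is [dft_geometric] for z = exp(2 pi i / n) and q = exp(- 2 pi i W / n). *)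
Lemma dterm_sum (n j : nat) W : (j < n)%N -> cexp (- (rC tp * Ci * W)) != 1 ->
  \sum_(k < n) dterm n j W k%:R = phid n j W.
Proof.
move=> jn W1; have n0 : (0 < n)%N by apply: leq_ltn_trans jn.
have nn0 : n%:R != 0 :> R by rewrite pnatr_eq0 -lt0n.
have nC : n%:R != 0 :> Cx R by rewrite pnatr_eq0 -lt0n.
pose z : Cx R := cexp (rC (tp / n%:R) * Ci).
pose q : Cx R := cexp (- (rC (tp / n%:R) * Ci * W)).
have zE k : z ^+ k = cexp (rC (k%:R * (tp / n%:R)) * Ci).
  by rewrite -cexpMn; congr cexp; rewrite [in RHS]rmorphM /= rmorph_nat -mulrA mulr_natl.
have qE : q ^+ n = cexp (- (rC tp * Ci * W)).
  rewrite -cexpMn; congr cexp; rewrite mulNrn; congr (- _).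
  by rewrite rC_divn -mulr_natl; field; exact: nC.
have := @dft_geometric _ n j z q jn.
rewrite qE zE => h.
transitivity (n%:R^-1 * \sum_(k < n) (z ^+ k) ^- j / (1 - q * z ^+ k)).
  rewrite mulr_sumr; apply: eq_bigr => k _.
  have e1 : (z ^+ k) ^- j = cexp (- (rC (k%:R * (tp * j%:R / n%:R)) * Ci)).
    rewrite cexpN -exprM zE natrM.
    by have -> : k%:R * j%:R * (tp / n%:R) = k%:R * (tp * j%:R / n%:R) by field.
  have e2 : q * z ^+ k = cexp (rC (tp / n%:R) * Ci * (rC k%:R - W)).
    rewrite zE /q -cexpD (rmorphM (@rC R) k%:R) /=.
    by have -> : - (rC (tp / n%:R) * Ci * W) + rC k%:R * rC (tp / n%:R) * Ci =
      rC (tp / n%:R) * Ci * (rC k%:R - W) by ring.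
  by rewrite e1 e2 /dterm invfM mulrCA.
rewrite h//; last first.
- move=> k /andP[k0 kn]; rewrite zE; apply: cexp_im_neq1.
  rewrite -/tp mulr_gt0 ?ltr0n ?divr_gt0 ?ltr0n//= mulrCA gtr_pMr//.
  by rewrite ltr_pdivrMr ?ltr0n// mul1r ltr_nat.
- by have -> : n%:R * (tp / n%:R) = tp * 1%:R by [field]; exact: cexp_2piin.
rewrite mulKf// /phid; congr (_ / _).
rewrite /q -cexpMn; congr cexp; rewrite mulNrn; congr (- _).
rewrite -(mulr_natl (_ * W)) !rC_divn (rmorphM (@rC R) tp) /= !rmorph_nat; field.
exact: nC.
Qed.

Lemma dterm_sum2 (h j : nat) W : (j < h.*2)%N -> cexp (- (rC tp * Ci * W)) != 1 ->
  \sum_(k < h) (dterm h.*2 j W k%:R + dterm h.*2 j W (- k.+1%:R)) = phid h.*2 j W.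
Proof.
move=> jh W1; rewrite -dterm_sum// big_split /=.
rewrite -!(big_mkord xpredT (fun k => dterm h.*2 j W k%:R)).
rewrite [RHS](@big_cat_nat _ _ _ h)//=; last by rewrite -addnn leq_addr.
rewrite big_mkord; congr (_ + _).
rewrite -[in RHS](add0n h) big_addn add0n -[X in (X - h)%N]addnn addnK big_mkord.
(* In reversed order the negative frequencies are - (h - k), and adding the period 2 h turns them
   into h + k. *)
rewrite [LHS](reindex_inj rev_ord_inj) /=; apply: eq_bigr => k _.
rewrite subnSK// -(dterm_periodic j W (- _)); last by apply: leq_ltn_trans jh.
congr dterm; rewrite natrB; last exact: ltnW.
by rewrite -addnn !natrD; ring.
Qed.

(** The phase of [dterm] has modulus one and drops out, which makes the tail bound independent of
    the node [j]. *)
Lemma cnorm_dterm_diff (n j : nat) W U (x : R) :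
  let q V := cexp (- (rC (tp / n%:R) * Ci * V)) : Cx R in
  let t := cexp (rC (tp / n%:R * x) * Ci) : Cx R in
  cnorm (dterm n j W x - dterm n j U x) =
  cnorm ((1 - q W * t)^-1 - (1 - q U * t)^-1) / n%:R.
Proof.
move=> q t; rewrite /dterm.
have E V : cexp (rC (tp / n%:R) * Ci * (rC x - V)) = q V * t.
  by rewrite -cexpD; congr cexp; rewrite rmorphM /=; ring.
rewrite !E !invfM -mulrBr cnormM cnorm_cexp !ReImE !(mulr0, mul0r) subr0 oppr0 expR0 mul1r.
by rewrite -mulrBr cnormM cnormV -(rmorph_nat (@rC R)) cnorm_real normr_nat mulrC.
Qed.

(** The tail bound for Tannery, uniform in [n] and [j]. A single term decays only like 1 / |x|; in
    the difference the numerator q W - q U is O(1/n), while both denominators are at least of order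
    |x| / n. The restriction |x| <= n/2 puts the angle in [- pi, pi], where [cexp_sub1_ge] holds. *)
Lemma dterm_bound W U : exists C : R, exists K0 : R, exists N0 : R, 0 <= C /\
  forall (n j : nat) (x : R), N0 <= n%:R -> K0 <= `|x| -> 0 < `|x| -> `|x| <= n%:R / 2 ->
  cnorm (dterm n j W x - dterm n j U x) <= C / x ^+ 2.
Proof.
pose M := cnorm W + cnorm U + 1.
have M0 : 0 < M by have := cnorm_ge0 W; have := cnorm_ge0 U; rewrite /M; lra.
have tp0 := tp_gt0; have pi0 := @pi_gt0 R.
(* With d = 2 pi / n: n >= 2 tp M gives d M <= 1/2, as [cexp_sub1_le] requires; |x| >= 40 M makes
   the perturbation 5 d M at most half of the lower bound d |x| / 4; and 640 = 10 * 8 * 8 collects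
   the numerator 10 d M and two denominators d |x| / 8. *)
exists (640 * tp * M / tp ^+ 2), (40 * M), (2 * tp * M).
split.
  apply: divr_ge0; last exact: sqr_ge0.
  by apply: mulr_ge0; [apply: mulr_ge0; [exact: ler0n|exact: ltW]|exact: ltW].
move=> n j x nN xK x0 xn.
have n0 : 0 < n%:R :> R by lra.
pose q V := cexp (- (rC (tp / n%:R) * Ci * V)) : Cx R.
pose t := cexp (rC (tp / n%:R * x) * Ci) : Cx R.
rewrite (cnorm_dterm_diff n j W U x) -/t -/(q W) -/(q U).
pose d := tp / n%:R.
have d0 : 0 < d by rewrite divr_gt0.
have q1 V : cnorm V <= M -> cnorm (q V - 1) <= 5 * (d * M).
  move=> VM; have wE : cnorm (- (rC (tp / n%:R) * Ci * V)) = d * cnorm V.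
    by rewrite cnormN !cnormM cnormi cnorm_real mulr1 gtr0_norm.
  have dM : d * cnorm V <= d * M by rewrite ler_pM2l.
  apply: le_trans (cexp_sub1_le _) _; rewrite wE; last by lra.
  apply: (le_trans dM); rewrite /d mulrAC ler_pdivrMr//; lra.
have WM : cnorm W <= M by have := cnorm_ge0 U; rewrite /M; lra.
have UM : cnorm U <= M by have := cnorm_ge0 W; rewrite /M; lra.
have t1 : cnorm t = 1.
  by rewrite cnorm_cexp !ReImE !(mulr0, mul0r) subr0 expR0.
have dx : `|d * x| = d * `|x| by rewrite normrM gtr0_norm.
have tb : d * `|x| / 4 <= cnorm (t - 1).
  rewrite -dx; apply: cexp_sub1_ge; rewrite dx /d mulrAC ler_pdivrMr//.
  have : pi * `|x| <= pi * (n%:R / 2) by rewrite ler_pM2l.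
  by rewrite /tp; lra.
have lb V : cnorm V <= M -> d * `|x| / 8 <= cnorm (1 - q V * t).
  move=> VM; have -> : 1 - q V * t = - ((t - 1) - (1 - q V) * t) by ring.
  rewrite cnormN; apply: le_trans (ler_cnormB _ _).
  rewrite cnormM t1 mulr1 (cnormB 1) .
  have := q1 _ VM; have : d * (40 * M) <= d * `|x| by rewrite ler_pM2l.
  by lra.
have dx0 : 0 < d * `|x| / 8 by rewrite divr_gt0// mulr_gt0.
have hW := lb _ WM; have hU := lb _ UM.
have W0 : 0 < cnorm (1 - q W * t) by apply: lt_le_trans hW.
have U0 : 0 < cnorm (1 - q U * t) by apply: lt_le_trans hU.
have -> : (1 - q W * t)^-1 - (1 - q U * t)^-1 =
    ((q W - 1) - (q U - 1)) * t * ((1 - q W * t)^-1 * (1 - q U * t)^-1).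
  by field; rewrite -!cnorm_gt0 W0 U0.
rewrite (cnormM (_ * t)) (cnormM _ t) (cnormM (_^-1)) t1 mulr1 !cnormV -invfM.
have num : cnorm (q W - 1 - (q U - 1)) <= 10 * (d * M).
  apply: le_trans (cnormD _ _) _; rewrite cnormN.
  have := q1 _ WM; have := q1 _ UM; lra.
have den : (d * `|x| / 8) * (d * `|x| / 8) <= cnorm (1 - q W * t) * cnorm (1 - q U * t).
  by apply: ler_pM => //; exact: ltW.
have -> : 640 * tp * M / tp ^+ 2 / x ^+ 2 =
   (10 * (d * M)) / ((d * `|x| / 8) * (d * `|x| / 8)) / n%:R.
  rewrite -(real_normK (num_real x)) /d; field.
  by rewrite !gt_eqF//.
rewrite ler_pM2r ?invr_gt0//.
apply: ler_pM => //; first exact: cnorm_ge0.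
  by rewrite invr_ge0 mulr_ge0// ltW.
by rewrite lef_pV2// posrE mulr_gt0.
Qed.

(** The discrete kernel becomes a simple pole because n (1 - exp(c/n)) tends to - c, with error
    O(1/n) by [cexp_sub_le]. *)
Lemma dterm_lim (n j : nat -> nat) (y x : R) W : rC x != W ->
  (forall h, (h < n h)%N) ->
  clim (fun h => rC (tp * (j h)%:R / (n h)%:R)) (rC y) ->
  clim (fun h => dterm (n h) (j h) W x)
    (cexp (- (Ci * rC x * rC y)) / (rC tp * Ci * (W - rC x))).
Proof.
move=> xW nh jy; have tp0 := tp_gt0.
have Ci0 : Ci != 0 :> Cx R by rewrite -cnorm_gt0 cnormi.
have tpC : rC tp != 0 :> Cx R by rewrite -cnorm_gt0 cnorm_real gtr0_norm.
apply: climM.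
  apply: clim_cexp; apply: climN.
  have -> : (fun h => rC (x * (tp * (j h)%:R / (n h)%:R)) * Ci) =
            (fun h => Ci * rC x * rC (tp * (j h)%:R / (n h)%:R)).
    by apply/funext => h; rewrite [in LHS]rmorphM /=; ring.
  by apply: climM => //; exact: clim_cst.
apply: climV.
  by rewrite !mulf_neq0// subr_eq0 eq_sym.
pose c : Cx R := rC tp * Ci * (rC x - W).
pose B := 2 * cnorm c + 1.
have B0 : 0 < B by have := cnorm_ge0 c; rewrite /B; lra.
have [N0 hN0] := exists_nat_gt B.
apply: (@clim_inv _ _ _ (8 * cnorm c ^+ 2) N0) => h hN.
have nB : B <= (n h)%:R.
  by apply: (le_trans (ltW hN0)); rewrite ler_nat (leq_trans hN)// ltnW.
have n0 : 0 < (n h)%:R :> R by apply: lt_le_trans nB.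
have nC : (n h)%:R != 0 :> Cx R by rewrite pnatr_eq0 -(@pnatr_eq0 R) gt_eqF.
have E : rC (tp / (n h)%:R) * Ci * (rC x - W) = c / (n h)%:R.
  by rewrite rmorphM fmorphV /= rmorph_nat /c; ring.
have cn : cnorm (c / (n h)%:R) = cnorm c / (n h)%:R.
  by rewrite cnormM cnormV -(rmorph_nat (@rC R)) cnorm_real normr_nat.
rewrite E.
have -> : (n h)%:R * (1 - cexp (c / (n h)%:R)) - rC tp * Ci * (W - rC x) =
   - ((n h)%:R * (cexp (c / (n h)%:R) - 1 - c / (n h)%:R)).
  rewrite /c; field.
  exact: nC.
rewrite cnormN cnormM -(rmorph_nat (@rC R)) cnorm_real normr_nat rmorph_nat.
have b : cnorm (c / (n h)%:R) <= 2^-1.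
  by rewrite cn ler_pdivrMr//; move: nB; rewrite /B; lra.
have := cexp_sub_le b; rewrite cn => b2.
apply: (@le_trans _ _ ((n h)%:R * (8 * (cnorm c / (n h)%:R) ^+ 2))).
  by rewrite ler_pM2l.
have -> : (n h)%:R * (8 * (cnorm c / (n h)%:R) ^+ 2) = 8 * cnorm c ^+ 2 / (n h)%:R.
  by field; rewrite gt_eqF.
apply: ler_wpM2l; first by rewrite mulr_ge0// sqr_ge0.
by rewrite lef_pV2 ?posrE ?n0 ?ltr0Sn// ler_nat.
Qed.

Lemma phid_lim (n j : nat -> nat) (y : R) W :  cexp (- (rC tp * Ci * W)) != 1 ->
  clim (fun h => rC (tp * (j h)%:R / (n h)%:R)) (rC y) ->
  clim (fun h => phid (n h) (j h) W) (cexp (- (Ci * W * rC y)) / (1 - cexp (- (rC tp * Ci * W)))).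
Proof.
move=> W1 jy; apply: climM; last exact: clim_cst.
apply: clim_cexp; apply: climN; apply: climM => //; exact: clim_cst.
Qed.

(** Telescoping, from 1 / (k+1)^2 <= 1/k - 1/(k+1). *)
Lemma sum_inv_sqr_le (a b : nat) : (0 < a)%N -> (a <= b)%N ->
  \sum_(a <= k < b) (k.+1%:R ^+ 2)^-1 <= a%:R^-1 - b%:R^-1 :> R.
Proof.
move=> a0; elim: b => [|b IH]; first by rewrite leqn0 => /eqP a0'; rewrite a0' in a0.
rewrite leq_eqVlt => /predU1P[<-|]; first by rewrite big_geq// subrr.
rewrite ltnS => ab; rewrite big_nat_recr//=.
have b0 : 0 < b%:R :> R by rewrite ltr0n (leq_trans a0).
have h : (b.+1%:R ^+ 2)^-1 <= b%:R^-1 - b.+1%:R^-1 :> R.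
  have -> : b%:R^-1 - b.+1%:R^-1 = (b%:R * b.+1%:R)^-1 :> R.
    by rewrite -natr1; field; rewrite !gt_eqF//; lra.
  rewrite lef_pV2 ?posrE ?mulr_gt0 ?exprn_gt0 ?ltr0n//; last by rewrite -(ltr0n R).
  by rewrite expr2 ler_pM2r ?ltr0n// ler_nat.
by apply: le_trans (lerD (IH ab) h) _; rewrite addrA subrK.
Qed.

Lemma exists_node (y : R) : 0 <= y <= tp ->
  exists j : nat -> nat, (forall h, (j h < h.+1.*2)%N) /\
  clim (fun h => rC (tp * (j h)%:R / (h.+1.*2)%:R)) (rC y).
Proof.
move=> /andP[y0 y1]; have tp0 := tp_gt0.
pose j0 h := Num.truncn (y / tp * (h.+1.*2)%:R).
have yh h : 0 <= y / tp * (h.+1.*2)%:R by rewrite mulr_ge0 ?divr_ge0 ?(ltW tp0).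
(* The rounded-down index would equal the number of nodes when y = 2 pi; capping it at the last node
   keeps it admissible, at a cost of at most one grid step. *)
exists (fun h => minn (j0 h) (h.+1.*2).-1); split.
  by move=> h; rewrite gtn_min; apply/orP; right; rewrite ltn_predL double_gt0.
apply: (@clim_inv _ _ _ tp 0%N) => h _.
have /andP[] := truncn_itv (yh h); rewrite -/(j0 h) => t1 t2.
have n0 : 0 < (h.+1.*2)%:R :> R by rewrite ltr0n.
have jn : (j0 h)%:R <= (h.+1.*2)%:R :> R.
  apply: (le_trans t1); rewrite ler_piMl//.
  by rewrite ler_pdivrMr// mul1r.
have nE : (h.+1.*2).-1%:R = (h.+1.*2)%:R - 1 :> R.
  by rewrite -[in RHS](@prednK h.+1.*2)// -natr1 addrK.
have b : `|(minn (j0 h) (h.+1.*2).-1)%:R - y / tp * (h.+1.*2)%:R| <= 1.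
  have yn : y / tp * (h.+1.*2)%:R <= (h.+1.*2)%:R.
    by rewrite ler_piMl// ler_pdivrMr// mul1r.
  rewrite -natr1 in t2.
  rewrite ler_norml; rewrite /minn; case: ifPn => [_|]; first by apply/andP; split; lra.
  by rewrite -leqNgt -(ler_nat R) !nE => h'; apply/andP; split; lra.
have -> : rC (tp * (minn (j0 h) (h.+1.*2).-1)%:R / (h.+1.*2)%:R) - rC y =
   rC (tp / (h.+1.*2)%:R * ((minn (j0 h) (h.+1.*2).-1)%:R - y / tp * (h.+1.*2)%:R)).
  by rewrite -rmorphB /=; congr rC; field; rewrite !gt_eqF.
rewrite cnorm_real normrM gtr0_norm ?divr_gt0//.
apply: (@le_trans _ _ (tp / (h.+1.*2)%:R)); first by rewrite ler_piMr// divr_ge0// ltW.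
by rewrite ler_pM2l// lef_pV2 ?posrE// ler_nat -addnn leq_addr.
Qed.

Lemma cexp_neq1_lattice W (k : int) : cexp (- (rC tp * Ci * W)) != 1 -> rC k%:~R != W.
Proof.
apply: contra => /eqP <-.
have -> : - (rC tp * Ci * rC k%:~R) = - (rC (tp * k%:~R) * Ci) by rewrite [in RHS](rmorphM _ tp)
  /=; ring.
by rewrite cexpN cexp_2piiz invr1.
Qed.

Let ft (y : R) W U (x : R) : Cx R :=
  cexp (- (Ci * rC x * rC y)) / (rC tp * Ci) * ((rC x - W)^-1 - (rC x - U)^-1).

(** The two hypotheses say that W and U are not integers. The exact identity [dterm_sum2] with 2 (h
    + 1) nodes, taken at U minus at W, passes to the limit by [tannery]. *)
Theorem fourier_two_poles (y : R) W U : 0 <= y <= tp ->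
  cexp (- (rC tp * Ci * W)) != 1 -> cexp (- (rC tp * Ci * U)) != 1 ->
  clim (fun K => \sum_(k < K) (ft y W U k%:R + ft y W U (- k.+1%:R)))
    (cexp (- (Ci * W * rC y)) / (cexp (- (rC tp * Ci * W)) - 1)
     - cexp (- (Ci * U * rC y)) / (cexp (- (rC tp * Ci * U)) - 1)).
Proof.
move=> y01 W1 U1; have [j [jn jy]] := exists_node y01.
have tp0 := tp_gt0.
have Ci0 : Ci != 0 :> Cx R by rewrite -cnorm_gt0 cnormi.
have tpC : rC tp != 0 :> Cx R by rewrite -cnorm_gt0 cnorm_real gtr0_norm.
pose n h := h.+1.*2.
have hn h : (h < n h)%N by rewrite /n -addnn addSn ltnS leq_addr.
have natW V (k : nat) : cexp (- (rC tp * Ci * V)) != 1 -> rC k%:R != V.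
  by move=> V1; exact: (@cexp_neq1_lattice V k).
have negW V (k : nat) : cexp (- (rC tp * Ci * V)) != 1 -> rC (- k.+1%:R) != V.
  by move=> /(@cexp_neq1_lattice V (Negz k)); rewrite NegzE mulrNz.
pose d h x := dterm (n h) (j h) U x - dterm (n h) (j h) W x.
have dl x : rC x != W -> rC x != U -> clim (d^~ x) (ft y W U x).
  move=> xW xU; have -> : ft y W U x =
     cexp (- (Ci * rC x * rC y)) / (rC tp * Ci * (U - rC x)) -
     cexp (- (Ci * rC x * rC y)) / (rC tp * Ci * (W - rC x)).
    rewrite /ft; field.
    have a1 : rC x - W != 0 by rewrite subr_eq0.
    have a2 : rC x - U != 0 by rewrite subr_eq0.
    have a3 : W - rC x != 0 by rewrite subr_eq0 eq_sym.
    have a4 : U - rC x != 0 by rewrite subr_eq0 eq_sym.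
    by rewrite Ci0 tpC a1 a2 a3 a4.
  by apply: climB; apply: dterm_lim.
have [C [K0 [N0 [C0 db]]]] := dterm_bound U W.
have -> : cexp (- (Ci * W * rC y)) / (cexp (- (rC tp * Ci * W)) - 1)
     - cexp (- (Ci * U * rC y)) / (cexp (- (rC tp * Ci * U)) - 1) =
  cexp (- (Ci * U * rC y)) / (1 - cexp (- (rC tp * Ci * U))) -
  cexp (- (Ci * W * rC y)) / (1 - cexp (- (rC tp * Ci * W))).
  have a1 : cexp (- (rC tp * Ci * W)) - 1 != 0 by rewrite subr_eq0.
  have a2 : cexp (- (rC tp * Ci * U)) - 1 != 0 by rewrite subr_eq0.
  have a3 : 1 - cexp (- (rC tp * Ci * W)) != 0 by rewrite subr_eq0 eq_sym.
  have a4 : 1 - cexp (- (rC tp * Ci * U)) != 0 by rewrite subr_eq0 eq_sym.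
  by field; rewrite a1 a2 a3 a4.
(* The identity of index h has only h + 1 pairs of frequencies; further terms are set to 0. *)
pose f h k := if (k < h.+1)%N then d h k%:R + d h (- k.+1%:R) else 0.
(* The constant 5 C is 4 C + C: the term at k is bounded by C / k^2 <= 4 C / (k+1)^2, the one at -
   (k+1) by C / (k+1)^2, and the sum telescopes. *)
apply: (@tannery _ f (fun k => ft y W U k%:R + ft y W U (- k.+1%:R)) (fun h => phid (n h) (j h) U
  - phid (n h) (j h) W) _
    (fun K => 5 * C / K%:R)).
- move=> k; apply: (@clim_near _ (fun h => d h k%:R + d h (- k.+1%:R)) _ _ k).
    by move=> h kh; rewrite /f ltnS kh.
  exact: climD (dl _ (natW _ k W1) (natW _ k U1)) (dl _ (negW _ k W1) (negW _ k U1)).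
- by apply: climB; apply: phid_lim.
- move=> e e0; have [n0 h0] := exists_inv_lt (5 * C) e0; exists n0.+1 => -[//|K].
  by rewrite ltnS => /h0.
have [K1 hK1] := exists_nat_gt K0.
exists K1.+1 => K KK; have K0' : (0 < K)%N by apply: leq_trans KK.
have [N1 hN1] := exists_nat_gt N0.
exists (maxn N1 K) => h; rewrite geq_max => /andP[hN hK].
rewrite -dterm_sum2// -dterm_sum2// -sumrB.
have -> : \sum_(k < K) f h k = \sum_(0 <= k < K) (d h k%:R + d h (- k.+1%:R)).
  rewrite big_mkord; apply: eq_bigr => k _; rewrite /f ltnS ifT//.
  by rewrite (leq_trans _ hK)// ltnW.
have -> : \sum_(i < h.+1) (dterm h.+1.*2 (j h) U i%:R + dterm h.+1.*2 (j h) U (- i.+1%:R) -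
    (dterm h.+1.*2 (j h) W i%:R + dterm h.+1.*2 (j h) W (- i.+1%:R))) =
    \sum_(0 <= k < h.+1) (d h k%:R + d h (- k.+1%:R)).
  by rewrite big_mkord; apply: eq_bigr => k _; rewrite /d addrACA opprD.
rewrite [X in _ - X](@big_cat_nat _ _ _ K)//=; last by rewrite (leq_trans hK).
rewrite opprD addrA subrr add0r cnormN.
apply: le_trans (cnorm_sum _ _ _) _.
have nN : N0 <= (n h)%:R.
  by apply: (le_trans (ltW hN1)); rewrite ler_nat (leq_trans hN)// ltnW.
have K1R : K0 <= K%:R by apply: (le_trans (ltW hK1)); rewrite ler_nat ltnW.
have b (k : nat) : (K <= k < h.+1)%N ->
    cnorm (d h k%:R + d h (- k.+1%:R)) <= (5 * C) * (k.+1%:R ^+ 2)^-1.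
  move=> /andP[Kk kh].
  have k0 : 0 < k%:R :> R by rewrite ltr0n (leq_trans K0').
  have kK : K0 <= k%:R by apply: (le_trans K1R); rewrite ler_nat.
  have k1 : k%:R + 1 = k.+1%:R :> R by rewrite natr1.
  have nk : k.+1%:R <= (n h)%:R / 2 :> R.
    by rewrite ler_pdivlMr// -natrM ler_nat /n muln2 leq_double.
  have a1 : cnorm (d h k%:R) <= C / k%:R ^+ 2.
    by apply: db => //; rewrite gtr0_norm//; lra.
  have a2 : cnorm (d h (- k.+1%:R)) <= C / k.+1%:R ^+ 2.
    by rewrite -[in leRHS]sqrrN; apply: db => //; rewrite normrN gtr0_norm//; lra.
  have a3 : C / k%:R ^+ 2 <= C * (4 * (k.+1%:R ^+ 2)^-1).
    apply: ler_wpM2l => //.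
    have -> : 4 * (k.+1%:R ^+ 2)^-1 = ((k.+1%:R / 2) ^+ 2)^-1 :> R.
      by field; rewrite gt_eqF// ltr0Sn.
    have k12 : k.+1%:R / 2 <= k%:R :> R.
      have : 1 <= k%:R :> R by rewrite -(ler_nat R 1) in K0'; apply: (le_trans K0');
        rewrite ler_nat.
      by rewrite -k1; lra.
    by rewrite lef_pV2 ?posrE ?exprn_gt0 ?divr_gt0 ?ltr0Sn// ler_sqr ?nnegrE ?divr_ge0 ?ler0n.
  apply: le_trans (cnormD _ _) _; apply: (le_trans (lerD a1 a2)).
  apply: (le_trans (lerD a3 (lexx _))); rewrite -mulrDr -mulrA mulrCA ler_wpM2l//.
  by rewrite -[X in _ + X]mul1r -mulrDl natr1.
rewrite big_nat; apply: (@le_trans _ _ (\sum_(K <= k < h.+1) 5 * C * (k.+1%:R ^+ 2)^-1)).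
  by rewrite [leRHS]big_nat; apply: ler_sum => k; exact: b.
rewrite -mulr_sumr; apply: ler_wpM2l; first by rewrite mulr_ge0.
apply: le_trans (sum_inv_sqr_le K0' (leqW hK)) _.
by rewrite lerBlDr lerDl invr_ge0.
Qed.

End Fourier.

(** * Absolutely convergent complex series *)

Section Completeness.
Variable R : realType.
Implicit Types (u d : nat -> Cx R) (a tau : nat -> R).

Lemma clim_le u l x (b : R) n : (forall m, (n <= m)%N -> cnorm (u m - x) <= b) ->
  clim u l -> cnorm (l - x) <= b.
Proof.
move=> h ul; apply/ler_addgt0Pl => e e0.
have [n0 hn] := ul _ e0; have := hn (maxn n0 n) (leq_maxl _ _).
have := h (maxn n0 n) (leq_maxr _ _); set v := u _.
have -> : l - x = (v - x) - (v - l) by ring.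
by move=> p q; apply: le_trans (cnormD _ _) _; rewrite cnormN; lra.
Qed.

Lemma clim_ReIm u (x y : R) : (fun n => Cre (u n)) @ \oo --> x ->
  (fun n => Cim (u n)) @ \oo --> y -> clim u (rC x + Ci * rC y).
Proof.
move=> /cvgrPdist_lt hx /cvgrPdist_lt hy e e0.
have e2 : 0 < e / 2 by rewrite divr_gt0.
have [n0 _ h0] := hx _ e2; have [n1 _ h1] := hy _ e2.
exists (maxn n0 n1) => n; rewrite geq_max => /andP[/h0 /= p /h1 /= q].
apply: le_lt_trans (cnorm_ReIm _) _.
rewrite !ReImE mul0r mulr0 subr0 mul0r mul1r !add0r !addr0 distrC (distrC (Cim _)).
by lra.
Qed.

(** Real and imaginary parts are compared with the same real series, whose partial sums are monotone
    and bounded. *)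
Lemma series_domination d a (M : R) : (forall k, cnorm (d k) <= a k) ->
  (forall n, \sum_(k < n) a k <= M) -> exists l, clim (fun n => \sum_(k < n) d k) l.
Proof.
move=> da aM.
have a0 k : 0 <= a k by apply: le_trans (cnorm_ge0 _) (da k).
have ca : cvgn (series a).
  apply: nondecreasing_is_cvgn; first by apply: nondecreasing_series => k _ _.
  by exists M => _ [n _ <-]; rewrite /series/= big_mkord.
have cv (f : Cx R -> R) : (forall z, `|f z| <= cnorm z) -> cvgn (series (fun k => f (d k))).
  move=> fz; apply: normed_cvg; apply: series_le_cvg ca => [k|k|k]//=.
  exact: le_trans (fz _) (da _).
have := cv _ (@le_Re R); have := cv _ (@le_Im R).
set X := series _; set Y := series _ => /cvg_ex[y hy] /cvg_ex[x hx].
exists (rC x + Ci * rC y); apply: clim_ReIm.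
  rewrite (_ : (fun n => _) = Y) //; apply/funext => n.
  by rewrite Re_sum /Y /series/= big_mkord.
rewrite (_ : (fun n => _) = X) //; apply/funext => n.
by rewrite Im_sum /X /series/= big_mkord.
Qed.

End Completeness.

(** * Calculus on a segment *)

Section Calculus.
Variables (R : realType) (T : R).
Hypothesis T0 : 0 < T.
Implicit Types (f g F G : R -> Cx R) (t s : R).

Definition cont_on f := forall t, 0 <= t <= T -> forall e, 0 < e ->
  exists2 d, 0 < d & forall s, 0 <= s <= T -> `|s - t| < d -> cnorm (f s - f t) < e.

(** Stated with increments instead of quotients, so that s = t need not be excluded and linearity is
    immediate. Only points of the segment are compared, hence the derivative is one-sided at the
    endpoints. *)
Definition deriv_on F t (D : Cx R) := forall e, 0 < e ->
  exists2 d, 0 < d & forall s, 0 <= s <= T -> `|s - t| < d ->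
    cnorm (F s - F t - rC (s - t) * D) <= e * `|s - t|.

Lemma cont_onP f : {within `[0, T], continuous f} <-> cont_on f.
Proof.
rewrite subspace_continuousP; split => h t.
- move=> tT e e0; have /h /cvgrPdist_lt h' : `[0, T] t by rewrite /= in_itv.
  have e0' : 0 < rC e by rewrite -[0]/(rC 0) ltr_rC.
  have := h' _ e0'; rewrite near_withinE => /nbhs_ballP[d /= d0 hd].
  exists d => // s sT st; have := hd s; rewrite /ball/= distrC => /(_ st).
  by rewrite in_itv/= sT => /(_ isT); rewrite distrC normE ltr_rC.
- rewrite /= in_itv/= => tT; suff h' : f x @[x --> within `[0, T] (nbhs t)] --> f t by exact: h'.
  apply/cvgrPdist_lt => e e0.
  have eE : e = rC (Cre e) by apply: ReIm_eq => //; rewrite Im_rC; exact: (ger0_Im (ltW e0)).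
  have re0 : 0 < Cre e by move: e0; rewrite eE -[0]/(rC 0) ltr_rC.
  have [d d0 hd] := h t tT _ re0.
  rewrite near_withinE; apply/nbhs_ballP; exists d => //= s.
  rewrite /ball/= in_itv/= distrC => st sT.
  by rewrite distrC normE eE ltr_rC; exact: hd.
Qed.

(** Heine-Cantor: balls of half the local radius form the covering, so that s and t both lie in the
    full ball of one centre. *)
Lemma cont_on_unif f : cont_on f -> forall e, 0 < e ->
  exists2 d, 0 < d & forall s t, 0 <= s <= T -> 0 <= t <= T -> `|s - t| < d ->
    cnorm (f s - f t) < e.
Proof.
move=> cf e e0.
have /compact_near_coveringP ncov := @segment_compact R 0 T.
have := ncov R (0 : R)^'+ (fun d x => 0 <= x <= T -> forall s, 0 <= s <= T -> `|s - x| < d ->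
  cnorm (f s - f x) < e).
move=> /(_ _) H.
have {}H : \forall d \near (0 : R)^'+, `[0, T] `<=` (fun x => 0 <= x <= T -> forall s, 0 <= s <=
  T -> `|s - x| < d -> cnorm (f s - f x) < e).
  apply: H => x; rewrite /= in_itv/= => xT.
  have e2 : 0 < e / 2 by rewrite divr_gt0.
  have [d d0 hd] := cf x xT _ e2.
  exists (ball x (d / 2), [set y : R | y < d / 2]) => /=.
    split; first by apply: nbhsx_ballx; rewrite divr_gt0.
    by apply: nbhs_right_lt; rewrite divr_gt0.
  move=> [y d'] /= [yx d'd] yT s sT sy.
  have a1 := hd _ yT; have a2 := hd _ sT.
  rewrite /ball/= in yx.
  have b1 : `|y - x| < d by rewrite distrC; lra.
  have b2 : `|s - x| < d.
    rewrite (_ : s - x = (s - y) - (x - y)); last by ring.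
    by apply: le_lt_trans (ler_normB _ _) _; lra.
  have -> : f s - f y = (f s - f x) - (f y - f x) by ring.
  apply: le_lt_trans (cnormD _ _) _; rewrite cnormN.
  by have := a1 b1; have := a2 b2; lra.
move: H => [d /= d0 hd]; exists (d / 2); first by rewrite divr_gt0.
move=> s t sT tT st.
have d2 : 0 < d / 2 by rewrite divr_gt0.
apply: (hd (d / 2)) => //=.
- by rewrite distrC subr0 gtr0_norm//; lra.
Qed.

Lemma cont_on_bounded f : cont_on f -> exists2 M, 0 <= M & forall t, 0 <= t <= T -> cnorm (f t)
  <= M.
Proof.
move=> cf.
have /compact_near_coveringP ncov := @segment_compact R 0 T.
have H : \forall d \near (+oo : set_system R), `[0, T] `<=` (fun x => 0 <= x <= T -> cnorm (f x)
  < d).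
  apply: ncov => x; rewrite /= in_itv/= => xT.
  have [d d0 hd] := cf x xT _ ltr01.
  exists (ball x d, [set y : R | cnorm (f x) + 1 < y]) => /=.
    split; first exact: nbhsx_ballx.
    by exists (cnorm (f x) + 1); split => //; rewrite num_real.
  move=> [y M] /= [yx hM] yT.
  have := hd _ yT; rewrite distrC => /(_ yx) h.
  have := ler_cnormB (f y) (f x); lra.
move: H => [M [_ hM]]; exists (`|M| + 1); first by rewrite addr_ge0.
move=> t tT; apply: ltW; apply: (hM (`|M| + 1)) => //.
by have := ler_norm M; lra.
Qed.

Lemma deriv_on_cont F D : (forall t, 0 <= t <= T -> deriv_on F t (D t)) -> cont_on F.
Proof.
move=> h t tT e e0; have [d d0 hd] := h t tT _ ltr01.
pose b := cnorm (D t) + 1.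
have b0 : 0 < b by have := cnorm_ge0 (D t); rewrite /b; lra.
exists (Num.min d (e / b)); first by rewrite lt_min d0 divr_gt0.
move=> s sT; rewrite lt_min => /andP[sd se]; have := hd s sT sd; rewrite mul1r => h1.
have -> : F s - F t = (F s - F t - rC (s - t) * D t) + rC (s - t) * D t by ring.
apply: le_lt_trans (cnormD _ _) _; rewrite cnormM cnorm_real.
apply: (@le_lt_trans _ _ (`|s - t| * b)); first by rewrite /b mulrDr mulr1; lra.
by rewrite -ltr_pdivlMr.
Qed.

Lemma deriv_onD F G t D E : deriv_on F t D -> deriv_on G t E ->
  deriv_on (fun s => F s + G s) t (D + E).
Proof.
move=> hF hG e e0; have e2 : 0 < e / 2 by rewrite divr_gt0.
have [d d0 hd] := hF _ e2; have [d' d0' hd'] := hG _ e2.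
exists (Num.min d d'); first by rewrite lt_min d0.
move=> s sT; rewrite lt_min => /andP[s1 s2].
have := hd s sT s1; have := hd' s sT s2.
set X := _ - _ - _; set Y := _ - _ - _; move=> a b.
have -> : F s + G s - (F t + G t) - rC (s - t) * (D + E) = Y + X by rewrite /X /Y; ring.
by apply: le_trans (cnormD _ _) _; lra.
Qed.

Lemma deriv_onZ F t D (c : Cx R) : deriv_on F t D -> deriv_on (fun s => c * F s) t (c * D).
Proof.
move=> hF e e0; pose b := cnorm c + 1.
have b0 : 0 < b by have := cnorm_ge0 c; rewrite /b; lra.
have e2 : 0 < e / b by rewrite divr_gt0.
have [d d0 hd] := hF _ e2; exists d => // s sT st.
have -> : c * F s - c * F t - rC (s - t) * (c * D) = c * (F s - F t - rC (s - t) * D) by ring.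
rewrite cnormM; apply: (@le_trans _ _ (b * (e / b * `|s - t|))).
  by apply: ler_pM; rewrite ?cnorm_ge0 ?hd// /b; lra.
by rewrite mulrA mulrCA divff ?mulr1// gt_eqF.
Qed.

Lemma deriv_on_cst t (c : Cx R) : deriv_on (fun=> c) t 0.
Proof.
by move=> e e0; exists 1 => // s _ _; rewrite subrr mulr0 subr0 cnorm0 mulr_ge0// ltW.
Qed.

Lemma deriv_on_id t : deriv_on (@rC R) t 1.
Proof.
by move=> e e0; exists 1 => // s _ _; rewrite mulr1 rmorphB /= subrr cnorm0 mulr_ge0// ltW.
Qed.

Lemma deriv_onB F G t D E : deriv_on F t D -> deriv_on G t E ->
  deriv_on (fun s => F s - G s) t (D - E).
Proof.
move=> hF /(deriv_onZ (-1)) hG.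
have := deriv_onD hF hG; rewrite mulN1r.
by congr deriv_on; apply/funext => s; rewrite mulN1r.
Qed.

Lemma deriv_on_Re F t D : deriv_on F t D -> deriv_on (fun s => rC (Cre (F s))) t (rC (Cre D)).
Proof.
move=> h e /h[d d0 hd]; exists d => // s sT /(hd s sT); apply: le_trans.
have -> : rC (Cre (F s)) - rC (Cre (F t)) - rC (s - t) * rC (Cre D) =
  rC (Cre (F s - F t - rC (s - t) * D)).
  by rewrite !ReImE mul0r subr0 !(rmorphB, rmorphM) /=; ring.
by rewrite cnorm_real le_Re.
Qed.

Lemma deriv_on_Im F t D : deriv_on F t D -> deriv_on (fun s => rC (Cim (F s))) t (rC (Cim D)).
Proof.
move=> h e /h[d d0 hd]; exists d => // s sT /(hd s sT); apply: le_trans.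
have -> : rC (Cim (F s)) - rC (Cim (F t)) - rC (s - t) * rC (Cim D) =
  rC (Cim (F s - F t - rC (s - t) * D)).
  by rewrite !ReImE mul0r addr0 !(rmorphB, rmorphM) /=; ring.
by rewrite cnorm_real le_Im.
Qed.

Lemma is_deriveP (f : R -> R) (t d : R) : is_derive t 1 f d <->
  forall e, 0 < e -> exists2 dl, 0 < dl & forall s, `|s - t| < dl ->
    `|f s - f t - (s - t) * d| <= e * `|s - t|.
Proof.
split.
- move=> [ex val] e e0.
  have : (fun h => h^-1 *: ((f \o shift t) (h *: 1) - f t)) @ 0^' --> d by rewrite -val.
  move=> /cvgrPdist_lt /(_ _ e0) /nbhs_ballP[dl /= dl0 hd]; exists dl => // s st.
  have [->|stn] := eqVneq s t; first by rewrite !subrr mul0r subr0 normr0 mulr0.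
  have st0 : s - t != 0 by rewrite subr_eq0.
  have := hd (s - t); rewrite /ball/= sub0r normrN => /(_ st st0).
  rewrite [_%:A]mulr1 subrK => h.
  have -> : f s - f t - (s - t) * d = - ((d - (s - t)^-1 *: (f s - f t)) * (s - t)).
    by rewrite /GRing.scale/=; field.
  by rewrite normrN normrM ler_wpM2r// ltW.
- move=> h.
  have lim : (fun h => h^-1 *: ((f \o shift t) (h *: 1) - f t)) @ 0^' --> d.
    apply/cvgrPdist_le => e e0; have [dl dl0 hd] := h _ e0.
    apply/nbhs_ballP; exists dl => //= x; rewrite /ball/= sub0r normrN => xd x0.
    rewrite [_%:A]mulr1.
    have := hd (x + t); rewrite addrK => /(_ xd).
    have -> : f (x + t) - f t - x * d = - ((d - x^-1 *: (f (x + t) - f t)) * x).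
      by rewrite /GRing.scale/=; field.
    by rewrite normrN normrM ler_pM2r// normr_gt0.
  split; first by apply/cvg_ex; exists d.
  exact/cvg_lim.
Qed.

Lemma is_derive_deriv_on (f : R -> R) t d : is_derive t 1 f d -> deriv_on (@rC R \o f) t (rC d).
Proof.
move=> /is_deriveP h e /h[dl dl0 hd]; exists dl => // s _ st.
by rewrite /= -rmorphB -rmorphM -rmorphB /= cnorm_real; exact: hd.
Qed.

Lemma deriv_on_is_derive (f : R -> R) t d : 0 < t < T -> deriv_on (@rC R \o f) t (rC d) ->
  is_derive t 1 f d.
Proof.
move=> /andP[t0 tT] h; apply/is_deriveP => e /h[dl dl0 hd].
exists (Num.min dl (Num.min t (T - t))); first by rewrite !lt_min dl0 t0 subr_gt0.
move=> s; rewrite !lt_min => /and3P[s1]; rewrite !ltr_norml => /andP[s2 s3] /andP[s4 s5].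
have sT : 0 <= s <= T by apply/andP; split; lra.
by have := hd s sT s1; rewrite /= -rmorphB -rmorphM -rmorphB /= cnorm_real.
Qed.

Lemma deriv_on_mono (f d : R -> R) a b : 0 <= a -> a <= b -> b <= T ->
  (forall t, 0 <= t <= T -> deriv_on (@rC R \o f) t (rC (d t))) ->
  (forall t, a <= t <= b -> 0 <= d t) -> f a <= f b.
Proof.
move=> a0; rewrite le_eqVlt => /predU1P[->//|ab] bT df d0.
have h1 (x : R) : x \in `]a, b[%R -> is_derive x 1 f (d x).
  rewrite in_itv/= => /andP[xa xb]; apply: deriv_on_is_derive; first by apply/andP; split; lra.
  by apply: df; apply/andP; split; lra.
have h2 : {within `[a, b], continuous f}.
  apply/subspace_continuousP => x /=; rewrite in_itv/= => /andP[xa xb].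
  have xT : 0 <= x <= T by apply/andP; split; lra.
  apply/cvgrPdist_lt => e e0; have [dl dl0 hd] := deriv_on_cont df xT e0.
  rewrite near_withinE; apply/nbhs_ballP; exists dl => //= s.
  rewrite /ball/= in_itv/= distrC => st /andP[sa sb].
  have sT : 0 <= s <= T by apply/andP; split; lra.
  by have := hd s sT st; rewrite /= -rmorphB cnorm_real distrC.
have [c cab] := MVT ab h1 h2.
move: cab; rewrite in_itv/= => /andP[ca cb] e.
by rewrite -subr_ge0 e mulr_ge0// ?d0 ?subr_ge0 ?(ltW ab)// (ltW ca) (ltW cb).
Qed.

(* Applied to the real and imaginary parts separately, whence the factor 2. *)
Lemma mean_value F D (g gp : R -> R) a b : 0 <= a -> a <= b -> b <= T ->
  (forall t, 0 <= t <= T -> deriv_on F t (D t)) ->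
  (forall t, 0 <= t <= T -> deriv_on (@rC R \o g) t (rC (gp t))) ->
  (forall t, a <= t <= b -> cnorm (D t) <= gp t) ->
  cnorm (F b - F a) <= 2 * (g b - g a).
Proof.
move=> a0 ab bT dF dg Dg.
have P (h k : R -> R) : (forall t, 0 <= t <= T -> deriv_on (@rC R \o h) t (rC (k t))) ->
   (forall t, `|k t| <= cnorm (D t)) -> `|h b - h a| <= g b - g a.
  move=> dh kD; rewrite ler_norml; apply/andP; split.
    rewrite opprB -subr_ge0.
    have -> : h b - h a - (g a - g b) = (g b + h b) - (g a + h a) by ring.
    rewrite subr_ge0; apply: (@deriv_on_mono (fun t => g t + h t) (fun t => gp t + k t)) => //.
      move=> t tT; rewrite rmorphD; have := deriv_onD (dg t tT) (dh t tT).
      by congr deriv_on; apply/funext => s; rewrite /= rmorphD.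
    move=> t tab; have := kD t; rewrite ler_norml => /andP[k1 _].
    by have := Dg t tab; lra.
  rewrite -subr_ge0.
  have -> : g b - g a - (h b - h a) = (g b - h b) - (g a - h a) by ring.
  rewrite subr_ge0; apply: (@deriv_on_mono (fun t => g t - h t) (fun t => gp t - k t)) => //.
    move=> t tT; rewrite rmorphB; have := deriv_onB (dg t tT) (dh t tT).
    by congr deriv_on; apply/funext => s; rewrite /= rmorphB.
  move=> t tab; have := kD t; rewrite ler_norml => /andP[_ k1].
  by have := Dg t tab; lra.
apply: le_trans (cnorm_ReIm _) _; rewrite !ReImE.
have p1 := P (fun t => Cre (F t)) (fun t => Cre (D t)) (fun t tT => deriv_on_Re (dF t tT)) (fun t
  => le_Re _).
have p2 := P (fun t => Cim (F t)) (fun t => Cim (D t)) (fun t tT => deriv_on_Im (dF t tT)) (fun t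
  => le_Im _).
by lra.
Qed.

End Calculus.

(** * Primitives and the Lebesgue integral *)

Section Primitive.
Variables (R : realType) (T : R).
Hypothesis T0 : 0 < T.
Implicit Types (f : R -> Cx R) (t s : R).

Lemma primitive_real (g : R -> R) : (forall x, {for x, continuous g}) ->
  exists G : R -> R, (forall t, 0 <= t <= T -> is_derive t 1 G (g t)) /\
    (\int[lebesgue_measure]_(t in `[0%R, T]) (g t)%:E)%E = (G T - G 0)%:E.
Proof.
move=> cg.
(* Integration starts at - 1 and is allowed up to T + 1, which makes 0 and T interior points with a
   two-sided derivative. *)
pose G y := (\int[@lebesgue_measure R]_(t in [set` `[-1, y]%R]) g t)%R.
have ig : (@lebesgue_measure R).-integrable [set` `[-1, T + 1]%R] (EFin \o g).
  apply: continuous_compact_integrable; first exact: segment_compact.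
  by apply: continuous_subspaceT => x; exact: cg.
have dG t : -1 < t < T + 1 -> is_derive t 1 G (g t).
  move=> /andP[t1 tT]; have [] := @continuous_FTC1_closed _ g (-1) t (T + 1) tT ig t1 (cg t).
  by rewrite derive1E => ex val; exact: DeriveDef.
exists G; split; first by move=> t /andP[t0 tT]; apply: dG; apply/andP; split; lra.
rewrite EFinB; apply: continuous_FTC2 => //.
- by apply: continuous_subspaceT => x; exact: cg.
- have cG t : -1 < t < T + 1 -> {for t, continuous G}.
    move=> /dG d; apply: differentiable_continuous; apply/derivable1_diffP.
    exact: ex_derive.
  split.
  + move=> x; rewrite in_itv/= => /andP[x0 xT].
    by have [] := dG x _; [apply/andP; split; lra|].
  + have z0 : -1 < (0 : R) < T + 1 by rewrite ltrN10 addr_gt0.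
    by apply: cvg_at_right_filter; exact: (cG _ z0).
  + have z0 : -1 < T < T + 1 by rewrite (lt_trans (ltrN10 R) T0) ltrDl ltr01.
    by apply: cvg_at_left_filter; exact: (cG _ z0).
- move=> x; rewrite in_itv/= => /andP[x0 xT].
  by rewrite derive1E; have [] := dG x _; [apply/andP; split; lra|].
Qed.

(** Retraction onto the segment: composing with it extends a function continuous on [0, T] to one
    continuous on the whole line, as [primitive_real] requires. *)
Let clamp t : R := if t < 0 then 0 else if T < t then T else t.

Let clampW t : [\/ clamp t = 0 /\ t < 0, clamp t = T /\ T < t | clamp t = t /\ 0 <= t <= T].
Proof.
rewrite /clamp; have [t0|t0] := ltP t 0; first by constructor 1.
by have [tT|tT] := ltP T t; [constructor 2|constructor 3].
Qed.

Let clampP t : 0 <= clamp t <= T.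
Proof.
by have [[-> _]|[-> _]|[-> //]] := clampW t; rewrite lexx ltW.
Qed.

Let clampE t : 0 <= t <= T -> clamp t = t.
Proof. by move=> /andP[t0 tT]; rewrite /clamp ltNge t0 /= ltNge tT. Qed.

Let clamp_lip s t : `|clamp s - clamp t| <= `|s - t|.
Proof.
have T1 : (0 : R) < T := T0.
have h1 : - (s - t) <= `|s - t| by rewrite -normrN ler_norm.
have h2 : s - t <= `|s - t| by rewrite ler_norm.
by rewrite ler_norml; have [[-> a]|[-> a]|[-> /andP[a b]]] := clampW s;
  have [[-> c]|[-> c]|[-> /andP[c d]]] := clampW t; apply/andP; split; lra.
Qed.

Let clamp_continuous (k : Cx R -> R) f : cont_on T f ->
  (forall z w, `|k z - k w| <= cnorm (z - w)) ->
  forall x, {for x, continuous (fun t => k (f (clamp t)))}.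
Proof.
move=> cf kl x; apply/cvgrPdist_lt => e e0.
have [d d0 hd] := cf _ (clampP x) _ e0.
apply/nbhs_ballP; exists d => //= s; rewrite /ball/= distrC => sx.
rewrite distrC; apply: le_lt_trans (kl _ _) _; apply: hd; first exact: clampP.
exact: le_lt_trans (clamp_lip _ _) sx.
Qed.

Lemma primitive_exists f : cont_on T f ->
  exists F, F 0 = 0 /\ forall t, 0 <= t <= T -> deriv_on T F t (f t).
Proof.
move=> cf.
have lRe z w : `|Cre z - Cre w| <= cnorm (z - w) :> R by rewrite -ReN -ReD le_Re.
have lIm z w : `|Cim z - Cim w| <= cnorm (z - w) :> R by rewrite -ImN -ImD le_Im.
have [X [dX _]] := primitive_real (clamp_continuous cf lRe).
have [Y [dY _]] := primitive_real (clamp_continuous cf lIm).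
exists (fun t => (rC (X t) + Ci * rC (Y t)) - (rC (X 0) + Ci * rC (Y 0))); split;
  first by rewrite subrr.
move=> t tT; have := is_derive_deriv_on T (dX t tT); have := is_derive_deriv_on T (dY t tT).
rewrite (clampE tT) => /(deriv_onZ Ci) h1 h2.
have := deriv_onB (deriv_onD h2 h1) (deriv_on_cst T t (rC (X 0) + Ci * rC (Y 0))).
by rewrite subr0 -ReImK.
Qed.

(** Converts the integral of the hypothesis on the largest eigenvalue into an increment of a
    primitive, in the form the mean value theorem consumes. *)
Lemma primitive_integral (g : R -> R) : cont_on T (@rC R \o g) ->
  exists G : R -> R, (forall t, 0 < t < T -> is_derive t 1 G (g t)) /\
    {within `[0, T], continuous G} /\
    (\int[lebesgue_measure]_(t in `[0%R, T]) (g t)%:E)%E = (G T - G 0)%:E.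
Proof.
move=> cg.
have lRe z w : `|Cre z - Cre w| <= cnorm (z - w) :> R by rewrite -ReN -ReD le_Re.
have [G [dG iG]] := primitive_real (clamp_continuous cg lRe).
have cE t : 0 <= t <= T -> Cre ((@rC R \o g) (clamp t)) = g t by move=> tT; rewrite /= clampE.
exists G; split.
  by move=> t /andP[t0 tT]; rewrite -cE; [apply: dG|]; rewrite !ltW.
split; last first.
  rewrite -iG; apply: eq_integral => t; rewrite inE/= in_itv/= => tT.
  by rewrite clampE.
apply: derivable_within_continuous => x; rewrite in_itv/= => xT.
by have [] := dG x xT.
Qed.

End Primitive.

(** * Matrix-valued functions and linear differential equations *)

Section MatrixNorm.
Variable R : realType.

(** The entrywise l1 norm. It is submultiplicative, but the identity has norm N and not 1, which
    influences the error recursion of the Trotter products. *)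
Definition mxl1 (m n : nat) (A : 'M[Cx R]_(m, n)) : R := \sum_i \sum_j cnorm (A i j).

Lemma mxl1_ge0 m n (A : 'M[Cx R]_(m, n)) : 0 <= mxl1 A.
Proof. by apply: sumr_ge0 => i _; apply: sumr_ge0 => j _; exact: cnorm_ge0. Qed.

Lemma le_mxl1 m n (A : 'M[Cx R]_(m, n)) i j : cnorm (A i j) <= mxl1 A.
Proof.
rewrite /mxl1 (bigD1 i)//= (bigD1 j)//= -addrA lerDl addr_ge0// sumr_ge0// => *.
- exact: cnorm_ge0.
- by apply: sumr_ge0 => *; exact: cnorm_ge0.
Qed.

Lemma mxl1_le m n (A : 'M[Cx R]_(m, n)) (b : R) : (forall i j, cnorm (A i j) <= b) -> mxl1 A <=
  (m * n)%:R * b.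
Proof.
move=> h; apply: (@le_trans _ _ (\sum_(i < m) \sum_(j < n) b)).
  by apply: ler_sum => i _; apply: ler_sum => j _.
under eq_bigr do rewrite sumr_const card_ord.
by rewrite sumr_const card_ord -mulrnA -[leLHS]mulr_natl mulnC lexx.
Qed.

Lemma mxl1D m n (A B : 'M[Cx R]_(m, n)) : mxl1 (A + B) <= mxl1 A + mxl1 B.
Proof.
rewrite /mxl1 -big_split/=; apply: ler_sum => i _.
by rewrite -big_split/=; apply: ler_sum => j _; rewrite mxE cnormD.
Qed.

Lemma mxl1N m n (A : 'M[Cx R]_(m, n)) : mxl1 (- A) = mxl1 A.
Proof. by apply: eq_bigr => i _; apply: eq_bigr => j _; rewrite mxE cnormN. Qed.

Lemma mxl1B m n (A B : 'M[Cx R]_(m, n)) : mxl1 (A - B) <= mxl1 A + mxl1 B.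
Proof. by rewrite -[mxl1 B]mxl1N mxl1D. Qed.

Lemma mxl1Z m n (c : Cx R) (A : 'M[Cx R]_(m, n)) : mxl1 (c *: A) = cnorm c * mxl1 A.
Proof.
rewrite /mxl1 mulr_sumr; apply: eq_bigr => i _.
by rewrite mulr_sumr; apply: eq_bigr => j _; rewrite mxE cnormM.
Qed.

Lemma mxl1M m n p (A : 'M[Cx R]_(m, n)) (B : 'M[Cx R]_(n, p)) : mxl1 (A *m B) <= mxl1 A * mxl1 B.
Proof.
rewrite {1 2}/mxl1 mulr_suml; apply: ler_sum => i _.
apply: (@le_trans _ _ (\sum_k \sum_j cnorm (A i j) * cnorm (B j k))).
  apply: ler_sum => k _; rewrite mxE; apply: le_trans (cnorm_sum _ _ _) _.
  by apply: ler_sum => j _; rewrite cnormM.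
rewrite exchange_big/= mulr_suml; apply: ler_sum => j _.
rewrite -mulr_sumr ler_wpM2l ?cnorm_ge0// /mxl1 [leRHS](bigD1 j)//= lerDl.
by apply: sumr_ge0 => *; apply: sumr_ge0 => *; exact: cnorm_ge0.
Qed.

Lemma mxl1_0 m n : mxl1 (0 : 'M[Cx R]_(m, n)) = 0.
Proof. by rewrite -(subrr (0 : 'M[Cx R]_(m, n))) /mxl1 big1// => i _; rewrite big1// => j _;
  rewrite !mxE subrr cnorm0. Qed.

Lemma mxl1_1 n : mxl1 (1%:M : 'M[Cx R]_n) = n%:R.
Proof.
rewrite /mxl1 (eq_bigr (fun=> 1)) ?sumr_const ?card_ord// => i _.
rewrite (bigD1 i)//= big1 ?addr0; first by rewrite mxE eqxx cnorm1.
by move=> j ji; rewrite mxE eq_sym (negbTE ji) cnorm0.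
Qed.

Lemma mxl1_le0 m n (A : 'M[Cx R]_(m, n)) : mxl1 A <= 0 -> A = 0.
Proof.
move=> h; apply/matrixP => i j; rewrite mxE; apply/eqP; rewrite -cnorm_eq0 eq_le cnorm_ge0 andbT.
exact: le_trans (le_mxl1 _ _ _) h.
Qed.

Lemma mxl1_sum m n (I : Type) (r : seq I) (P : pred I) (F : I -> 'M[Cx R]_(m, n)) :
  mxl1 (\sum_(i <- r | P i) F i) <= \sum_(i <- r | P i) mxl1 (F i).
Proof.
elim/big_ind2 : _ => [|x x' y y' h h'|//]; first by rewrite mxl1_0.
exact: le_trans (mxl1D _ _) (lerD h h').
Qed.

End MatrixNorm.

Lemma sub_mul_quot (F : fieldType) (x y d : F) : x != 0 -> y - x * d = - ((d - y / x) * x).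
Proof. by move=> x0; field. Qed.

Section MatrixCalculus.
Variables (R : realType) (T : R) (N : nat).
Hypothesis T0 : 0 < T.
Implicit Types (f g V W : R -> 'M[Cx R]_N) (t s : R).

Definition mcont f := forall i j, cont_on T (fun t => f t i j).
Definition mderiv V t (D : 'M[Cx R]_N) := forall i j, deriv_on T (fun s => V s i j) t (D i j).

Lemma mx_deriv_withinP V t (D : 'M[Cx R]_N) : mx_deriv_within `[0, T] V t D <-> mderiv V t D.
Proof.
split => h i j.
- move=> e e0.
  have e0' : 0 < rC e by rewrite -[0]/(rC 0) ltr_rC.
  have /cvgrPdist_lt /(_ _ e0') := h i j.
  rewrite near_withinE => /nbhs_ballP[d /= d0 hd]; exists d => // s sT st.
  have [->|sneq] := eqVneq s t; first by rewrite !subrr rmorph0 mul0r subr0 cnorm0 normr0 mulr0.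
  have st0 : rC (s - t) != 0 by rewrite -cnorm_eq0 cnorm_real normr_eq0 subr_eq0.
  have := hd s; rewrite /ball/= distrC => /(_ st).
  rewrite in_itv/= sT => /(_ (conj isT _)) H.
  have {}H : `|D i j - (V s i j - V t i j) / rC (s - t)| < rC e by apply: H => /eqP;
    rewrite (negbTE sneq).
  rewrite normE ltr_rC in H.
  have -> : V s i j - V t i j - rC (s - t) * D i j =
     - ((D i j - (V s i j - V t i j) / rC (s - t)) * rC (s - t)) by exact: sub_mul_quot.
  by rewrite cnormN cnormM cnorm_real ler_wpM2r// ltW.
- apply/cvgrPdist_lt => e e0.
  have eE : e = rC (Cre e) by apply: ReIm_eq => //; rewrite Im_rC; exact: (ger0_Im (ltW e0)).
  have re0 : 0 < Cre e by move: e0; rewrite eE -[0]/(rC 0) ltr_rC.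
  have re2 : 0 < Cre e / 2 by rewrite divr_gt0.
  have [d d0 hd] := h i j _ re2.
  rewrite near_withinE; apply/nbhs_ballP; exists d => //= s.
  rewrite /ball/= in_itv/= distrC => st [sT /eqP sneq].
  have st0 : rC (s - t) != 0 by rewrite -cnorm_eq0 cnorm_real normr_eq0 subr_eq0.
  rewrite normE eE ltr_rC -/(rC (s - t)).
  have := hd s sT st.
  have -> : V s i j - V t i j - rC (s - t) * D i j =
     - ((D i j - (V s i j - V t i j) / rC (s - t)) * rC (s - t)) by exact: sub_mul_quot.
  rewrite cnormN cnormM cnorm_real ler_pM2r; last by rewrite normr_gt0 subr_eq0.
  by move=> h1; apply: (le_lt_trans h1); lra.
Qed.

Lemma mcontP f : mcont f <-> forall t, 0 <= t <= T -> forall e, 0 < e ->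
  exists2 d, 0 < d & forall s, 0 <= s <= T -> `|s - t| < d -> mxl1 (f s - f t) < e.
Proof.
split => [cf t tT e e0|h i j t tT e e0]; last first.
  have [d d0 hd] := h t tT e e0; exists d => // s sT st.
  by apply: le_lt_trans (hd s sT st); have := le_mxl1 (f s - f t) i j; rewrite !mxE.
pose c : R := (N * N)%:R + 1.
have c0 : 0 < c by rewrite /c ltr_wpDl.
have e1 : 0 < e / c by rewrite divr_gt0.
have H (k : 'I_N * 'I_N) : exists d, 0 < d /\ forall s, 0 <= s <= T -> `|s - t| < d ->
    cnorm (f s k.1 k.2 - f t k.1 k.2) < e / c.
  by have [d d0 hd] := cf k.1 k.2 t tT _ e1; exists d.
have [d hd] := choice H.
exists (\big[Num.min/1]_k d k).
  by elim/big_ind : _ => // [x y x0 y0|k _]; [rewrite lt_min x0|have [] := hd k].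
move=> s sT st; apply: (@le_lt_trans _ _ ((N * N)%:R * (e / c))).
  apply: mxl1_le => i j; rewrite !mxE ltW//; have [_ /(_ s sT)] := hd (i, j); apply.
  apply: (lt_le_trans st); rewrite (bigD1 (i, j))//= ge_min lexx//.
by rewrite mulrCA gtr_pMr// ltr_pdivrMr// mul1r /c ltrDl.
Qed.

Lemma mcontM f g : mcont f -> mcont g -> mcont (fun t => f t *m g t).
Proof.
move=> /mcontP cf /mcontP cg; apply/mcontP => t tT e e0.
pose B := mxl1 (f t) + mxl1 (g t) + 1.
have B0 : 0 < B by have := mxl1_ge0 (f t); have := mxl1_ge0 (g t); rewrite /B; lra.
have e1 : 0 < Num.min 1 (e / (2 * B)) by rewrite lt_min ltr01 divr_gt0 ?mulr_gt0.
have [d d0 hd] := cf t tT _ e1; have [d' d0' hd'] := cg t tT _ e1.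
exists (Num.min d d'); first by rewrite lt_min d0.
move=> s sT; rewrite lt_min => /andP[s1 s2].
have := hd s sT s1; have := hd' s sT s2; rewrite !lt_min !ltr_pdivlMr ?mulr_gt0//.
move=> /andP[a1 a2] /andP[b1 b2].
have -> : f s *m g s - f t *m g t = (f s - f t) *m g s + f t *m (g s - g t).
  by rewrite mulmxBl mulmxBr addrA subrK.
apply: le_lt_trans (mxl1D _ _) _.
have gs : mxl1 (g s) <= B.
  rewrite -(subrK (g t) (g s)); apply: le_trans (mxl1D _ _) _.
  by have := mxl1_ge0 (f t); rewrite /B; lra.
have := mxl1M (f s - f t) (g s); have := mxl1M (f t) (g s - g t).
have d1 : mxl1 (f s - f t) * mxl1 (g s) <= mxl1 (f s - f t) * B by rewrite ler_wpM2l// mxl1_ge0.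
have d2 : mxl1 (f t) * mxl1 (g s - g t) <= B * mxl1 (g s - g t).
  by rewrite ler_wpM2r ?mxl1_ge0//; have := mxl1_ge0 (g t); rewrite /B; lra.
nra.
Qed.

Lemma mcont_unif f : mcont f -> forall e, 0 < e ->
  exists2 d, 0 < d & forall s t, 0 <= s <= T -> 0 <= t <= T -> `|s - t| < d -> mxl1 (f s - f t) < e.
Proof.
move=> cf e e0.
pose c : R := (N * N)%:R + 1.
have c0 : 0 < c by rewrite /c ltr_wpDl.
have e1 : 0 < e / c by rewrite divr_gt0.
have H (k : 'I_N * 'I_N) : exists d, 0 < d /\ forall s t, 0 <= s <= T -> 0 <= t <= T -> `|s - t|
  < d ->
    cnorm (f s k.1 k.2 - f t k.1 k.2) < e / c.
  by have [d d0 hd] := cont_on_unif (cf k.1 k.2) e1; exists d.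
have [d hd] := choice H.
exists (\big[Num.min/1]_k d k).
  by elim/big_ind : _ => // [x y x0 y0|k _]; [rewrite lt_min x0|have [] := hd k].
move=> s t sT tT st; apply: (@le_lt_trans _ _ ((N * N)%:R * (e / c))).
  apply: mxl1_le => i j; rewrite !mxE ltW//; have [_ /(_ s t sT tT)] := hd (i, j); apply.
  apply: (lt_le_trans st); rewrite (bigD1 (i, j))//= ge_min lexx//.
by rewrite mulrCA gtr_pMr// ltr_pdivrMr// mul1r /c ltrDl.
Qed.

Lemma mcont_bounded f : mcont f -> exists2 M, 0 < M & forall t, 0 <= t <= T -> mxl1 (f t) <= M.
Proof.
move=> cf.
have H (k : 'I_N * 'I_N) : exists M, 0 <= M /\ forall t, 0 <= t <= T -> cnorm (f t k.1 k.2) <= M.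
  by have [M M0 hM] := cont_on_bounded (cf k.1 k.2); exists M.
have [M hM] := choice H.
exists ((N * N)%:R * (\sum_k M k) + 1).
  by rewrite ltr_wpDl// mulr_ge0// sumr_ge0// => k _; have [] := hM k.
move=> t tT; apply: (@le_trans _ _ ((N * N)%:R * (\sum_k M k))); last by rewrite lerDl.
apply: mxl1_le => i j; have [_ /(_ t tT) h] := hM (i, j); apply: (le_trans h).
rewrite (bigD1 (i, j))//= lerDl sumr_ge0// => k _; by have [] := hM k.
Qed.

Lemma mderiv_cont V D : (forall t, 0 <= t <= T -> mderiv V t (D t)) -> mcont V.
Proof. by move=> h i j; apply: (@deriv_on_cont _ _ _ (fun t => D t i j)) => t tT; exact: h. Qed.

Lemma mean_value_mxl1 V D (g gp : R -> R) a b : 0 <= a -> a <= b -> b <= T ->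
  (forall t, 0 <= t <= T -> mderiv V t (D t)) ->
  (forall t, 0 <= t <= T -> deriv_on T (@rC R \o g) t (rC (gp t))) ->
  (forall t, a <= t <= b -> mxl1 (D t) <= gp t) ->
  mxl1 (V b - V a) <= (N * N)%:R * (2 * (g b - g a)).
Proof.
move=> a0 ab bT dV dg Dg; apply: mxl1_le => i j; rewrite !mxE.
apply: (@mean_value _ T (fun t => V t i j) (fun t => D t i j) g gp) => //.
- by move=> t tT; exact: dV.
- by move=> t tab; apply: le_trans (Dg t tab); exact: le_mxl1.
Qed.

Lemma mean_value_cst V D (M : R) a b : 0 <= a -> a <= b -> b <= T ->
  (forall t, 0 <= t <= T -> mderiv V t (D t)) ->
  (forall t, a <= t <= b -> mxl1 (D t) <= M) ->
  mxl1 (V b - V a) <= (N * N)%:R * (2 * (M * (b - a))).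
Proof.
move=> a0 ab bT dV DM; rewrite mulrBr.
apply: (@mean_value_mxl1 V D (fun t => M * t) (fun=> M)) => //.
move=> t tT; have := deriv_onZ (rC M) (deriv_on_id T t); rewrite mulr1.
by congr deriv_on; apply/funext => s; rewrite /= rmorphM.
Qed.

Lemma mderivB V W t D E : mderiv V t D -> mderiv W t E -> mderiv (fun s => V s - W s) t (D - E).
Proof.
move=> hV hW i j; rewrite !mxE.
have := deriv_onB (hV i j) (hW i j).
by congr deriv_on; apply/funext => s; rewrite !mxE.
Qed.

Lemma mderivD V W t D E : mderiv V t D -> mderiv W t E -> mderiv (fun s => V s + W s) t (D + E).
Proof.
move=> hV hW i j; rewrite !mxE.
have := deriv_onD (hV i j) (hW i j).
by congr deriv_on; apply/funext => s; rewrite !mxE.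
Qed.

Lemma mderiv_cst t (C : 'M[Cx R]_N) : mderiv (fun=> C) t 0.
Proof. by move=> i j; rewrite mxE; exact: deriv_on_cst. Qed.

Lemma mderiv_lin t (C : 'M[Cx R]_N) : mderiv (fun s => rC s *: C) t C.
Proof.
move=> i j; have := deriv_onZ (C i j) (deriv_on_id T t); rewrite mulr1.
by congr deriv_on; apply/funext => s; rewrite !mxE mulrC.
Qed.

Lemma mprimitive_exists f : mcont f ->
  exists F : R -> 'M[Cx R]_N, F 0 = 0 /\ forall t, 0 <= t <= T -> mderiv F t (f t).
Proof.
move=> cf.
have H (k : 'I_N * 'I_N) : exists F : R -> Cx R, F 0 = 0 /\
   forall t, 0 <= t <= T -> deriv_on T F t (f t k.1 k.2).
  exact: primitive_exists (cf k.1 k.2).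
have [F hF] := choice H.
exists (fun t => \matrix_(i, j) F (i, j) t); split.
  by apply/matrixP => i j; rewrite !mxE; have [] := hF (i, j).
move=> t tT i j; have [_ /(_ t tT)] := hF (i, j).
by congr deriv_on; apply/funext => s; rewrite mxE.
Qed.

End MatrixCalculus.

(** * Picard iteration for linear equations *)

Section Picard.
Variables (R : realType) (T : R) (N : nat).
Hypothesis T0 : 0 < T.
Implicit Types (V W : R -> 'M[Cx R]_N) (t s : R).

Lemma is_derive_expRM (k t : R) : is_derive t 1 (fun s => expR (k * s)) (k * expR (k * t)).
Proof.
have h : is_derive t 1 (fun s => k * s) k.
  have := is_deriveZ k (is_derive_id t (1 : R)).
  by move=> h; apply: is_derive_eq; rewrite /GRing.scale/= mulr1.
have := is_derive1_comp (is_derive_expR (k * t)) h.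
by rewrite mulrC.
Qed.

Lemma geometric_tail (K : R) n m : (n <= m)%N ->
  \sum_(n <= k < m) K / 2 ^+ k = 2 * K / 2 ^+ n - 2 * K / 2 ^+ m.
Proof.
elim: m => [|m IH]; first by rewrite leqn0 => /eqP ->; rewrite big_geq// subrr.
rewrite leq_eqVlt => /predU1P[->|]; first by rewrite big_geq// subrr.
rewrite ltnS => nm; rewrite big_nat_recr//= IH// exprS; field.
by rewrite !expf_neq0.
Qed.

Lemma exists_geometric_lt (X e : R) : 0 < e -> exists n : nat, X / 2 ^+ n < e.
Proof.
move=> e0; have [n hn] := exists_inv_lt `|X| e0; exists n.
apply: le_lt_trans (hn n (leqnn _)).
apply: (@le_trans _ _ (`|X| / 2 ^+ n)).
  by rewrite ler_pM2r ?ler_norm// invr_gt0 exprn_gt0.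
rewrite ler_wpM2l// lef_pV2 ?posrE ?exprn_gt0 ?ltr0Sn//.
by rewrite -natrX ler_nat; exact: ltn_expl.
Qed.

Lemma mderiv_ext V W t D : 0 <= t <= T -> (forall s, 0 <= s <= T -> V s = W s) ->
  mderiv T V t D -> mderiv T W t D.
Proof.
move=> tT VW h i j e /(h i j)[d d0 hd]; exists d => // s sT st.
by rewrite -(VW s sT) -(VW t tT); exact: hd.
Qed.

(** The solution is the sum of the iterated integrals [D n] with [D 0] the identity and [D n.+1] the
    primitive of G times [D n]. *)
Theorem linear_ode_exists (G : R -> 'M[Cx R]_N) : mcont T G ->
  exists V, V 0 = 1%:M /\ forall t, 0 <= t <= T -> mderiv T V t (G t *m V t).
Proof.
move=> cG; have T1 : (0 : R) < T := T0.
have [C C0 GC] := mcont_bounded cG.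
(* [choice] needs a total operator, so discontinuous integrands are sent to the zero function. *)
have P (f : R -> 'M[Cx R]_N) : exists F : R -> 'M[Cx R]_N,
    mcont T f -> F 0 = 0 /\ forall t, 0 <= t <= T -> mderiv T F t (f t).
  have [cf|ncf] := pselect (mcont T f); last by exists (fun=> 0).
  by have [F hF] := mprimitive_exists T0 cf; exists F.
have [prim hprim] := choice P.
pose D n := iter n (fun D => prim (fun t => G t *m D t)) (fun=> 1%:M).
have cD n : mcont T (D n).
  elim: n => [|n IH].
    by apply: (@mderiv_cont _ _ _ _ (fun=> 0)) => t tT; exact: mderiv_cst.
  have [_ h] := hprim _ (mcontM cG IH).
  exact: mderiv_cont h.
have dD n t : 0 <= t <= T -> mderiv T (D n.+1) t (G t *m D n t).
  by move=> tT; have [_ h] := hprim _ (mcontM cG (cD n)); exact: h.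
have D0 n : D n.+1 0 = 0 by have [h _] := hprim _ (mcontM cG (cD n)).
pose N2 : R := (N * N)%:R.
have N20 : 0 <= N2 by rewrite /N2.
(* The weight [expR (kp * t)] makes every Picard step a contraction of ratio 1/2. *)
pose kp := 4 * (N2 + 1) * C.
have kp0 : 0 < kp by rewrite mulr_gt0// mulr_gt0// ltr_wpDl.
pose B : R := N%:R + 1.
have B0 : 0 < B by rewrite ltr_wpDl.
have bD n t : 0 <= t <= T -> mxl1 (D n t) <= B / 2 ^+ n * expR (kp * t).
  elim: n t => [|n IH] t /andP[t0 tT].
    rewrite /D/= mxl1_1 divr1; apply: (@le_trans _ _ (B * 1)); first by rewrite mulr1 lerDl.
    by rewrite ler_pM2l// -expR0 ler_expR mulr_ge0// ltW.
  pose c := C * B / 2 ^+ n.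
  have c0 : 0 < c by rewrite divr_gt0 ?exprn_gt0// mulr_gt0.
  have := @mean_value_mxl1 R T N (D n.+1) (fun s => G s *m D n s)
    (fun s => c / kp * expR (kp * s)) (fun s => c * expR (kp * s)) 0 t (lexx _) t0 tT (dD n).
  rewrite D0 subr0 => h; apply: le_trans (h _ _) _.
  - move=> s sT; have := is_derive_deriv_on T (is_derive_expRM kp s).
    move=> /(deriv_onZ (rC (c / kp))); rewrite -rmorphM /= mulrA divfK ?gt_eqF//.
    by congr deriv_on; apply/funext => x; rewrite /= -rmorphM.
  - move=> s /andP[s0 st].
    have sT : 0 <= s <= T by rewrite s0 (le_trans st).
    apply: le_trans (mxl1M _ _) _; apply: (@le_trans _ _ (C * (B / 2 ^+ n * expR (kp * s)))).
      by apply: ler_pM; rewrite ?mxl1_ge0 ?GC ?IH.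
    by rewrite /c !mulrA.
  - apply: (@le_trans _ _ (N2 * (2 * (c / kp * expR (kp * t))))).
      apply: ler_wpM2l => //; rewrite ler_pM2l// lerBlDr lerDl mulr_ge0 ?expR_ge0//.
      by rewrite divr_ge0 ?ltW.
    have -> : N2 * (2 * (c / kp * expR (kp * t))) = (N2 / (N2 + 1)) * (B / 2 ^+ n.+1 * expR (kp *
      t)).
      rewrite /c /kp exprS; field.
      by rewrite expf_neq0//= !gt_eqF// ltr_wpDl.
    rewrite ler_piMl//; first by rewrite mulr_ge0 ?expR_ge0// divr_ge0 ?exprn_ge0// ltW.
    by rewrite ler_pdivrMr ?mul1r ?lerDl// ltr_wpDl.
pose K := B * expR (kp * T).
have K0 : 0 < K by rewrite mulr_gt0 ?expR_gt0.
have bK n t : 0 <= t <= T -> mxl1 (D n t) <= K / 2 ^+ n.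
  move=> tT; apply: (le_trans (bD n t tT)); rewrite /K mulrAC ler_pM2r ?invr_gt0 ?exprn_gt0//.
  by rewrite ler_pM2l// ler_expR ler_pM2l//; case/andP: tT.
have p2 n : 0 < 2 ^+ n :> R by rewrite exprn_gt0.
have q0 n : 0 <= 2 * K / 2 ^+ n.
  by apply: divr_ge0; [apply: mulr_ge0; [|exact: ltW]|exact: ltW].
pose W n t := \sum_(k < n) D k t.
have tail n m t : (n <= m)%N -> 0 <= t <= T -> mxl1 (W m t - W n t) <= 2 * K / 2 ^+ n.
  move=> nm tT; rewrite /W -!(big_mkord xpredT (fun k => D k t)).
  rewrite (@big_cat_nat _ _ _ n)//= addrAC subrr add0r.
  apply: le_trans (mxl1_sum _ _ _) _; apply: (@le_trans _ _ (\sum_(n <= k < m) K / 2 ^+ k)).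
    by apply: ler_sum => k _; exact: bK.
  by rewrite geometric_tail// lerBlDr lerDl.
have lim t : exists v : 'M[Cx R]_N, 0 <= t <= T -> forall n, mxl1 (v - W n t) <= N2 * (2 * K / 2
  ^+ n).
  have [tT|_] := boolP (0 <= t <= T); last by exists 0.
  have H (k : 'I_N * 'I_N) : exists l, clim (fun n => \sum_(i < n) D i t k.1 k.2) l.
    apply: (@series_domination R (fun i => D i t k.1 k.2) (fun i => K / 2 ^+ i) (2 * K)).
      by move=> i; apply: le_trans (bK i t tT); exact: le_mxl1.
    move=> n; rewrite -(big_mkord xpredT (fun i => K / 2 ^+ i)) geometric_tail//.
    by rewrite expr0 divr1 lerBlDr lerDl.
  have [l hl] := choice H; exists (\matrix_(i, j) l (i, j)) => _ n.
  apply: mxl1_le => i j; rewrite !mxE /= summxE.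
  apply: (@clim_le _ (fun n => \sum_(k < n) D k t i j) _ _ _ n); last exact: (hl (i, j)).
  move=> m nm; apply: le_trans (tail n m t nm tT).
  by have := le_mxl1 (W m t - W n t) i j; rewrite !mxE !summxE.
have [V hV] := choice lim.
have dW n t : 0 <= t <= T -> mderiv T (W n.+1) t (G t *m W n t).
  move=> tT; elim: n => [|n IH].
    rewrite /W big_ord0 mulmx0 (_ : (fun t => _) = (fun=> 1%:M)); first exact: mderiv_cst.
    by apply/funext => s; rewrite big_ord1.
  rewrite (_ : W n.+2 = (fun t => W n.+1 t + D n.+1 t)); last first.
    by apply/funext => s; rewrite /W [LHS]big_ord_recr.
  rewrite (_ : W n.+1 t = W n t + D n t); last by rewrite /W big_ord_recr.
  by rewrite mulmxDr; apply: mderivD => //; exact: dD.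
have cV : mcont T V.
  apply/mcontP => t tT e e0.
  have e4 : 0 < e / 4 by rewrite divr_gt0.
  have [n hn] := exists_geometric_lt (N2 * (2 * K)) e4.
  have hn1 : N2 * (2 * K / 2 ^+ n.+1) < e / 4.
    apply: le_lt_trans hn; rewrite mulrA; apply: ler_wpM2l;
      first by rewrite mulr_ge0// mulr_ge0// ltW.
    by rewrite lef_pV2 ?posrE// exprS ler_peMl// ?ltW// ltr1n.
  have cW : mcont T (W n.+1) by apply: (@mderiv_cont _ _ _ _ (fun t => G t *m W n t)) => s;
    exact: dW.
  have [d d0 hd] := (mcontP T (W n.+1)).1 cW t tT _ e4; exists d => // s sT st.
  have -> : V s - V t = (V s - W n.+1 s) + (W n.+1 s - W n.+1 t) - (V t - W n.+1 t).
    by rewrite addrA subrK opprB addrA subrK.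
  apply: le_lt_trans (mxl1B _ _) _; apply: le_lt_trans (lerD (mxl1D _ _) (lexx _)) _.
  have := hV s sT n.+1; have := hV t tT n.+1; have := hd s sT st; lra.
(* The limit V is not differentiated term by term. Its equation is read off from V = 1 + Y with Y a
   primitive of G V; this equality holds because 1 + Y - W n.+1 vanishes at 0 and has derivative G
   (V - W n), which is geometrically small. *)
have [Y0 dY] := hprim _ (mcontM cG cV).
set Y := prim _ in Y0 dY.
have YV t : 0 <= t <= T -> 1%:M + Y t = V t.
  move=> tT; apply/eqP; rewrite -subr_eq0; apply/eqP/mxl1_le0/ler_addgt0Pl => e e0; rewrite addr0.
  pose X := N2 * (2 * (C * (N2 * (2 * K)) * T)) + N2 * (2 * K).
  have [n hn] := exists_geometric_lt X e0; apply: le_trans (ltW hn).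
  have dYW s : 0 <= s <= T -> mderiv T (fun t => (1%:M + Y t) - W n.+1 t) s (G s *m (V s - W n s)).
    move=> sT; rewrite mulmxBr; apply: mderivB; last exact: dW.
    by rewrite -[G s *m V s]add0r; apply: mderivD; [exact: mderiv_cst|exact: dY].
  have /andP[t0 tT'] := tT.
  have := @mean_value_cst R T N _ _ (C * (N2 * (2 * K / 2 ^+ n))) 0 t (lexx _) t0 tT' dYW.
  have -> : 1%:M + Y 0 - W n.+1 0 = 0.
    rewrite Y0 addr0 /W big_ord_recl big1 ?addr0 ?subrr// => i _.
    exact: D0.
  rewrite subr0 => h.
  have -> : 1%:M + Y t - V t = (1%:M + Y t - W n.+1 t) - (V t - W n.+1 t) by rewrite opprB addrA
    subrK.
  apply: le_trans (mxl1B _ _) _.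
  apply: le_trans (lerD (h _) (hV t tT n.+1)) _.
    move=> s /andP[s0 st]; have sT : 0 <= s <= T by rewrite s0 (le_trans st).
    apply: le_trans (mxl1M _ _) _.
    by apply: ler_pM; rewrite ?mxl1_ge0 ?GC ?hV.
  rewrite /X subr0 (mulrDl _ _ (2 ^+ n)^-1); apply: lerD.
    have -> : N2 * (2 * (C * (N2 * (2 * K / 2 ^+ n)) * t)) = (N2 * (2 * (C * (N2 * (2 * K))))) /
      2 ^+ n * t by ring.
    have -> : N2 * (2 * (C * (N2 * (2 * K)) * T)) / 2 ^+ n = (N2 * (2 * (C * (N2 * (2 * K))))) /
      2 ^+ n * T by ring.
    apply: ler_wpM2l => //; apply: divr_ge0; last exact: ltW.
    by rewrite mulr_ge0// mulr_ge0// mulr_ge0 ?(ltW C0)// mulr_ge0// mulr_ge0// ltW.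
  rewrite mulrA; apply: ler_wpM2l.
    by apply: mulr_ge0 => //; apply: mulr_ge0 => //; exact: ltW.
  by rewrite lef_pV2 ?posrE// exprS ler_peMl// ?ltW// ltr1n.
exists V; split.
  by rewrite -YV ?lexx ?ltW// Y0 addr0.
move=> t tT; apply: (@mderiv_ext (fun s => 1%:M + Y s)) => //.
by rewrite -[G t *m V t]add0r; apply: mderivD; [exact: mderiv_cst|exact: dY].
Qed.

End Picard.

(** [texp] is the endpoint of a curve picked by epsilon; the existence theorem guarantees that this
    curve solves the equation. *)
Lemma texp_exists (R : realType) (N : nat) (B : R -> 'M[Cx R]_N) (T : R) : 0 < T ->
  mcont T B -> exists V : R -> 'M[Cx R]_N, [/\ V 0 = 1%:M, V T = texp B T &
    forall t, 0 <= t <= T -> mderiv T V t (- (B t *m V t))].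
Proof.
move=> T0 cB.
have cNB : mcont T (fun t => - B t).
  by apply/mcontP => t tT e /((mcontP T B).1 cB t tT)[d d0 hd]; exists d => // s sT /(hd s sT);
    rewrite -opprD mxl1N.
have [V [V0 dV]] := linear_ode_exists T0 cNB.
have ex : exists V, texp_sol B T V.
  by exists V; split=> // t tT; apply/mx_deriv_withinP; rewrite -mulNmx; exact: dV.
have [W0 dW] := ClassicalEpsilon.epsilon_spec (inhabits (fun _ : R => (1%:M : 'M[Cx R]_N))) _ ex.
exists (ClassicalEpsilon.epsilon (inhabits (fun _ : R => (1%:M : 'M[Cx R]_N))) (texp_sol B T));
  split=> // t tT.
by apply/mx_deriv_withinP; exact: dW.
Qed.

(** * Hermitian matrices *)

Section Adjoint.
Variable R : realType.

Lemma conj_cconj (z : Cx R) : Num.conj z = cconj z.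
Proof.
by [].
Qed.

Lemma adjmxE m n (A : 'M[Cx R]_(m, n)) : adjmx A = map_mx Num.conj A^T.
Proof. by apply/matrixP => i j; rewrite !mxE conj_cconj. Qed.

Lemma adjmxK m n (A : 'M[Cx R]_(m, n)) : adjmx (adjmx A) = A.
Proof. by apply/matrixP => i j; rewrite !mxE conjcK. Qed.

Lemma adjmxM m n p (A : 'M[Cx R]_(m, n)) (B : 'M[Cx R]_(n, p)) :
  adjmx (A *m B) = adjmx B *m adjmx A.
Proof. by rewrite !adjmxE trmx_mul map_mxM. Qed.

Lemma adjmxD m n (A B : 'M[Cx R]_(m, n)) : adjmx (A + B) = adjmx A + adjmx B.
Proof. by rewrite !adjmxE raddfD map_mxD. Qed.

Lemma adjmxZ m n (c : Cx R) (A : 'M[Cx R]_(m, n)) : adjmx (c *: A) = cconj c *: adjmx A.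
Proof. by rewrite !adjmxE linearZ map_mxZ /= conj_cconj. Qed.

Lemma adjmx1 n : adjmx (1%:M : 'M[Cx R]_n) = 1%:M.
Proof. by rewrite adjmxE trmx1 map_mx1. Qed.

Lemma mxl1_adjmx m n (A : 'M[Cx R]_(m, n)) : mxl1 (adjmx A) = mxl1 A.
Proof.
rewrite /mxl1 exchange_big; apply: eq_bigr => i _; apply: eq_bigr => j _.
by rewrite mxE -[conjc _]/(cconj _) cnormJ.
Qed.

Definition rdiag n (d : 'I_n -> Cx R) : 'M[Cx R]_n := diag_mx (\row_i d i).

Lemma rdiag_mul n m (d : 'I_n -> Cx R) (A : 'M[Cx R]_(n, m)) i j : (rdiag d *m A) i j = d i * A i j.
Proof. by rewrite /rdiag mul_diag_mx !mxE. Qed.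

Lemma rdiagE n (d : 'I_n -> Cx R) i j : rdiag d i j = d i *+ (i == j).
Proof. by rewrite !mxE. Qed.

Lemma spectral_decomposition n (L : 'M[Cx R]_n) : hermitian_mx L ->
  exists P : 'M[Cx R]_n, exists lam : 'I_n -> R,
  [/\ P *m adjmx P = 1%:M, adjmx P *m P = 1%:M &
      L = adjmx P *m rdiag (fun i => rC (lam i)) *m P].
Proof.
move=> hL.
have normL : L \is normalmx.
  by apply/normalmxP; rewrite -adjmxE hL.
pose P := spectralmx L; pose D := spectral_diag L.
have uP : P *m adjmx P = 1%:M.
  by have /unitarymxP := spectral_unitarymx L; rewrite -adjmxE.
have uP' : adjmx P *m P = 1%:M by apply: mulmx1C.
have LE : L = adjmx P *m diag_mx D *m P.
  have /orthomx_spectralP := normL; rewrite invmx_unitary ?spectral_unitarymx//.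
  by rewrite -adjmxE.
have DE : diag_mx D = P *m L *m adjmx P.
  by rewrite LE !mulmxA uP mul1mx -mulmxA uP mulmx1.
(* The diagonal matrix is P L P^H, hence Hermitian, so its entries equal their conjugates. *)
have Dr i : D 0 i = rC (Cre (D 0 i)).
  have := congr1 (fun M : 'M[Cx R]_n => M i i) (congr1 (@adjmx R n n) DE).
  rewrite !adjmxM adjmxK hL mulmxA -DE !mxE eqxx mulr1n -[conjc _]/(cconj _) => e.
  apply: ReIm_eq => //; rewrite Im_rC; have := congr1 (@Cim R) e; rewrite ImJ.
  by move=> /eqP; rewrite eqNr => /eqP.
exists P, (fun i => Cre (D 0 i)); split; [exact: uP|exact: uP'|].
rewrite {1}LE; congr (_ *m _ *m _); congr diag_mx.
by apply/rowP => i; rewrite !mxE -Dr.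
Qed.

(** The square of the Frobenius norm. Unlike [mxl1] it is invariant under unitary factors, which is
    what makes the bound on Trotter products independent of real z. *)
Definition frob m n (A : 'M[Cx R]_(m, n)) : R := \sum_i \sum_j cnorm (A i j) ^+ 2.

Lemma frob_ge0 m n (A : 'M[Cx R]_(m, n)) : 0 <= frob A.
Proof. by apply: sumr_ge0 => i _; apply: sumr_ge0 => j _; exact: sqr_ge0. Qed.

Lemma le_frob m n (A : 'M[Cx R]_(m, n)) i j : cnorm (A i j) ^+ 2 <= frob A.
Proof.
rewrite /frob (bigD1 i)//= (bigD1 j)//= -addrA lerDl addr_ge0// sumr_ge0// => *.
- exact: sqr_ge0.
- by apply: sumr_ge0 => *; exact: sqr_ge0.
Qed.

Lemma frob_tr m n (A : 'M[Cx R]_(m, n)) : rC (frob A) = \tr (A *m adjmx A).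
Proof.
rewrite /frob /mxtrace rmorph_sum /=; apply: eq_bigr => i _.
rewrite rmorph_sum /= mxE; apply: eq_bigr => j _.
by rewrite !mxE -[conjc _]/(cconj _) mulJ.
Qed.

Lemma frob_mulr m n p (A : 'M[Cx R]_(m, n)) (U : 'M[Cx R]_(n, p)) : U *m adjmx U = 1%:M ->
  frob (A *m U) = frob A.
Proof.
by move=> uU; apply: rCI; rewrite !frob_tr adjmxM mulmxA -(mulmxA A) uU mulmx1.
Qed.

Lemma frob_mull m n p (A : 'M[Cx R]_(m, n)) (U : 'M[Cx R]_(p, m)) : adjmx U *m U = 1%:M ->
  frob (U *m A) = frob A.
Proof.
by move=> uU; apply: rCI; rewrite !frob_tr adjmxM mulmxA mxtrace_mulC !mulmxA uU mul1mx.
Qed.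

Lemma frob_diag m n (A : 'M[Cx R]_(m, n)) (d : 'I_m -> Cx R) : (forall i, cnorm (d i) = 1) ->
  frob (rdiag d *m A) = frob A.
Proof.
move=> d1; apply: eq_bigr => i _; apply: eq_bigr => j _.
by rewrite rdiag_mul cnormM d1 mul1r.
Qed.

Lemma frob1 n : frob (1%:M : 'M[Cx R]_n) = n%:R.
Proof.
by apply: rCI; rewrite frob_tr adjmx1 mulmx1 mxtrace1 rmorph_nat.
Qed.

Lemma frob_mul_le m n (H : 'M[Cx R]_m) (A : 'M[Cx R]_(m, n)) :
  frob (H *m A) <= (m * n)%:R * mxl1 H ^+ 2 * frob A.
Proof.
have F0 := frob_ge0 A.
pose s := Num.sqrt (frob A).
have sE : s ^+ 2 = frob A by rewrite sqr_sqrtr.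
have s0 : 0 <= s by rewrite sqrtr_ge0.
have As k j : cnorm (A k j) <= s.
  by rewrite -(ler_pXn2r (n := 2))// ?nnegrE ?cnorm_ge0// sE le_frob.
have b i j : cnorm ((H *m A) i j) ^+ 2 <= mxl1 H ^+ 2 * frob A.
  rewrite -sE -exprMn ler_pXn2r ?nnegrE ?cnorm_ge0 ?mulr_ge0 ?mxl1_ge0//.
  rewrite mxE; apply: le_trans (cnorm_sum _ _ _) _.
  apply: (@le_trans _ _ (\sum_k cnorm (H i k) * s)).
    by apply: ler_sum => k _; rewrite cnormM ler_wpM2l ?cnorm_ge0.
  rewrite -mulr_suml ler_wpM2r// /mxl1 [leRHS](bigD1 i)//= lerDl.
  by apply: sumr_ge0 => *; apply: sumr_ge0 => *; exact: cnorm_ge0.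
rewrite /frob; apply: (@le_trans _ _ (\sum_(i < m) \sum_(j < n) (mxl1 H ^+ 2 * frob A))).
  by apply: ler_sum => i _; apply: ler_sum => j _.
under eq_bigr do rewrite sumr_const card_ord.
by rewrite sumr_const card_ord -mulrnA -[leLHS]mulr_natl mulnC mulrA lexx.
Qed.

(* (1 - i delta H)^* (1 - i delta H) = 1 + delta^2 H^2 *)
Lemma frob_euler m n (H : 'M[Cx R]_m) (A : 'M[Cx R]_(m, n)) (dl : R) : hermitian_mx H ->
  frob ((1%:M - (Ci * rC dl) *: H) *m A) = frob A + dl ^+ 2 * frob (H *m A).
Proof.
move=> hH; apply: rCI; rewrite rmorphD rmorphM /= !frob_tr.
set M := 1%:M - _.
have MM : adjmx M *m M = 1%:M + rC (dl ^+ 2) *: (H *m H).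
  have -> : adjmx M = 1%:M + (Ci * rC dl) *: H.
    rewrite /M -scaleNr adjmxD adjmx1 adjmxZ hH; congr (_ + _ *: _).
    by apply: ReIm_eq; rewrite !ReImE; ring.
  rewrite /M mulmxDl mul1mx mulmxBr mulmx1 -scalemxAl -scalemxAr scalerA.
  rewrite addrA subrK; congr (_ + _).
  rewrite -scaleNr; congr (_ *: _); rewrite mulrACA CiCi expr2 rmorphM /=; ring.
have tE (X : 'M[Cx R]_m) : \tr (X *m A *m adjmx (X *m A)) = \tr (adjmx X *m X *m (A *m adjmx A)).
  by rewrite adjmxM mulmxA mxtrace_mulC !mulmxA.
by rewrite !tE MM mulmxDl mul1mx mxtraceD -scalemxAl mxtraceZ hH.
Qed.

(** The rows have norm one, so every entry has modulus at most one. *)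
Lemma unitary_mxl1_le n (P : 'M[Cx R]_n) : P *m adjmx P = 1%:M -> mxl1 P <= (n * n)%:R.
Proof.
move=> uP; rewrite -[leRHS]mulr1; apply: mxl1_le => i j.
have := congr1 (fun M : 'M[Cx R]_n => M i i) uP; rewrite !mxE eqxx mulr1n.
under eq_bigr do rewrite !mxE -[conjc _]/(cconj _) mulJ.
rewrite -rmorph_sum /= => /(congr1 (@Cre R)); rewrite Re_rC Re1 => h.
rewrite -(ler_pXn2r (n := 2))// ?nnegrE ?cnorm_ge0// expr1n -h (bigD1 j)//= lerDl.
by apply: sumr_ge0 => *; exact: sqr_ge0.
Qed.

(** [eigenvalue] refers to row vectors, and row i of P is a left eigenvector. *)
Lemma eigenvalue_spectral n (P : 'M[Cx R]_n) (d : 'I_n -> Cx R) i : P *m adjmx P = 1%:M ->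
  eigenvalue (adjmx P *m rdiag d *m P) (d i).
Proof.
move=> uP; apply/eigenvalueP; exists (row i P).
  rewrite -row_mul !mulmxA uP mul1mx; apply/rowP => j; rewrite mxE rdiag_mul; by rewrite !mxE.
apply/eqP => r0; have : row i (P *m adjmx P) = 0 by rewrite row_mul r0 mul0mx.
rewrite uP => /(congr1 (fun r : 'rV[Cx R]_n => r ord0 i)); rewrite !mxE eqxx => /eqP.
by rewrite oner_eq0.
Qed.

(** Positivity is tested on the adjoint of row i of P, where the quadratic form equals [lam i]. *)
Lemma psd_spectral n (P : 'M[Cx R]_n) (lam : 'I_n -> R) i : P *m adjmx P = 1%:M ->
  psd_mx (adjmx P *m rdiag (fun i => rC (lam i)) *m P) -> 0 <= lam i.
Proof.
move=> uP /(_ (adjmx (row i P))); rewrite adjmxK !mulmxA -row_mul uP.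
have -> : row i 1%:M *m rdiag (fun i => rC (lam i)) *m P *m adjmx (row i P) =
   row i (rdiag (fun i => rC (lam i)) *m P) *m adjmx (row i P).
  by rewrite -!row_mul mul1mx.
rewrite mxE.
have -> : \sum_j row i (rdiag (fun i => rC (lam i)) *m P) ord0 j * adjmx (row i P) j ord0 =
   rC (lam i) * (P *m adjmx P) i i.
  by rewrite [(P *m _) i i]mxE mulr_sumr; apply: eq_bigr => j _; rewrite mxE rdiag_mul !mxE mulrA.
by rewrite uP mxE eqxx mulr1 -[0]/(rC 0) ler_rC.
Qed.

Definition top_eigenvalue n (L : 'M[Cx R]_n) (al : R) :=
  eigenvalue L (rC al) /\ forall lam : Cx R, eigenvalue L lam -> lam <= rC al.

(** A Weyl inequality, used for the continuity of the largest eigenvalue. The Rayleigh quotient of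
    L' at an eigenvector u of L for [al] differs from [al] by at most [mxl1 (L - L')], and
    diagonalizing L' shows that it is at most [al']. *)
Lemma top_eigenvalue_le n (L L' : 'M[Cx R]_n) (al al' : R) :
  hermitian_mx L' -> top_eigenvalue L al -> top_eigenvalue L' al' ->
  al <= al' + mxl1 (L - L').
Proof.
move=> hL' [/eigenvalueP[u uL u0] _] [_ max'].
have [P [lam [uP uP' LE]]] := spectral_decomposition hL'.
have lamle i : lam i <= al'.
  by rewrite -ler_rC; apply: max'; rewrite LE; exact: eigenvalue_spectral.
pose w := u *m adjmx P.
have fw : frob w = frob u by apply: frob_mulr; rewrite adjmxK.
have f0 : 0 < frob u.
  rewrite lt_def frob_ge0 andbT; apply/eqP => f0; move/eqP: u0; apply.
  apply/rowP => i; rewrite mxE; apply/eqP; rewrite -cnorm_eq0 -sqrf_eq0 eq_le sqr_ge0 andbT -f0.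
  exact: le_frob.
have e1 : (u *m L' *m adjmx u) ord0 ord0 = rC (\sum_i lam i * cnorm (w ord0 i) ^+ 2).
  have -> : u *m L' *m adjmx u = w *m rdiag (fun i => rC (lam i)) *m adjmx w.
    by rewrite LE /w adjmxM adjmxK !mulmxA.
  rewrite mxE rmorph_sum /=; apply: eq_bigr => i _.
  rewrite /rdiag mul_mx_diag !mxE -[conjc _]/(cconj _) rmorphM /= -mulJ; ring.
have e2 : (u *m L' *m adjmx u) ord0 ord0 = rC (al * frob u) - (u *m (L - L') *m adjmx u) ord0 ord0.
  have -> : u *m L' *m adjmx u = u *m L *m adjmx u - u *m (L - L') *m adjmx u.
    by rewrite -mulmxBl -mulmxBr opprB addrC subrK.
  rewrite uL -scalemxAl mxE [in LHS]mxE rmorphM /= frob_tr /mxtrace big_ord1; congr (_ * _ + _).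
  by rewrite mxE.
have b1 : Cre ((u *m (L - L') *m adjmx u) ord0 ord0) <= mxl1 (L - L') * frob u.
  apply: le_trans (ler_norm _) _; apply: le_trans (le_Re _) _.
  rewrite -mulmxA mxE; apply: le_trans (cnorm_sum _ _ _) _.
  rewrite /mxl1 mulr_suml; apply: ler_sum => i _.
  rewrite cnormM mxE.
  apply: (@le_trans _ _ (cnorm (u ord0 i) * \sum_j cnorm ((L - L') i j) * cnorm (u ord0 j))).
    rewrite ler_wpM2l ?cnorm_ge0//; apply: le_trans (cnorm_sum _ _ _) _.
    by apply: ler_sum => j _; rewrite cnormM [adjmx u j _]mxE -[conjc _]/(cconj _) cnormJ.
  rewrite mulr_sumr mulr_suml; apply: ler_sum => j _.
  rewrite mulrCA ler_wpM2l ?cnorm_ge0//.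
  have := le_frob u ord0 i; have := le_frob u ord0 j.
  have := sqr_ge0 (cnorm (u ord0 i) - cnorm (u ord0 j)); rewrite !expr2; nra.
have b2 : \sum_i lam i * cnorm (w ord0 i) ^+ 2 <= al' * frob u.
  rewrite -fw /frob big_ord1 mulr_sumr; apply: ler_sum => i _.
  by rewrite ler_wpM2r ?sqr_ge0.
have e3 := congr1 (@Cre R) (etrans (esym e1) e2).
rewrite Re_rC ReD ReN Re_rC in e3.
rewrite -(ler_pM2r f0); lra.
Qed.

End Adjoint.

(** * Trotter products as exponential sums *)

Section ExponentialSums.
Variables (R : realType) (N : nat).
Implicit Types (f g : Cx R -> 'M[Cx R]_N) (X Y : R).

(** An inductive predicate on functions of z, so that an identity linear in f reduces by induction
    to a single exponential. *)
Inductive expsum X : (Cx R -> 'M[Cx R]_N) -> Prop :=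
| expsum0 : expsum X (fun=> 0)
| expsum_add (x : R) (C : 'M[Cx R]_N) f : 0 <= x <= X -> expsum X f ->
    expsum X (fun z => cexp (- (Ci * z * rC x)) *: C + f z).

Lemma expsum_ext X f g : f =1 g -> expsum X f -> expsum X g.
Proof. by move=> /funext ->. Qed.

Lemma expsum_widen X Y f : X <= Y -> expsum X f -> expsum Y f.
Proof.
move=> XY; elim => [|x C g /andP[x0 xX] _ IH]; first exact: expsum0.
by apply: expsum_add => //; rewrite x0 (le_trans xX).
Qed.

Lemma expsum1 X x (C : 'M[Cx R]_N) : 0 <= x <= X ->
  expsum X (fun z => cexp (- (Ci * z * rC x)) *: C).
Proof.
move=> xX; apply: (@expsum_ext _ (fun z => cexp (- (Ci * z * rC x)) *: C + 0)).
  by move=> z; rewrite addr0.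
by apply: expsum_add => //; exact: expsum0.
Qed.

Lemma expsumD X f g : expsum X f -> expsum X g -> expsum X (fun z => f z + g z).
Proof.
move=> hf hg; elim: hf => [|x C h xX _ IH].
  by apply: expsum_ext hg => z; rewrite add0r.
apply: (@expsum_ext _ (fun z => cexp (- (Ci * z * rC x)) *: C + (h z + g z))).
  by move=> z; rewrite addrA.
exact: expsum_add.
Qed.

Lemma expsum_sum X (I : Type) (r : seq I) (F : I -> Cx R -> 'M[Cx R]_N) :
  (forall i, expsum X (F i)) -> expsum X (fun z => \sum_(i <- r) F i z).
Proof.
move=> h; elim: r => [|i r IH].
  by apply: (@expsum_ext _ (fun=> 0)); [move=> z; rewrite big_nil|exact: expsum0].
apply: (@expsum_ext _ (fun z => F i z + \sum_(i <- r) F i z)).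
  by move=> z; rewrite big_cons.
exact: expsumD.
Qed.

Lemma expsum_mull X f (C : 'M[Cx R]_N) : expsum X f -> expsum X (fun z => C *m f z).
Proof.
elim => [|x D g xX _ IH].
  by apply: (@expsum_ext _ (fun=> 0)); [move=> z; rewrite mulmx0|exact: expsum0].
apply: (@expsum_ext _ (fun z => cexp (- (Ci * z * rC x)) *: (C *m D) + C *m g z)).
  by move=> z; rewrite mulmxDr -scalemxAr.
exact: expsum_add.
Qed.

(** Frequencies add under products, so the bound of a Trotter product is the sum of the bounds of
    its steps. *)
Lemma expsumM X Y f g : 0 <= Y -> expsum X f -> expsum Y g -> expsum (X + Y) (fun z => f z *m g z).
Proof.
move=> Y0 hf hg; elim: hf => [|x C h /andP[x0 xX] _ IH].
  by apply: (@expsum_ext _ (fun=> 0)); [move=> z; rewrite mul0mx|exact: expsum0].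
apply: (@expsum_ext _ (fun z => cexp (- (Ci * z * rC x)) *: C *m g z + h z *m g z)).
  by move=> z; rewrite mulmxDl.
apply: expsumD => //; elim: hg => [|y D k /andP[y0 yY] _ IH2].
  by apply: (@expsum_ext _ (fun=> 0)); [move=> z; rewrite mulmx0|exact: expsum0].
apply: (@expsum_ext _ (fun z => cexp (- (Ci * z * rC (x + y))) *: (C *m D) +
    (cexp (- (Ci * z * rC x)) *: C) *m k z)).
  move=> z; rewrite mulmxDr; congr (_ + _).
  rewrite -scalemxAl -scalemxAr scalerA -cexpD; congr (cexp _ *: _).
  by rewrite rmorphD /=; ring.
by apply: expsum_add => //; rewrite addr_ge0// lerD.
Qed.

(* [1 - i dl H] times the exact propagator of [L] is a first-order approximation of
   [T exp(- i (H + z L))] over a time step [dl] that remains an exponential sum in [z]. *)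
Lemma trotter_step (H L : 'M[Cx R]_N) (al dl : R) :
  hermitian_mx H -> hermitian_mx L -> psd_mx L -> top_eigenvalue L al -> 0 <= dl ->
  exists M : Cx R -> 'M[Cx R]_N, [/\ expsum (dl * al) M,
    forall (x : R) (A : 'M[Cx R]_N),
      frob (M (rC x) *m A) <= (1 + dl ^+ 2 * ((N * N)%:R * mxl1 H ^+ 2)) * frob A &
    forall (z : Cx R) (b : R), mxl1 H <= b -> mxl1 L <= b -> al <= b -> cnorm z <= b -> 0 <= b ->
      dl * b ^+ 2 <= 2^-1 -> dl <= 1 ->
      mxl1 (M z - 1%:M + rC dl *: (Ci *: (H + z *: L))) <=
        dl ^+ 2 * ((N * N)%:R ^+ 2 * (N%:R * 8 * b ^+ 4) * (1 + b) + b ^+ 3)].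
Proof.
move=> hH hL pL [_ maxL] dl0.
have [P [lam [uP uP' LE]]] := spectral_decomposition hL.
have lam0 i : 0 <= lam i by apply: (@psd_spectral R N P lam i uP); rewrite -LE.
have lamle i : lam i <= al.
  by rewrite -ler_rC; apply: maxL; rewrite LE; exact: eigenvalue_spectral.
pose d z i := cexp (- (Ci * z * rC (dl * lam i))).
pose E z := adjmx P *m rdiag (d z) *m P.
exists (fun z => (1%:M - (Ci * rC dl) *: H) *m E z); split.
(* The spectral projections of L carry the frequencies [dl * lam i], which lie in [0, dl al] by
   positivity of L and maximality of al. *)
- apply: expsum_mull; apply: (@expsum_ext _ (fun z => \sum_i d z i *: (adjmx P *m delta_mx i i *m
  P))).
    move=> z; rewrite /E /rdiag; under eq_bigr do rewrite scalemxAl scalemxAr.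
    rewrite -mulmx_suml -mulmx_sumr; congr (_ *m _ *m _).
    apply/matrixP => i j; rewrite summxE mxE (bigD1 i)//= big1 ?addr0.
      by rewrite !mxE eqxx /= mulr_natr eq_sym.
    by move=> k ki; rewrite !mxE eq_sym (negbTE ki) mulr0.
  apply: expsum_sum => i; apply: expsum1; rewrite mulr_ge0//=.
  by rewrite ler_wpM2l.
(* For real z the factor [E] is unitary, so only the Euler factor of H enlarges the norm. *)
- move=> x A; rewrite -mulmxA frob_euler//.
  have -> : frob (E (rC x) *m A) = frob A.
    rewrite /E -!mulmxA frob_mull; last by rewrite adjmxK.
    rewrite frob_diag; last first.
      by move=> i; rewrite cnorm_cexp !ReImE !(mul0r, mulr0, subr0, addr0, oppr0) expR0.
    by rewrite frob_mull.
  have h := frob_mul_le H (E (rC x) *m A).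
  have e : frob (E (rC x) *m A) = frob A.
    rewrite /E -!mulmxA frob_mull; last by rewrite adjmxK.
    rewrite frob_diag; last first.
      by move=> i; rewrite cnorm_cexp !ReImE !(mul0r, mulr0, subr0, addr0, oppr0) expR0.
    by rewrite frob_mull.
  rewrite e in h; rewrite mulrDl mul1r lerD2l -mulrA.
  by apply: ler_wpM2l => //; exact: sqr_ge0.
- move=> z b Hb Lb ab zb b0 dlb dl1.
  have mP : mxl1 P <= (N * N)%:R by exact: unitary_mxl1_le.
  have mP' : mxl1 (adjmx P) <= (N * N)%:R by rewrite mxl1_adjmx.
  (* [w] is the exponent of the i-th eigenvalue and [r] its second-order remainder; the hypothesis
     dl b^2 <= 1/2 brings [w] into the domain of [cexp_sub_le]. *)
  pose w i : Cx R := - (Ci * z * rC (dl * lam i)).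
  pose r i : Cx R := d z i - 1 - w i.
  have wb i : cnorm (w i) <= dl * b ^+ 2.
    rewrite cnormN !cnormM cnormi mul1r cnorm_real ger0_norm ?mulr_ge0//.
    rewrite mulrCA ler_wpM2l// expr2; apply: ler_pM => //; first exact: cnorm_ge0.
    exact: le_trans (lamle i) ab.
  have rb i : cnorm (r i) <= 8 * (dl ^+ 2 * b ^+ 4).
    have h1 : cnorm (w i) <= 2^-1 by apply: le_trans (wb i) dlb.
    apply: le_trans (cexp_sub_le h1) _; rewrite ler_pM2l//.
    have -> : dl ^+ 2 * b ^+ 4 = (dl * b ^+ 2) ^+ 2 by ring.
    by rewrite ler_pXn2r ?nnegrE ?cnorm_ge0// mulr_ge0// sqr_ge0.
  pose Q := adjmx P *m rdiag r *m P.
  have EQ : E z = 1%:M - (Ci * z * rC dl) *: L + Q.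
    have -> : (Ci * z * rC dl) *: L = adjmx P *m rdiag (fun i => Ci * z * rC (dl * lam i)) *m P.
      rewrite LE scalemxAl scalemxAr; congr (_ *m _ *m _); apply/matrixP => i j.
      by rewrite mxE !rdiagE rmorphM /= mulrnAr; congr (_ *+ _); ring.
    have -> : 1%:M = adjmx P *m rdiag (fun=> 1) *m P.
      rewrite (_ : rdiag _ = 1%:M) ?mulmx1//; apply/matrixP => i j; by rewrite rdiagE mxE.
    rewrite /Q /E -mulmxBl -mulmxBr -mulmxDl -mulmxDr; congr (_ *m _ *m _).
    apply/matrixP => i j; rewrite !(mxE, rdiagE) -mulrnBl -mulrnDl; congr (_ *+ _).
    by rewrite /r /w; ring.
  pose q := (N * N)%:R ^+ 2 * (N%:R * 8 * b ^+ 4).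
  have Qb : mxl1 Q <= dl ^+ 2 * q.
    have rbd : mxl1 (rdiag r) <= N%:R * (8 * (dl ^+ 2 * b ^+ 4)).
      rewrite /mxl1; apply: (@le_trans _ _ (\sum_(i < N) 8 * (dl ^+ 2 * b ^+ 4))); last first.
        by rewrite sumr_const card_ord -[leLHS]mulr_natl lexx.
      apply: ler_sum => i _; rewrite (bigD1 i)//= big1 ?addr0; first by rewrite rdiagE eqxx mulr1n.
      by move=> j ji; rewrite rdiagE eq_sym (negbTE ji) mulr0n cnorm0.
    apply: le_trans (mxl1M _ _) _; apply: (@le_trans _ _ ((N * N)%:R * (N%:R * (8 * (dl ^+ 2 * b
      ^+ 4))) * (N * N)%:R)).
      apply: ler_pM; rewrite ?mxl1_ge0//; apply: le_trans (mxl1M _ _) _.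
      by apply: ler_pM; rewrite ?mxl1_ge0.
    by rewrite /q le_eqVlt; apply/orP; left; apply/eqP; ring.
  (* The zeroth and first order terms cancel exactly; the spectral remainder and two cross terms are
     left, all of order dl^2. *)
  have -> : (1%:M - (Ci * rC dl) *: H) *m E z - 1%:M + rC dl *: (Ci *: (H + z *: L)) =
    Q - (Ci * rC dl) *: (H *m Q) - (rC (dl ^+ 2) * z) *: (H *m L).
    rewrite EQ mulmxBl mul1mx -scalemxAl !mulmxDr mulmx1 mulmxN -scalemxAr.
    have -> : rC (dl ^+ 2) * z = - (Ci * rC dl * (Ci * z * rC dl)).
      by rewrite rmorphXn /= -[LHS]opprK -[- (_ * z)]mulN1r -CiCi; ring.
    set HQ := H *m Q; set HL := H *m L.
    by apply/matrixP => i j; rewrite !mxE; ring.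
  have mnHQ : mxl1 (H *m Q) <= b * (dl ^+ 2 * q).
    by apply: le_trans (mxl1M _ _) _; apply: ler_pM; rewrite ?mxl1_ge0.
  have mnHL : mxl1 (H *m L) <= b * b.
    by apply: le_trans (mxl1M _ _) _; apply: ler_pM; rewrite ?mxl1_ge0.
  apply: le_trans (mxl1B _ _) _; apply: le_trans (lerD (mxl1B _ _) (lexx _)) _.
  rewrite !mxl1Z !cnormM cnormi mul1r !cnorm_real (ger0_norm dl0) (ger0_norm (sqr_ge0 dl)).
  have t1 : dl * mxl1 (H *m Q) <= b * (dl ^+ 2 * q).
    by apply: le_trans mnHQ; rewrite ler_piMl// mxl1_ge0.
  have t2 : dl ^+ 2 * cnorm z * mxl1 (H *m L) <= dl ^+ 2 * b * (b * b).
    apply: ler_pM => //; rewrite ?mxl1_ge0//; first by rewrite mulr_ge0 ?cnorm_ge0 ?sqr_ge0.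
    by rewrite ler_wpM2l// sqr_ge0.
  rewrite -/q; apply: (le_trans (lerD (lerD Qb t1) t2)).
  by rewrite le_eqVlt; apply/orP; left; apply/eqP; ring.
Qed.

End ExponentialSums.

Lemma psd_eigenvalue_ge0 (R : realType) N (L : 'M[Cx R]_N) (al : R) :
  psd_mx L -> eigenvalue L (rC al) -> 0 <= al.
Proof.
move=> pL /eigenvalueP[u uL u0]; have := pL (adjmx u); rewrite adjmxK uL.
have f0 : 0 < frob u.
  rewrite lt_def frob_ge0 andbT; apply/eqP => f0; move/eqP: u0; apply.
  apply/rowP => i; rewrite mxE; apply/eqP; rewrite -cnorm_eq0 -sqrf_eq0 eq_le sqr_ge0 andbT -f0.
  exact: le_frob.
have -> : (rC al *: u *m adjmx u) ord0 ord0 = rC (al * frob u).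
  by rewrite -scalemxAl mxE rmorphM /= frob_tr /mxtrace big_ord1.
by rewrite -[0]/(rC 0) ler_rC pmulr_lge0.
Qed.

(** * Convergence of the Trotter products *)

Section Trotter.
Variables (R : realType) (N : nat) (T : R).

Lemma mcont_generator (H L : R -> 'M[Cx R]_N) (z : Cx R) : mcont T H -> mcont T L ->
  mcont T (fun t => Ci *: (H t + z *: L t)).
Proof.
move=> /mcontP cH /mcontP cL; apply/mcontP => t tT e e0.
pose c := cnorm z + 1.
have c0 : 0 < c by have := cnorm_ge0 z; rewrite /c; lra.
have e1 : 0 < e / 2 by rewrite divr_gt0.
have e2 : 0 < e / 2 / c by rewrite divr_gt0.
have [d d0 hd] := cH t tT _ e1; have [d' d0' hd'] := cL t tT _ e2.
exists (Num.min d d'); first by rewrite lt_min d0.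
move=> s sT; rewrite lt_min => /andP[s1 s2].
have -> : Ci *: (H s + z *: L s) - Ci *: (H t + z *: L t) =
   Ci *: ((H s - H t) + z *: (L s - L t)).
  by apply/matrixP => i j; rewrite !mxE; ring.
rewrite mxl1Z cnormi mul1r; apply: le_lt_trans (mxl1D _ _) _; rewrite mxl1Z.
have h1 := hd s sT s1; have := hd' s sT s2; rewrite ltr_pdivlMr// => h2.
have : cnorm z * mxl1 (L s - L t) <= c * mxl1 (L s - L t) by rewrite ler_wpM2r ?mxl1_ge0// /c; lra.
by lra.
Qed.

(** A discrete Gronwall inequality, with 1 + dl k <= exp(dl k) used at each step. *)
Lemma euler_growth (e : nat -> R) (k eta dl : R) : 0 <= dl -> 0 <= k -> 0 <= eta -> e 0%N <= 0 ->
  forall n, (forall j, (j < n)%N -> e j.+1 <= (1 + dl * k) * e j + dl * eta) ->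
  e n <= n%:R * dl * eta * expR (n%:R * dl * k).
Proof.
move=> dl0 k0 eta0 e0; elim=> [|n IH] h; first by rewrite !mul0r.
apply: le_trans (h n (ltnSn _)) _.
have h1 := IH (fun j jn => h j (leq_trans jn (leqnSn _))).
have d1 : 0 <= dl * k by rewrite mulr_ge0.
have x1 : 1 + dl * k <= expR (dl * k) by exact: expR_ge1Dx.
have -> : n.+1%:R * dl * k = dl * k + n%:R * dl * k by rewrite -natr1; ring.
rewrite expRD.
set X := expR (n%:R * dl * k) in h1 *.
have X1 : 1 <= X by rewrite /X -expR0 ler_expR !mulr_ge0.
have Y1 : 1 <= expR (dl * k) by rewrite -expR0 ler_expR.
set Y := expR (dl * k) in x1 Y1 *.
have s1 : (1 + dl * k) * e n <= Y * (n%:R * dl * eta * X).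
  apply: (@le_trans _ _ ((1 + dl * k) * (n%:R * dl * eta * X))).
    by rewrite ler_wpM2l// addr_ge0.
  by rewrite ler_wpM2r// !mulr_ge0// (le_trans ler01).
have s2 : dl * eta <= dl * eta * (Y * X).
  by rewrite ler_peMr ?mulr_ge0// mulr_ege1.
apply: (le_trans (lerD s1 s2)); rewrite -natr1.
by rewrite le_eqVlt; apply/orP; left; apply/eqP; ring.
Qed.

Hypothesis T0 : 0 < T.
Variables (H L : R -> 'M[Cx R]_N) (al : R -> R).
Hypothesis cH : mcont T H.
Hypothesis cL : mcont T L.
Hypothesis hH : forall t, 0 <= t <= T -> hermitian_mx (H t).
Hypothesis hL : forall t, 0 <= t <= T -> hermitian_mx (L t).
Hypothesis pL : forall t, 0 <= t <= T -> psd_mx (L t).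
Hypothesis topL : forall t, 0 <= t <= T -> top_eigenvalue (L t) (al t).

Lemma top_eigenvalue_continuous : cont_on T (@rC R \o al).
Proof.
move=> t tT e e0; have [d d0 hd] := (mcontP T L).1 cL t tT e e0.
exists d => // s sT st; apply: le_lt_trans (hd s sT st).
rewrite /= -rmorphB cnorm_real ler_norml; apply/andP; split.
  have := top_eigenvalue_le (hL sT) (topL tT) (topL sT).
  by rewrite -[L t - L s]opprB mxl1N; lra.
by have := top_eigenvalue_le (hL tT) (topL sT) (topL tT); lra.
Qed.

(* With this choice of [tau] the frequencies of the Trotter product add up to the integral of
  [al]. *)
Lemma trotter_grid (G : R -> R) (n : nat) :
  (forall t, 0 < t < T -> is_derive t 1 G (al t)) -> {within `[0, T], continuous G} ->
  forall j, (j < n.+1)%N -> exists tau : R,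
    T / n.+1%:R * j%:R <= tau <= T / n.+1%:R * j.+1%:R /\
    G (T / n.+1%:R * j.+1%:R) - G (T / n.+1%:R * j%:R) = T / n.+1%:R * al tau.
Proof.
move=> dG cG j jn; have T1 : (0 : R) < T := T0.
set dl := T / n.+1%:R.
have dl0 : 0 < dl by rewrite divr_gt0.
have j0 : 0 <= dl * j%:R by rewrite mulr_ge0// ltW.
have jT : dl * j.+1%:R <= T.
  by rewrite /dl mulrAC ler_pdivrMr// ler_pM2l// ler_nat.
have jj : dl * j%:R < dl * j.+1%:R by rewrite ltr_pM2l// ltr_nat.
have h1 (x : R) : x \in `]dl * j%:R, dl * j.+1%:R[%R -> is_derive x 1 G (al x).
  by rewrite in_itv/= => /andP[a b]; apply: dG; apply/andP; split; lra.
have h2 : {within `[dl * j%:R, dl * j.+1%:R], continuous G}.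
  apply: continuous_subspaceW cG => x; rewrite /= !in_itv/= => /andP[a b].
  by apply/andP; split; lra.
have [tau] := MVT jj h1 h2; rewrite in_itv/= => /andP[a b] e.
exists tau; split; first by rewrite !ltW.
by rewrite e mulrC -natr1; congr (_ * _); ring.
Qed.

(** The coefficients are merely continuous, so the local error is o(t - s), uniformly, instead of
    quadratic. The coefficient is frozen at an arbitrary [tau] of the step because the node produced
    by the mean value theorem is not under control. *)
Lemma euler_local_error (B V : R -> 'M[Cx R]_N) : mcont T B ->
  (forall t, 0 <= t <= T -> mderiv T V t (- (B t *m V t))) ->
  forall e, 0 < e -> exists2 d, 0 < d & forall s t tau, 0 <= s -> s <= tau -> tau <= t -> t <= T ->
    t - s < d -> mxl1 (V t - V s + rC (t - s) *: (B tau *m V s)) <= e * (t - s).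
Proof.
move=> cB dV e e0.
have cV : mcont T V := mderiv_cont dV.
have [Kb Kb0 hKb] := mcont_bounded cB; have [Kv Kv0 hKv] := mcont_bounded cV.
pose N2 : R := (N * N)%:R + 1.
have N20 : 0 < N2 by rewrite /N2 ltr_wpDl.
pose e1 := e / (2 * N2) / (Kb + Kv).
have K0 : 0 < Kb + Kv by rewrite addr_gt0.
have e10 : 0 < e1 by rewrite !divr_gt0// mulr_gt0.
have [d d0 hd] := mcont_unif cB e10; have [d' d0' hd'] := mcont_unif cV e10.
exists (Num.min d d'); first by rewrite lt_min d0.
move=> s t tau s0 st1 st2 tT; rewrite lt_min => /andP[sd sd'].
have st : s <= t by apply: le_trans st2.
pose W x := V x + rC x *: (B tau *m V s).
have dW x : 0 <= x <= T -> mderiv T W x (- (B x *m V x) + B tau *m V s).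
  by move=> xT; apply: mderivD; [exact: dV|exact: mderiv_lin].
have h := @mean_value_cst R T N W _ (e1 * (Kb + Kv)) s t s0 st tT dW.
have -> : V t - V s + rC (t - s) *: (B tau *m V s) = W t - W s.
  by rewrite /W rmorphB /= scalerBl; apply/matrixP => i j; rewrite !mxE; ring.
apply: le_trans (h _) _; last first.
  have -> : e1 * (Kb + Kv) = e / (2 * N2) by rewrite /e1 divfK// gt_eqF.
  have -> : (N * N)%:R * (2 * (e / (2 * N2) * (t - s))) = ((N * N)%:R / N2) * (e * (t - s)).
    by field; rewrite gt_eqF.
  rewrite ler_piMl//; first by rewrite mulr_ge0 ?subr_ge0// ltW.
  by rewrite ler_pdivrMr// mul1r /N2 lerDl.
move=> x /andP[sx xt].
have xT : 0 <= x <= T by rewrite (le_trans s0 sx) (le_trans xt tT).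
have sT : 0 <= s <= T by rewrite s0 (le_trans st tT).
have tauT : 0 <= tau <= T by rewrite (le_trans s0 st1) (le_trans st2 tT).
have -> : - (B x *m V x) + B tau *m V s = (B tau - B x) *m V s - B x *m (V x - V s).
  by rewrite mulmxBl mulmxBr; apply/matrixP => i j; rewrite !mxE; ring.
apply: le_trans (mxl1B _ _) _.
have a1 : mxl1 (B tau - B x) <= e1.
  by apply/ltW/hd => //; rewrite ltr_norml; apply/andP; split; lra.
have a2 : mxl1 (V x - V s) <= e1.
  by apply/ltW/hd' => //; rewrite ltr_norml; apply/andP; split; lra.
have b1 : mxl1 ((B tau - B x) *m V s) <= e1 * Kv.
  by apply: le_trans (mxl1M _ _) _; apply: ler_pM; rewrite ?mxl1_ge0 ?hKv.
have b2 : mxl1 (B x *m (V x - V s)) <= Kb * e1.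
  by apply: le_trans (mxl1M _ _) _; apply: ler_pM; rewrite ?mxl1_ge0 ?hKb.
by lra.
Qed.

(** The uniform bound is claimed for real z only, by near-unitarity; for complex z convergence
    follows from consistency of the step and a Gronwall estimate whose constants depend on z. *)
Theorem trotter_approximation (X : R) :
  (\int[lebesgue_measure]_(t in `[0%R, T]) (al t)%:E <= X%:E)%E ->
  exists U : nat -> Cx R -> 'M[Cx R]_N,
  [/\ forall n, expsum X (U n),
      exists C : R, forall n x i j, cnorm (U n (rC x) i j) <= C &
      forall z i j, clim (fun n => U n z i j) (texp (fun t => Ci *: (H t + z *: L t)) T i j)].
Proof.
move=> intX; have T1 : (0 : R) < T := T0.
have [G [dG [cG iG]]] := primitive_integral T0 top_eigenvalue_continuous.
rewrite iG lee_fin in intX.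
pose dl n : R := T / n.+1%:R.
have dl0 n : 0 < dl n by rewrite divr_gt0.
have dln n : n.+1%:R * dl n = T by rewrite /dl mulrCA divff ?mulr1.
have dlT n j : (j <= n.+1)%N -> dl n * j%:R <= T.
  by move=> jn; rewrite /dl mulrAC ler_pdivrMr// ler_pM2l// ler_nat.
have gridT n j tau : (j < n.+1)%N -> dl n * j%:R <= tau <= dl n * j.+1%:R -> 0 <= tau <= T.
  move=> jn /andP[a b]; have l0 : 0 <= dl n * j%:R by rewrite mulr_ge0// ltW.
  by rewrite (le_trans l0 a) (le_trans b (dlT n _ jn)).
(* The specification of one factor. Its frequency bound is written as an increment of G so that the
   bounds telescope. *)
pose step n j tau (M : Cx R -> 'M[Cx R]_N) := [/\ dl n * j%:R <= tau <= dl n * j.+1%:R,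
    0 <= G (dl n * j.+1%:R) - G (dl n * j%:R),
    expsum (G (dl n * j.+1%:R) - G (dl n * j%:R)) M,
    forall (x : R) (A : 'M[Cx R]_N),
      frob (M (rC x) *m A) <= (1 + dl n ^+ 2 * ((N * N)%:R * mxl1 (H tau) ^+ 2)) * frob A &
    forall (z : Cx R) (b : R), mxl1 (H tau) <= b -> mxl1 (L tau) <= b -> al tau <= b -> cnorm z
      <= b -> 0 <= b ->
      dl n * b ^+ 2 <= 2^-1 -> dl n <= 1 ->
      mxl1 (M z - 1%:M + rC (dl n) *: (Ci *: (H tau + z *: L tau))) <=
        dl n ^+ 2 * ((N * N)%:R ^+ 2 * (N%:R * 8 * b ^+ 4) * (1 + b) + b ^+ 3)].
have ex (k : nat * nat) : exists y : R * (Cx R -> 'M[Cx R]_N), (k.2 < k.1.+1)%N -> step k.1 k.2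
  y.1 y.2.
  case: k => n j /=; have [jn|_] := boolP (j < n.+1)%N; last by exists (0, fun=> 0).
  have [tau [tauj tauG]] := trotter_grid dG cG jn.
  have tauT := gridT n j tau jn tauj.
  have [M [M1 M2 M3]] := trotter_step (hH tauT) (hL tauT) (pL tauT) (topL tauT) (ltW (dl0 n)).
  exists (tau, M) => _; split => //; rewrite -/(dl n) in tauG *; rewrite tauG //.
  rewrite mulr_ge0 ?(ltW (dl0 n))//.
  exact: psd_eigenvalue_ge0 (pL tauT) (topL tauT).1.
have [S hS] := choice ex.
pose M n j := (S (n, j)).2; pose tau n j := (S (n, j)).1.
have {}hS n j (jn : (j < n.+1)%N) : step n j (tau n j) (M n j) := hS (n, j) jn.
pose Up n := fix up j := if j is j'.+1 then (fun z => M n j' z *m up j' z) else (fun=> 1%:M).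
have UpS n j z : Up n j.+1 z = M n j z *m Up n j z by [].
have [Kh Kh0 hKh] := mcont_bounded cH; have [Kl Kl0 hKl] := mcont_bounded cL.
have [Ka Ka0 hKa] := cont_on_bounded top_eigenvalue_continuous.
have tauT n j : (j < n.+1)%N -> 0 <= tau n j <= T.
  by move=> jn; have [t1 _ _ _ _] := hS n j jn; exact: gridT t1.
exists (fun n => Up n n.+1); split.
- move=> n; apply: (expsum_widen intX).
  (* At j = n + 1 the telescoped bound is G T - G 0, the integral of [al], with no discretization
     error. *)
  have H' j : (j <= n.+1)%N -> 0 <= G (dl n * j%:R) - G 0 /\
      expsum (G (dl n * j%:R) - G 0) (Up n j).
    elim: j => [_|j IH jn].
      rewrite mulr0 subrr; split => //.
      apply: (@expsum_ext _ _ _ (fun z => cexp (- (Ci * z * rC 0)) *: 1%:M)).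
        by move=> z; rewrite rmorph0 mulr0 oppr0 cexp0 scale1r.
      by apply: expsum1; rewrite lexx.
    have [g0 eU] := IH (ltnW jn); have [_ g1 eM _ _] := hS n j jn.
    have -> : G (dl n * j.+1%:R) - G 0 = (G (dl n * j.+1%:R) - G (dl n * j%:R)) + (G (dl n *
      j%:R) - G 0) by ring.
    by split; [rewrite addr_ge0|exact: expsumM].
  by have [_] := H' _ (leqnn _); rewrite mulrC dln.
- pose kp := (N * N)%:R * Kh ^+ 2.
  have kp0 : 0 <= kp by rewrite mulr_ge0// sqr_ge0.
  (* The steps multiply [frob] by at most (1 + dl^2 kp)^(n+1) <= exp(T dl kp), and dl <= T. The
     final + 1 turns a bound on the square of an entry into one on the entry. *)
  exists (expR (T * T * kp) * N%:R + 1) => n x i j.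
  have F k : (k <= n.+1)%N -> frob (Up n k (rC x)) <= (1 + dl n ^+ 2 * kp) ^+ k * N%:R.
    elim: k => [_|k IH kn]; first by rewrite expr0 mul1r frob1.
    have [_ _ _ hF _] := hS n k kn.
    rewrite UpS; apply: le_trans (hF _ _) _; rewrite (exprS _ k) -mulrA; apply: ler_pM.
    + by rewrite addr_ge0// mulr_ge0 ?sqr_ge0// mulr_ge0// sqr_ge0.
    + exact: frob_ge0.
    + rewrite lerD2l; apply: ler_wpM2l; first exact: sqr_ge0.
      by apply: ler_wpM2l => //; rewrite ler_pXn2r ?nnegrE ?mxl1_ge0 ?(ltW Kh0)// hKh// tauT.
    + exact: IH (ltnW kn).
  have := F _ (leqnn _); set A := Up _ _ _ => FA.
  have e1 : (1 + dl n ^+ 2 * kp) ^+ n.+1 <= expR (T * T * kp).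
    apply: (@le_trans _ _ (expR (dl n ^+ 2 * kp) ^+ n.+1)).
      by rewrite ler_pXn2r ?nnegrE ?expR_ge0 ?expR_ge1Dx// addr_ge0// mulr_ge0// sqr_ge0.
    rewrite -expRM_natl ler_expR mulrA expr2 mulrA dln; apply: ler_wpM2r => //.
    rewrite ler_pM2l// /dl ler_pdivrMr// ler_peMr ?ler1n ?(ltW T1)//.
  have := le_frob A i j; have := cnorm_ge0 (A i j).
  have : (1 + dl n ^+ 2 * kp) ^+ n.+1 * N%:R <= expR (T * T * kp) * N%:R by rewrite ler_wpM2r.
  set c := cnorm _; rewrite expr2; nra.
move=> z i j.
pose B t := Ci *: (H t + z *: L t).
have cB : mcont T B := mcont_generator z cH cL.
have [V [V0 VT dV]] := texp_exists T0 cB.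
have [Kb Kb0 hKb] := mcont_bounded cB.
have [Kv Kv0 hKv] := mcont_bounded (mderiv_cont dV).
pose b := Kh + Kl + Ka + cnorm z.
have z0 := cnorm_ge0 z.
have [b0 bKh bKl] : [/\ 0 <= b, Kh <= b & Kl <= b] by rewrite /b; split; lra.
have [bKa bz] : Ka <= b /\ cnorm z <= b by rewrite /b; split; lra.
pose k3 := (N * N)%:R ^+ 2 * (N%:R * 8 * b ^+ 4) * (1 + b) + b ^+ 3.
have k30 : 0 <= k3.
  apply: addr_ge0; last exact: exprn_ge0.
  by apply: mulr_ge0; [apply: mulr_ge0; [exact: sqr_ge0|apply: mulr_ge0;
    [exact: mulr_ge0|exact: exprn_ge0]]|lra].
pose k := Kb + k3.
have k0 : 0 <= k by rewrite /k; lra.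
move=> e e0.
(* With this [eta] the Gronwall bound T eta exp(T k) equals e / 2. *)
pose D := T * expR (T * k).
have D0 : 0 < D by rewrite mulr_gt0 ?expR_gt0.
pose eta := e / (2 * D).
have eta0 : 0 < eta by rewrite divr_gt0// mulr_gt0.
have eta2 : 0 < eta / 2 by rewrite divr_gt0.
have [d d0 hd] := euler_local_error cB dV eta2.
(* The threshold on dl: [d] controls the local error, the next two entries secure the hypotheses of
   the consistency estimate, and the last absorbs its contribution dl k3 Kv into eta / 2. *)
pose r := Num.min d (Num.min 1 (Num.min (2^-1 / (b ^+ 2 + 1)) (eta / 2 / (k3 * Kv + 1)))).
have b21 : 0 < b ^+ 2 + 1 by rewrite ltr_wpDl// sqr_ge0.
have kv1 : 0 < k3 * Kv + 1 by rewrite ltr_wpDl// mulr_ge0// ltW.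
have r3 : 0 < 2^-1 / (b ^+ 2 + 1) by apply: divr_gt0 => //; rewrite invr_gt0.
have r4 : 0 < eta / 2 / (k3 * Kv + 1) by apply: divr_gt0.
have r0 : 0 < r by rewrite !lt_min d0 ltr01 r3 r4.
have [n0 hn0] := exists_inv_lt T r0; exists n0 => n /hn0; rewrite -/(dl n).
rewrite !lt_min => /and4P[q1 q2 q3 q4].
rewrite (ltr_pdivlMr _ _ b21) in q3; rewrite (ltr_pdivlMr _ _ kv1) in q4.
have dn := dl0 n.
have c1 : dl n * b ^+ 2 <= 2^-1.
  by apply: ltW; apply: le_lt_trans q3; rewrite ler_pM2l// lerDl.
have c2 : dl n * (k3 * Kv) <= eta / 2.
  by apply: ltW; apply: le_lt_trans q4; rewrite ler_pM2l// lerDl.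
pose er j := mxl1 (Up n j z - V (dl n * j%:R)).
have er0 : er 0%N <= 0 by rewrite /er mulr0 V0 subrr mxl1_0.
have rec l : (l < n.+1)%N -> er l.+1 <= (1 + dl n * k) * er l + dl n * eta.
  move=> ln; have [/andP[t1 t2] _ _ _ hM] := hS n l ln.
  have tT := tauT n l ln; set ta := tau n l in t1 t2 hM tT.
  have lT : 0 <= dl n * l%:R <= T by rewrite mulr_ge0 ?(ltW dn)//= dlT// ltnW.
  have := hM z b; rewrite -/k3 -/(B ta) => {}hM.
  have rho : mxl1 (M n l z - 1%:M + rC (dl n) *: B ta) <= dl n ^+ 2 * k3.
    apply: hM => //; try exact: ltW.
    - exact: le_trans (hKh _ tT) bKh.
    - exact: le_trans (hKl _ tT) bKl.
    - apply: (le_trans (ler_norm _)); apply: le_trans bKa.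
      by have := hKa _ tT; rewrite /= cnorm_real.
  have /andP[l0 _] := lT.
  have loc := hd (dl n * l%:R) (dl n * l.+1%:R) ta l0 t1 t2 (dlT n _ ln).
  have dE : dl n * l.+1%:R - dl n * l%:R = dl n by rewrite -natr1; ring.
  rewrite dE in loc; have {}loc := loc q1.
  rewrite /er UpS; set U := Up n l z; set Vj := V (dl n * l%:R) in loc *.
  set V' := V _ in loc *; set Mj := M n l z in rho *; set Y := rC (dl n) *: B ta in rho *.
  have YV : rC (dl n) *: (B ta *m Vj) = Y *m Vj by rewrite scalemxAl.
  rewrite YV in loc.
  (* The growth factor 1 + dl k is extracted from Mj - 1: bounding Mj itself by [mxl1] would cost a
     factor N at every step. *)
  have -> : Mj *m U - V' = (U - Vj) + (Mj - 1%:M) *m (U - Vj) +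
     ((Mj - 1%:M + Y) *m Vj - (V' - Vj + Y *m Vj)).
    rewrite !(mulmxDl, mulmxDr, mulNmx, mulmxN, mul1mx).
    set a1 := Mj *m U; set a2 := Mj *m Vj; set a3 := Y *m Vj.
    by apply/matrixP => x y; rewrite !mxE; ring.
  have Yb : mxl1 Y <= dl n * Kb.
    by rewrite /Y mxl1Z cnorm_real gtr0_norm// ler_pM2l// hKb.
  have M1 : mxl1 (Mj - 1%:M) <= dl n * k.
    have -> : Mj - 1%:M = (Mj - 1%:M + Y) - Y by rewrite addrK.
    apply: le_trans (mxl1B _ _) _.
    have : dl n ^+ 2 * k3 <= dl n * k3.
      by rewrite expr2 -mulrA ler_piMl// ?mulr_ge0// ltW.
    move=> h3; apply: le_trans (lerD rho Yb) _.
    by rewrite /k (mulrDr _ Kb) addrC lerD2l.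
  have f1 := mxl1M (Mj - 1%:M) (U - Vj).
  have f2 : mxl1 (Mj - 1%:M) * mxl1 (U - Vj) <= dl n * k * mxl1 (U - Vj) by rewrite ler_wpM2r
    ?mxl1_ge0.
  have f3 : mxl1 ((Mj - 1%:M + Y) *m Vj) <= dl n * (eta / 2).
    apply: le_trans (mxl1M _ _) _; apply: (@le_trans _ _ (dl n ^+ 2 * k3 * Kv)).
      by apply: ler_pM; rewrite ?mxl1_ge0 ?hKv.
    have -> : dl n ^+ 2 * k3 * Kv = dl n * (dl n * (k3 * Kv)) by ring.
    by rewrite ler_pM2l.
  apply: le_trans (mxl1D _ _) _; apply: le_trans (lerD (mxl1D _ _) (mxl1B _ _)) _.
  apply: (le_trans (lerD (lerD (lexx _) (le_trans f1 f2)) (lerD f3 loc))).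
  by rewrite (mulrDl 1) mul1r lerD2l (mulrC (eta / 2)) -mulrDr -splitr.
have fin := euler_growth (ltW dn) k0 (ltW eta0) er0 rec.
rewrite dln /er in fin.
have e12 : T * eta * expR (T * k) = e / 2.
  by rewrite /eta /D; field; rewrite !gt_eqF ?expR_gt0.
rewrite mulrC dln VT e12 -/B in fin.
have := le_mxl1 (Up n n.+1 z - texp B T) i j; rewrite !mxE => h.
by apply: (le_lt_trans h); apply: (le_lt_trans fin); rewrite ltr_pdivrMr// mulr_natr mulr2n ltrDl.
Qed.

End Trotter.

(** * The pole expansion *)

(** The Lagrange basis polynomials minus 1 add up to a polynomial of degree below m that vanishes at
    the m distinct nodes. *)
Lemma lagrange_sum1 (F : fieldType) (m : nat) (p : 'I_m -> F) (z : F) :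
  (0 < m)%N -> injective p ->
  \sum_(r < m) \prod_(r' < m | r' != r) ((z - p r') / (p r - p r')) = 1.
Proof.
move=> m0 pI.
pose P : {poly F} := \sum_(r < m) \prod_(r' < m | r' != r) ((p r - p r')^-1 *: ('X - (p r')%:P))
  - 1.
have PE x : P.[x] = \sum_(r < m) \prod_(r' < m | r' != r) ((x - p r') / (p r - p r')) - 1.
  rewrite hornerD hornerN hornerC horner_sum; congr (_ - _); apply: eq_bigr => r _.
  by rewrite horner_prod; apply: eq_bigr => r' _; rewrite hornerZ hornerXsubC mulrC.
suff P0 : P = 0 by apply/eqP; rewrite -subr_eq0 -PE P0 horner0.
apply: (@roots_geq_poly_eq0 _ P (map p (enum 'I_m))).
- apply/allP => _ /mapP[r _ ->]; rewrite /root PE (bigD1 r)//=.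
  have e1 : \prod_(r' < m | r' != r) ((p r - p r') / (p r - p r')) = 1.
    by apply: big1 => s sr; rewrite divff// subr_eq0 (inj_eq pI) eq_sym.
  rewrite e1 big1 ?addr0 ?subrr// => s sr.
  by rewrite (bigD1 r) 1?eq_sym//= subrr !mul0r.
- by rewrite map_inj_uniq ?enum_uniq.
- rewrite size_map size_enum_ord; apply: leq_trans (size_polyD _ _) _.
  rewrite geq_max size_polyN size_poly1 m0 andbT.
  apply: leq_trans (size_sum _ _ _) _; apply/bigmax_leqP => r _.
  apply: leq_trans (size_prod_leq _ _) _.
  have : (\sum_(r' < m | r' != r) size ((p r - p r')^-1 *: ('X - (p r')%:P)) <= \sum_(r' < m | r'
    != r) 2)%N.
    by apply: leq_sum => r' _; apply: leq_trans (size_scale_leq _ _) _; rewrite size_XsubC.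
  rewrite sum_nat_const; have -> : #|(fun r' : 'I_m => r' != r)| = m.-1.
    by rewrite -[in RHS](card_ord m) -(cardC1 r); apply: eq_card => x; rewrite !inE.
  by move=> h; rewrite leq_subLR -[X in (_ <= _ + X)%N](prednK m0) addnS ltnS addnn -muln2.
Qed.

(** Multiply the product by the Lagrange sum at z, which is 1; the factors z - p r' cancel term by
    term. *)
Lemma partial_fractions (F : fieldType) (m : nat) (p : 'I_m -> F) (u z : F) :
  (0 < m)%N -> injective p -> (forall r, z != p r) ->
  \prod_(r < m) ((u - p r) / (z - p r)) =
  \sum_(r < m) (u - p r) / (z - p r) * \prod_(r' < m | r' != r) ((u - p r') / (p r - p r')).
Proof.
move=> m0 pI zp; transitivity (\prod_(r < m) ((u - p r) / (z - p r)) *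
    \sum_(r < m) \prod_(r' < m | r' != r) ((z - p r') / (p r - p r'))).
  by rewrite lagrange_sum1// mulr1.
rewrite mulr_sumr; apply: eq_bigr => r _.
rewrite (bigD1 r)//= -[LHS]mulrA; congr (_ * _).
transitivity (\prod_(s < m | s != r) ((u - p s) / (z - p s) * ((z - p s) / (p r - p s)))).
  by rewrite [RHS]big_split.
apply: eq_bigr => s sr.
have zs : z - p s != 0 by rewrite subr_eq0.
have rs : p r - p s != 0 by rewrite subr_eq0 (inj_eq pI) eq_sym.
by field; rewrite zs rs.
Qed.

(** * The kernel and the identity for exponential sums *)

Section PoleExpansion.
Variable R : realType.

(** The modulus forces Im W = 0, and [cexp_im_neq1] excludes a nonzero fractional part. This turns
    the lattice condition on the p_r into nonvanishing denominators. *)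
Lemma cexp_eq1 (W : Cx R) : cexp (- (rC (2 * pi) * Ci * W)) = 1 -> exists k : int, W = rC k%:~R.
Proof.
move=> h; have pi0 := @pi_gt0 R.
have /(congr1 (@cnorm R)) := h; rewrite cnorm_cexp cnorm1 => e1.
have im0 : Cim W = 0.
  have : Cre (- (rC (2 * pi) * Ci * W)) = 0.
    by apply: (@expR_inj R); rewrite e1 expR0.
  rewrite !ReImE !(mulr0, mul0r, subr0, mulr1, addr0, add0r, sub0r, opprK) => /eqP.
  by rewrite mulf_eq0 gt_eqF ?mulr_gt0//= => /eqP.
exists (Num.floor (Cre W)); set k := Num.floor _.
have WE : W = rC (Cre W) by apply: ReIm_eq.
pose f := Cre W - k%:~R.
have /andP[f0 f1] : 0 <= f < 1.
  rewrite /f subr_ge0 ltrBlDr addrC.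
  by have /andP[a b] := floor_itv (Cre W); rewrite a /= -[1](mulr1z) -intrD addrC -/k addrC b.
have [fz|fz] := eqVneq f 0.
  by rewrite WE; congr rC; apply/eqP; rewrite -subr_eq0 -/f fz.
have : cexp (rC (2 * pi * f) * Ci : Cx R) != 1.
  have fp : 0 < f by rewrite lt_def fz.
  by apply: cexp_im_neq1; rewrite !mulr_gt0//= gtr_pMr// mulr_gt0.
have -> : cexp (rC (2 * pi * f) * Ci) = (cexp (- (rC (2 * pi) * Ci * W)))^-1.
  rewrite -cexpN opprK.
  have -> : rC (2 * pi) * Ci * W = rC (2 * pi * f) * Ci + rC (2 * pi * k%:~R) * Ci.
    rewrite [in LHS]WE -mulrDl -rmorphD /= -mulrDr /f subrK (rmorphM (@rC R) (2 * pi)) /=; ring.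
  by rewrite cexpD cexp_2piiz mulr1.
by rewrite h invr1 eqxx.
Qed.

Lemma inverse_diff_bound (W U : Cx R) : exists C : R, exists K0 : R, [/\ 0 <= C, 0 <= K0 &
  forall x : R, K0 <= `|x| -> 0 < `|x| -> cnorm ((rC x - W)^-1 - (rC x - U)^-1) <= C / x ^+ 2].
Proof.
exists (4 * cnorm (W - U)), (2 * (cnorm W + cnorm U)).
split; [by rewrite mulr_ge0 ?cnorm_ge0|by rewrite mulr_ge0 ?addr_ge0 ?cnorm_ge0|].
move=> x xK x0.
have lb (V : Cx R) : 2 * cnorm V <= `|x| -> `|x| / 2 <= cnorm (rC x - V).
  by move=> h; apply: le_trans (ler_cnormB _ _); rewrite cnorm_real; lra.
have hW := lb W; have hU := lb U.
have cW := cnorm_ge0 W; have cU := cnorm_ge0 U.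
have {}hW : `|x| / 2 <= cnorm (rC x - W) by apply: hW; lra.
have {}hU : `|x| / 2 <= cnorm (rC x - U) by apply: hU; lra.
have x2 : 0 < `|x| / 2 by rewrite divr_gt0.
have W0 : 0 < cnorm (rC x - W) by apply: lt_le_trans hW.
have U0 : 0 < cnorm (rC x - U) by apply: lt_le_trans hU.
have -> : (rC x - W)^-1 - (rC x - U)^-1 = (W - U) * ((rC x - W)^-1 * (rC x - U)^-1).
  by field; rewrite -!cnorm_gt0 W0 U0.
rewrite cnormM (cnormM _^-1) !cnormV -invfM.
rewrite -(real_normK (num_real x)).
have -> : 4 * cnorm (W - U) / `|x| ^+ 2 = cnorm (W - U) * (`|x| / 2 * (`|x| / 2))^-1.
  by field; rewrite gt_eqF.
apply: ler_wpM2l; first exact: cnorm_ge0.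
rewrite lef_pV2 ?posrE ?mulr_gt0//; apply: ler_pM => //; exact: ltW.
Qed.

Variables (a : R) (m : nat) (p : 'I_m -> Cx R).
Hypothesis a0 : 0 < a.
Hypothesis m0 : (0 < m)%N.
Hypothesis pI : injective p.
Hypothesis pZ : forall r (k : int), p r != k%:~R / rC a.

Let aC0 : rC a != 0. Proof. by rewrite -cnorm_eq0 cnorm_real normr_eq0 gt_eqF. Qed.
Let tp0 : (0 : R) < 2 * pi. Proof. by rewrite mulr_gt0// pi_gt0. Qed.
Let tpC : rC (2 * pi : R) != 0.
Proof. by rewrite -cnorm_eq0 cnorm_real normr_eq0 gt_eqF//; exact: tp0. Qed.
Let Ci0 : Ci != 0 :> Cx R. Proof. by rewrite -cnorm_eq0 cnormi oner_eq0. Qed.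

(** The value of exp(- 2 pi i a z) - 1 at z = - i. *)
Definition pole_const : Cx R := rC (expR (- (2 * pi * a))) - 1.

Definition pole_kernel (z : Cx R) : Cx R :=
  pole_const / (rC (2 * pi) * Ci * (z + Ci) * \prod_(r < m) ((z - p r) / (- Ci - p r))).

(** The value at - i of the Lagrange basis polynomial of node p r; up to sign and a common constant,
    the residue of the kernel at p r. *)
Definition lagrange_weight r : Cx R := (\prod_(r' < m | r' != r) ((p r - p r') / (- Ci - p r')))^-1.

Definition pole_coef r : Cx R :=
  pole_const / ((cexp (- rC (2 * pi) * Ci * p r * rC a) - 1)
           * \prod_(r' < m | r' != r) ((p r - p r') / (- Ci - p r'))).

Lemma lagrange_weightE r : lagrange_weight r = \prod_(r' < m | r' != r) ((- Ci - p r') / (p r - p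
  r')).
Proof. by rewrite /lagrange_weight -prodfV; apply: eq_bigr => s _; rewrite invf_div. Qed.

Lemma sum_lagrange_weight : \sum_r lagrange_weight r = 1.
Proof. by under eq_bigr do rewrite lagrange_weightE; exact: lagrange_sum1. Qed.

(* The residues of the kernel at [- i] and at the [p r] add up to zero, so that only differences of
   two simple poles occur. *)
Lemma pole_kernelE (x : R) : (forall r, rC x / rC a != p r) ->
  pole_kernel (rC x / rC a) = \sum_r (- (rC a * pole_const * lagrange_weight r) / (rC (2 * pi) *
    Ci)) *
     ((rC x - rC a * p r)^-1 - (rC x - rC a * - Ci)^-1).
Proof.
move=> xp; set z := rC x / rC a.
have zi : z + Ci != 0.
  apply/eqP => /(congr1 (@Cim R)); rewrite /z -fmorph_div !ReImE add0r => /eqP.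
  by rewrite oner_eq0.
have zp r : z - p r != 0 by rewrite subr_eq0.
rewrite /pole_kernel invfM -prodfV.
under eq_bigr do rewrite invf_div.
rewrite partial_fractions// mulr_sumr mulr_sumr; apply: eq_bigr => r _.
rewrite -lagrange_weightE.
have -> : rC x - rC a * p r = rC a * (z - p r) by rewrite /z mulrBr mulrCA divff// mulr1.
have -> : rC x - rC a * - Ci = rC a * (z + Ci) by rewrite /z mulrN opprK mulrDr mulrCA divff//
  mulr1.
move: (rC (2 * pi)) tpC => t t0.
by field; rewrite aC0 zi zp t0 Ci0.
Qed.

(** The decay is that of the differences in [pole_kernelE]. One bound in k + 1 serves the paired
    indices k and - (k + 1), and the factor 4 pays for replacing k by k + 1. *)
Lemma pole_kernel_bound : exists C : R, exists K0 : nat, [/\ 0 <= C, (0 < K0)%N &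
  forall k : nat, (K0 <= k)%N -> cnorm (pole_kernel (rC k%:R / rC a)) <= C / k.+1%:R ^+ 2 /\
    cnorm (pole_kernel (rC (- k.+1%:R) / rC a)) <= C / k.+1%:R ^+ 2].
Proof.
have H r : exists CK : R * R, [/\ 0 <= CK.1, 0 <= CK.2 &
    forall x : R, CK.2 <= `|x| -> 0 < `|x| ->
      cnorm ((rC x - rC a * p r)^-1 - (rC x - rC a * - Ci)^-1) <= CK.1 / x ^+ 2].
  by have [C [K0 h]] := inverse_diff_bound (rC a * p r) (rC a * - Ci); exists (C, K0).
have [S hS] := choice H.
pose g r := cnorm (- (rC a * pole_const * lagrange_weight r) / (rC (2 * pi) * Ci)).
pose C := \sum_r g r * (S r).1.
have C0 : 0 <= C by apply: sumr_ge0 => r _; rewrite mulr_ge0 ?cnorm_ge0//; have [] := hS r.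
have [K1 hK1] := exists_nat_gt (\sum_r (S r).2).
have key (x : R) : K1%:R <= `|x| -> 0 < `|x| -> (forall r, rC x / rC a != p r) ->
    cnorm (pole_kernel (rC x / rC a)) <= C / x ^+ 2.
  move=> xK x0 xp; rewrite pole_kernelE//; apply: le_trans (cnorm_sum _ _ _) _.
  rewrite /C mulr_suml; apply: ler_sum => r _; rewrite (cnormM (_ / _)) -/(g r) -mulrA.
  apply: ler_wpM2l; first exact: cnorm_ge0.
  have [_ _ h] := hS r; apply: h => //; apply: (le_trans _ xK); apply: (le_trans _ (ltW hK1)).
  rewrite (bigD1 r)//= lerDl; apply: sumr_ge0 => s _; by have [] := hS s.
have natp (k : nat) r : rC k%:R / rC a != p r.
  by have := pZ r k; rewrite eq_sym rmorph_nat.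
have negp (k : nat) r : rC (- k.+1%:R) / rC a != p r.
  by have := pZ r (Negz k); rewrite eq_sym NegzE mulrNz rmorphN /= rmorph_nat.
exists (4 * C), K1.+1; split=> //; first by rewrite mulr_ge0.
move=> k Kk; have kK : K1%:R <= k%:R :> R by rewrite ler_nat ltnW.
have k0 : 0 < k%:R :> R by rewrite ltr0n (leq_trans _ Kk).
have k1 : 1 <= k%:R :> R by rewrite ler1n -(ltr0n R).
have kS : k.+1%:R = k%:R + 1 :> R by rewrite natr1.
have k12 : k.+1%:R / 2 <= k%:R :> R by rewrite kS; lra.
have S0 : 0 < k.+1%:R :> R by rewrite ltr0Sn.
split.
  apply: le_trans (key _ _ _ _) _; rewrite ?normr_nat//.
  have -> : 4 * C / k.+1%:R ^+ 2 = C * ((k.+1%:R / 2) ^+ 2)^-1 by field; rewrite gt_eqF.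
  apply: ler_wpM2l => //; rewrite lef_pV2 ?posrE ?exprn_gt0 ?divr_gt0//.
  by rewrite ler_pXn2r ?nnegrE ?divr_ge0 ?ler0n.
apply: le_trans (key _ _ _ _) _; rewrite ?normrN ?normr_nat//.
  by rewrite kS; lra.
rewrite sqrrN ler_wpM2r ?invr_ge0 ?sqr_ge0//; lra.
Qed.

Let e_ (x : R) (z : Cx R) : Cx R := cexp (- (Ci * z * rC x)).

(** A combination over r of [fourier_two_poles] at y = x / a, with poles W = a p_r and U = - i a; x
    <= 2 pi a is exactly y <= 2 pi. *)
Lemma scalar_identity (x : R) : 0 <= x <= 2 * pi * a ->
  clim (fun K => \sum_(k < K) (pole_kernel (rC k%:R / rC a) * e_ x (rC k%:R / rC a) +
      pole_kernel (rC (- k.+1%:R) / rC a) * e_ x (rC (- k.+1%:R) / rC a)))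
    (rC a * (e_ x (- Ci) - \sum_r pole_coef r * e_ x (p r))).
Proof.
move=> /andP[x0 xa].
have y01 : 0 <= x / a <= 2 * pi by rewrite divr_ge0 ?(ltW a0)//= ler_pdivrMr.
(* Thus the denominator attached to U is [pole_const] itself and cancels the one in the
   coefficients. *)
have cE : cexp (- (rC (2 * pi) * Ci * (rC a * - Ci))) = pole_const + 1.
  rewrite /pole_const subrK -cexp_real; congr cexp.
  rewrite !rmorphN !rmorphM /= !mulrN opprK.
  have -> : rC 2 * rC pi * Ci * (rC a * Ci) = (Ci * Ci) * (rC 2 * rC pi * rC a) by ring.
  by rewrite CiCi mulN1r.
have c0 : pole_const != 0.
  rewrite /pole_const subr_eq0; apply/eqP => /(congr1 (@Cre R)); rewrite Re_rC Re1 => h.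
  have : - (2 * pi * a) = 0 :> R by apply: (@expR_inj R); rewrite h expR0.
  by move/eqP; rewrite oppr_eq0 gt_eqF// mulr_gt0.
have U1 : cexp (- (rC (2 * pi) * Ci * (rC a * - Ci))) != 1.
  by rewrite cE -subr_eq0 addrK.
have W1 r : cexp (- (rC (2 * pi) * Ci * (rC a * p r))) != 1.
  apply/eqP => /cexp_eq1[k hk]; have /eqP := pZ r k; apply.
  by rewrite rmorph_int in hk; rewrite -hk mulrC mulKf.
have lim r := fourier_two_poles y01 (W1 r) U1.
have natp (k : nat) r : rC k%:R / rC a != p r.
  by have := pZ r k; rewrite eq_sym rmorph_nat.
have negp (k : nat) r : rC (- k.+1%:R) / rC a != p r.
  by have := pZ r (Negz k); rewrite eq_sym NegzE mulrNz rmorphN /= rmorph_nat.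
have ey (y : R) : cexp (- (Ci * rC y * rC (x / a))) = e_ x (rC y / rC a).
  by rewrite /e_ fmorph_div /=; congr cexp; ring.
have tE (y : R) : (forall r, rC y / rC a != p r) ->
   pole_kernel (rC y / rC a) * e_ x (rC y / rC a) = \sum_r (- (rC a * pole_const *
     lagrange_weight r)) *
     (cexp (- (Ci * rC y * rC (x / a))) / (rC (2 * pi) * Ci) *
       ((rC y - rC a * p r)^-1 - (rC y - rC a * - Ci)^-1)).
  by move=> yp; rewrite pole_kernelE// ey mulr_suml; apply: eq_bigr => r _; ring.
set F := fun K => _.
have -> : F = (fun K => \sum_r (- (rC a * pole_const * lagrange_weight r)) * \sum_(k < K)
     (cexp (- (Ci * rC k%:R * rC (x / a))) / (rC (2 * pi) * Ci) *
       ((rC k%:R - rC a * p r)^-1 - (rC k%:R - rC a * - Ci)^-1) +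
      cexp (- (Ci * rC (- k.+1%:R) * rC (x / a))) / (rC (2 * pi) * Ci) *
       ((rC (- k.+1%:R) - rC a * p r)^-1 - (rC (- k.+1%:R) - rC a * - Ci)^-1))).
  apply/funext => K; rewrite /F.
  under [RHS]eq_bigr do rewrite mulr_sumr.
  rewrite exchange_big /=; apply: eq_bigr => k _.
  rewrite (tE _ (natp k)) (tE _ (negp k)) -big_split /=.
  by apply: eq_bigr => r _; rewrite -mulrDr.
have -> : rC a * (e_ x (- Ci) - \sum_r pole_coef r * e_ x (p r)) =
   \sum_r (- (rC a * pole_const * lagrange_weight r)) *
     (cexp (- (Ci * (rC a * p r) * rC (x / a))) / (cexp (- (rC (2 * pi) * Ci * (rC a * p r))) - 1)
     - cexp (- (Ci * (rC a * - Ci) * rC (x / a))) / (cexp (- (rC (2 * pi) * Ci * (rC a * - Ci)))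
       - 1)).
  have eA z : cexp (- (Ci * (rC a * z) * rC (x / a))) = e_ x z.
    by rewrite /e_ fmorph_div /=; congr cexp; field.
  (* The weights add up to 1, so the value at - i can be distributed over r. *)
  transitivity (rC a * ((\sum_r lagrange_weight r) * e_ x (- Ci) - \sum_r pole_coef r * e_ x (p
    r))).
    by rewrite sum_lagrange_weight mul1r.
  rewrite cE addrK eA mulrBr mulr_suml mulr_sumr mulr_sumr.
  rewrite -sumrB; apply: eq_bigr => r _; rewrite eA /pole_coef.
  have -> : - rC (2 * pi) * Ci * p r * rC a = - (rC (2 * pi) * Ci * (rC a * p r)) by ring.
  set E := cexp _ - 1.
  rewrite invfM -/(lagrange_weight r).
  set iE := E^-1; by field.
apply: clim_sum => r _; apply: climM; first exact: clim_cst.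
exact: lim.
Qed.

Lemma expsum_identity (N : nat) (f : Cx R -> 'M[Cx R]_N) i j : expsum (2 * pi * a) f ->
  clim (fun K => \sum_(k < K) (pole_kernel (rC k%:R / rC a) * f (rC k%:R / rC a) i j +
      pole_kernel (rC (- k.+1%:R) / rC a) * f (rC (- k.+1%:R) / rC a) i j))
    (rC a * (f (- Ci) i j - \sum_r pole_coef r * f (p r) i j)).
Proof.
elim => [|x C g xX _ IH].
  have -> : rC a * ((0 : 'M[Cx R]_N) i j - \sum_r pole_coef r * (0 : 'M[Cx R]_N) i j) = 0.
    by rewrite mxE sub0r big1 ?oppr0 ?mulr0// => r _; rewrite mulr0.
  rewrite (_ : (fun K => _) = (fun=> 0)); first exact: clim_cst.
  by apply/funext => K; rewrite big1// => k _; rewrite mxE !mulr0 addr0.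
have h := climD (climM (scalar_identity xX) (clim_cst (C i j))) IH.
move: h; set F := (fun n => _); set l := _ + _ => h.
have -> : rC a * ((cexp (- (Ci * - Ci * rC x)) *: C + g (- Ci)) i j -
   \sum_r pole_coef r * (cexp (- (Ci * p r * rC x)) *: C + g (p r)) i j) = l.
  rewrite /l !mxE -/(e_ x (- Ci)).
  under eq_bigr do rewrite !mxE -/(e_ x (p _)) mulrDr mulrA.
  rewrite big_split /= -mulr_suml; ring.
rewrite (_ : (fun K => _) = F)//; apply/funext => K.
rewrite /F mulr_suml -big_split /=; apply: eq_bigr => k _.
by rewrite !mxE -/(e_ x (rC k%:R / rC a)) -/(e_ x (rC (- k.+1%:R) / rC a)); ring.
Qed.

(** [zseries_to] asks the nonnegative and the negative indices to converge separately, while the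
    Fourier argument only treats paired terms. *)
Lemma inv_sqr_summable (d : nat -> Cx R) (C : R) (K : nat) : 0 <= C -> (0 < K)%N ->
  (forall k, (K <= k)%N -> cnorm (d k) <= C / k.+1%:R ^+ 2) ->
  exists l, clim (fun n => \sum_(k < n) d k) l.
Proof.
move=> C0 K0 h.
apply: (@series_domination _ d (fun k => cnorm (d k)) (\sum_(0 <= k < K) cnorm (d k) + C)) => // n.
rewrite -(big_mkord xpredT (fun k => cnorm (d k))).
have S0 u v : 0 <= \sum_(u <= k < v) cnorm (d k) by apply: sumr_ge0 => *; exact: cnorm_ge0.
have [nK|Kn] := leqP n K.
  rewrite [X in _ <= X + _](@big_cat_nat _ _ _ n)//= -addrA lerDl addr_ge0//.
rewrite (@big_cat_nat _ _ _ K) ?(ltnW Kn)//= lerD2l.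
apply: (@le_trans _ _ (\sum_(K <= k < n) C * (k.+1%:R ^+ 2)^-1)).
  by rewrite big_nat [leRHS]big_nat; apply: ler_sum => k /andP[Kk _]; exact: h.
rewrite -mulr_sumr ler_piMr//; apply: le_trans (sum_inv_sqr_le R K0 (ltnW Kn)) _.
rewrite lerBlDr; apply: (@le_trans _ _ 1); last by rewrite lerDl invr_ge0.
by rewrite invf_le1 ?ler1n ?ltr0n.
Qed.

Variables (N : nat) (U : nat -> Cx R -> 'M[Cx R]_N) (V : Cx R -> 'M[Cx R]_N).
Hypothesis expU : forall n, expsum (2 * pi * a) (U n).
Hypothesis bndU : exists C : R, forall n x i j, cnorm (U n (rC x) i j) <= C.
Hypothesis limU : forall z i j, clim (fun n => U n z i j) (V z i j).

(** The identity holds for every [U n] by [expsum_identity]; the uniform bound on the real axis and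
    the kernel decay give the tail needed to let n tend to infinity. *)
Theorem limit_identity i j : exists s1 s2 : Cx R,
  [/\ clim (fun n => \sum_(k < n) pole_kernel (rC k%:R / rC a) * V (rC k%:R / rC a) i j) s1,
      clim (fun n => \sum_(k < n) pole_kernel (rC (- k.+1%:R) / rC a) * V (rC (- k.+1%:R) / rC a)
        i j) s2 &
      s1 + s2 = rC a * (V (- Ci) i j - \sum_r pole_coef r * V (p r) i j)].
Proof.
have [B hB] := bndU.
have B0 : 0 <= B by apply: le_trans (cnorm_ge0 _) (hB 0%N 0 i j).
have zE (x : R) : rC x / rC a = rC (x / a) by rewrite fmorph_div.
(* The points x / a are real, so the uniform bound on [U] passes to its limit there. *)
have hV x : cnorm (V (rC x / rC a) i j) <= B.
  have := @clim_le _ (fun n => U n (rC x / rC a) i j) (V (rC x / rC a) i j) 0 B 0%N.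
  by rewrite subr0; apply => // n _; rewrite subr0 zE.
have [C [K0 [C0 K00 hC]]] := pole_kernel_bound.
have bd (W : Cx R -> 'M[Cx R]_N) k : (forall x, cnorm (W (rC x / rC a) i j) <= B) -> (K0 <= k)%N ->
   cnorm (pole_kernel (rC k%:R / rC a) * W (rC k%:R / rC a) i j) <= (C * B) / k.+1%:R ^+ 2 /\
   cnorm (pole_kernel (rC (- k.+1%:R) / rC a) * W (rC (- k.+1%:R) / rC a) i j) <= (C * B) /
     k.+1%:R ^+ 2.
  move=> hW Kk; have [h1 h2] := hC k Kk; rewrite (mulrAC C).
  by split; rewrite (cnormM (pole_kernel _)); apply: ler_pM; rewrite ?cnorm_ge0.
have CB0 : 0 <= C * B by rewrite mulr_ge0.
have [s1 hs1] := inv_sqr_summable CB0 K00 (fun k Kk => (bd V k hV Kk).1).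
have [s2 hs2] := inv_sqr_summable CB0 K00 (fun k Kk => (bd V k hV Kk).2).
exists s1, s2; split => //.
have hs := climD hs1 hs2.
have hs' : clim (fun K => \sum_(k < K) (pole_kernel (rC k%:R / rC a) * V (rC k%:R / rC a) i j +
      pole_kernel (rC (- k.+1%:R) / rC a) * V (rC (- k.+1%:R) / rC a) i j)) (s1 + s2).
  rewrite (_ : (fun K => _) = (fun n => \sum_(k < n) pole_kernel (rC k%:R / rC a) * V (rC k%:R /
    rC a) i j +
     \sum_(k < n) pole_kernel (rC (- k.+1%:R) / rC a) * V (rC (- k.+1%:R) / rC a) i j))//.
  by apply/funext => n; rewrite big_split.
apply: clim_unique hs' _.
pose f n k := pole_kernel (rC k%:R / rC a) * U n (rC k%:R / rC a) i j +
      pole_kernel (rC (- k.+1%:R) / rC a) * U n (rC (- k.+1%:R) / rC a) i j.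
pose S n := rC a * (U n (- Ci) i j - \sum_r pole_coef r * U n (p r) i j).
apply: (@tannery _ f (fun k => pole_kernel (rC k%:R / rC a) * V (rC k%:R / rC a) i j +
    pole_kernel (rC (- k.+1%:R) / rC a) * V (rC (- k.+1%:R) / rC a) i j) S _ (fun K => 2 * (C *
      B) / K%:R)).
- by move=> k; apply: climD; apply: climM; rewrite ?limU//; exact: clim_cst.
- apply: climM; first exact: clim_cst.
  apply: climB => //; apply: clim_sum => r _.
  by apply: climM => //; exact: clim_cst.
- move=> e e0; have [n0 h0] := exists_inv_lt (2 * (C * B)) e0; exists n0.+1 => -[//|K].
  by rewrite ltnS => /h0.
exists K0 => K KK; exists 0%N => n _; rewrite cnormB.
(* [S n] is the limit of the partial sums of [f n], so its distance to the K-th one is at most any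
   uniform bound on the blocks from K to m'. *)
apply: (@clim_le _ (fun K => \sum_(k < K) f n k) _ _ _ K _ (expsum_identity i j (expU n))) => m' Km.
rewrite -!(big_mkord xpredT (fun k => f n k)) (@big_cat_nat _ _ _ K)//= addrAC subrr add0r.
apply: le_trans (cnorm_sum _ _ _) _.
apply: (@le_trans _ _ (\sum_(K <= k < m') 2 * (C * B) * (k.+1%:R ^+ 2)^-1)).
  rewrite big_nat [leRHS]big_nat; apply: ler_sum => k /andP[Kk _].
  have hU x : cnorm (U n (rC x / rC a) i j) <= B by rewrite zE.
  have [h1 h2] := bd (U n) k hU (leq_trans KK Kk).
  apply: le_trans (cnormD _ _) _; apply: (le_trans (lerD h1 h2)).
  by rewrite -mulrDl; apply: ler_wpM2r; rewrite ?invr_ge0 ?sqr_ge0//; lra.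
rewrite -mulr_sumr; apply: ler_wpM2l; first by rewrite mulr_ge0.
apply: le_trans (sum_inv_sqr_le R (leq_trans K00 KK) Km) _.
by rewrite lerBlDr lerDl invr_ge0.
Qed.

End PoleExpansion.

(** Collects the entrywise limits into matrices; a single choice over index pairs provides both
    halves of the series. *)
Theorem texp_pole_expansion (R : realType) (N : nat) (T : R)
  (H L : R -> 'M[Cx R]_N) (al : R -> R) (a : R) (m : nat) (p : 'I_m -> Cx R) :
  0 < T -> mcont T H -> mcont T L ->
  (forall t, 0 <= t <= T -> hermitian_mx (H t)) ->
  (forall t, 0 <= t <= T -> hermitian_mx (L t)) ->
  (forall t, 0 <= t <= T -> psd_mx (L t)) ->
  (forall t, 0 <= t <= T -> top_eigenvalue (L t) (al t)) ->
  0 < a ->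
  (\int[lebesgue_measure]_(t in `[0%R, T]) (al t)%:E <= (2 * pi * a)%:E)%E ->
  (0 < m)%N -> injective p -> (forall r (k : int), p r != k%:~R / rC a) ->
  exists S : 'M[Cx R]_N,
    zseries_to (fun k : int => pole_kernel a p (k%:~R / rC a) *:
       texp (fun s => Ci *: (H s + (k%:~R / rC a) *: L s)) T) S /\
    texp (fun t => L t + Ci *: H t) T - (rC a)^-1 *: S
    - \sum_(r < m) pole_coef a p r *: texp (fun s => Ci *: (H s + p r *: L s)) T = 0.
Proof.
move=> T0 cH cL hH hL pL topL a0 intA m0 pI pZ.
have [U [expU bndU limU]] := trotter_approximation T0 cH cL hH hL pL topL intA.
pose V (z : Cx R) := texp (fun t => Ci *: (H t + z *: L t)) T.
have lim i j := limit_identity a0 m0 pI pZ expU bndU (V := V) limU i j.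
have {}lim (k : 'I_N * 'I_N) : exists s : Cx R * Cx R,
  [/\ clim (fun n => \sum_(l < n) pole_kernel a p (rC l%:R / rC a) * V (rC l%:R / rC a) k.1 k.2)
    s.1,
      clim (fun n => \sum_(l < n) pole_kernel a p (rC (- l.+1%:R) / rC a) * V (rC (- l.+1%:R) /
        rC a) k.1 k.2) s.2 &
      s.1 + s.2 = rC a * (V (- Ci) k.1 k.2 - \sum_r pole_coef a p r * V (p r) k.1 k.2)].
  by have [s1 [s2 h]] := lim k.1 k.2; exists (s1, s2).
have [s hs] := choice lim.
pose S1 := \matrix_(i, j) (s (i, j)).1 : 'M[Cx R]_N.
pose S2 := \matrix_(i, j) (s (i, j)).2 : 'M[Cx R]_N.
exists (S1 + S2); split.
  exists S1, S2; split; [|split=> //] => i j; rewrite mxE; have [h1 h2 _] := hs (i, j); apply/climP.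
    move: h1; congr clim; apply/funext => n; rewrite summxE; apply: eq_bigr => k _.
    by rewrite [RHS]mxE rmorph_nat.
  move: h2; congr clim; apply/funext => n; rewrite summxE; apply: eq_bigr => k _.
  by rewrite [RHS]mxE rmorphN /= rmorph_nat mulrNz.
have aC0 : rC a != 0 by rewrite -cnorm_eq0 cnorm_real normr_eq0 gt_eqF.
have -> : texp (fun t => L t + Ci *: H t) T = V (- Ci).
  (* i (H - i L) = L + i H, so the exponential of A is the value at z = - i. *)
  have -> : (fun t => L t + Ci *: H t) = (fun t => Ci *: (H t + - Ci *: L t)); last by [].
  by apply/funext => t; rewrite scalerDr scalerA mulrN CiCi opprK scale1r addrC.
apply/matrixP => i j; rewrite !mxE summxE; have [_ _ ->] := hs (i, j).
rewrite mulKf// opprB addrCA subrr addr0; apply/eqP; rewrite subr_eq0; apply/eqP.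
by apply: eq_bigr => r _; rewrite mxE.
Qed.

Unset Implicit Arguments.

Local Open Scope ring_scope.
Local Open Scope complex_scope.
Local Open Scope classical_set_scope.

Theorem theorem1 (R : realType) (N : nat) (T : R)
  (H L : R -> 'M[Cx R]_N) (alpha_max : R -> R) (a : R) (m : nat)
  (p : 'I_m -> Cx R) :
  0 < T ->
  (forall i j, {within `[0, T], continuous (fun t => H t i j)}) ->
  (forall i j, {within `[0, T], continuous (fun t => L t i j)}) ->
  (forall t, 0 <= t <= T -> hermitian_mx (H t)) ->
  (forall t, 0 <= t <= T -> hermitian_mx (L t)) ->
  (forall t, 0 <= t <= T -> psd_mx (L t)) ->
  (forall t, 0 <= t <= T ->
     eigenvalue (L t) (alpha_max t)%:C /\
     (forall lam : Cx R, eigenvalue (L t) lam -> lam <= (alpha_max t)%:C)) ->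
  0 < a ->
  (\int[lebesgue_measure]_(t in `[0%R, T]) (alpha_max t)%:E <= (2 * pi * a)%:E)%E ->
  (0 < m)%N ->
  injective p ->
  (forall r, p r != - 'i) ->
  (forall r (k : int), p r != k%:~R / a%:C) ->
  let A := fun t => L t + 'i *: H t in
  let c := (expR (- (2 * pi * a)))%:C - 1 : Cx R in
  exists S : 'M[Cx R]_N,
    zseries_to
      (fun k : int =>
         (c / ((2 * pi)%:C * 'i * (k%:~R / a%:C + 'i)
               * \prod_(r < m) ((k%:~R / a%:C - p r) / (- 'i - p r))))
         *: texp (fun s => 'i *: (H s + (k%:~R / a%:C) *: L s)) T) S /\
    texp A T
    - (a%:C)^-1 *: S
    - \sum_(r < m)
        (c / ((cexp (- (2 * pi)%:C * 'i * p r * a%:C) - 1)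
              * \prod_(r' < m | r' != r) ((p r - p r') / (- 'i - p r'))))
        *: texp (fun s => 'i *: (H s + p r *: L s)) T
    = 0.
Proof.
move=> T0 cH cL hH hL pL topL a0 intA m0 pI _ pZ A c.
apply: (@texp_pole_expansion R N T H L alpha_max a m p) => //.
- by move=> i j; apply/cont_onP; exact: cH.
- by move=> i j; apply/cont_onP; exact: cL.
Qed.
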